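(* Let $N$ be a Riemannian symmetric space, $M$ a simply connected Riemannian symmetric space with geodesic symmetries $\sigma^M_p$ ($p\in M$), and $f:M\to N$ a parallel isometric immersion. For each $p\in M$ there exists a unique involutive map $\Sigma_p:\mathcal{O}f\to\mathcal{O}f$ characterized by the following properties: (a) $\Sigma_p$ is a fibrewise isometric vector bundle homomorphism along $\sigma^M_p$, i.e. $\Sigma_p$ covers $\sigma^M_p$ and for each $q\in M$ the map $\Sigma_p|\mathcal{O}_qf:\mathcal{O}_qf\to\mathcal{O}_{\sigma^M_p(q)}f$ is a linear isometry. (b) $\Sigma_p$ is a $\nabla^{\mathcal{O}f}$-parallel vector bundle isomorphism of $\mathcal{O}f$. (c) $\Sigma_p|\mathcal{O}_pf$ is the linear reflection in $\bot^1_pf$. Moreover: (d) For all $q\in M$ and $x,y\in T_qM$: $\Sigma_p\,x=T\sigma^M_p\,x$ and $\Sigma_p\,h(x,y)=h(T\sigma^M_p\,x,T\sigma^M_p\,y)$. (e) For every smooth geodesic line $\gamma$ of $M$ with $\gamma(0)=p$ we have $\sigma^M_p(\gamma(-1))=\gamma(1)$, the restriction $\Sigma_p|T_{\gamma(-1)}M$ equals minus the parallel displacement $T_{\gamma(-1)}M\to T_{\gamma(1)}M$ along $\gamma$ with respect to $\nabla^M$, and $\Sigma_p|\bot^1_{\gamma(-1)}f$ equals the restriction to $\bot^1_{\gamma(-1)}f$ of the parallel displacement along $\gamma$ from $\gamma(-1)$ to $\gamma(1)$ in $\bot f$ with respect to $\nabla^\bot$. (f) If $M$ is a symmetric submanifold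 of $N$ (and $f$ the inclusion) with extrinsic symmetries $\sigma^\bot_p$ ($p\in M$), then $T\sigma^\bot_p(\mathcal{O}M)\subset\mathcal{O}M$ and $\Sigma_p=T\sigma^\bot_p|\mathcal{O}M:\mathcal{O}M\to\mathcal{O}M$.
   Context: For an isometric immersion $f:M\to N$ identify $T_pM$ with its image in $T_{f(p)}N$; $\bot f$ is the normal bundle with normal connection $\nabla^\bot$ and $h$ the second fundamental form. $f$ is parallel if $\nabla^\bot_X(h(Y,Z))=h(\nabla^M_XY,Z)+h(Y,\nabla^M_XZ)$. Put $\bot^1_pf:=\mathrm{span}_{\mathbb R}\{h(x,y)\mid x,y\in T_pM\}$ and $\mathcal{O}_pf:=T_pM\oplus\bot^1_pf\subset T_{f(p)}N$. For parallel $f$, the second osculating bundle $\mathcal{O}f=\bigcup_p\{p\}\times\mathcal{O}_pf$ is a $\nabla^N$-parallel subbundle of $f^*TN$; $\nabla^{\mathcal{O}f}$ is the connection on it obtained by restricting $\nabla^N$. For a submanifold $M\subset N$ one writes $\mathcal{O}M$ for $\mathcal{O}f$, where $f$ is the inclusion. A vector bundle homomorphism along $\sigma^M_p$ is parallel if it maps parallel sections along each curve $c$ to parallel sections along $\sigma^M_p\circ c$. The linear reflection of $\mathcal{O}_pf$ in $\bot^1_pf$ is $+\mathrm{id}$ on $\bot^1_pf$ and $-\mathrm{id}$ on $T_pM$. $M\subset N$ is a symmetric submanifold with extrinsic symmetries $\sigma^\bot_p$ if $M$ is a symmetric space and for each $p\in M$, $\sigma^\bot_p$ is an involutive isometry of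 $N$ with $\sigma^\bot_p(M)=M$, $\sigma^\bot_p|M=\sigma^M_p$, and $T_p\sigma^\bot_p$ is the linear reflection in $\bot_pM$. *)

(* Defs.v *)
From HB Require Import structures.
From mathcomp Require Import all_boot all_order all_algebra.
From mathcomp Require Import all_classical all_reals all_analysis.

Set Implicit Arguments.
Unset Strict Implicit.
Unset Printing Implicit Defensive.

Import Order.TTheory GRing.Theory Num.Theory.
Import numFieldNormedType.Exports.

Local Open Scope classical_set_scope.
Local Open Scope ring_scope.

(* [Ck k U F]: [F] is of class C^k on the open set [U].  For a finite
   dimensional [E], being C^(k+1) means being differentiable with all
   directional derivatives of class C^k. *)
Fixpoint Ck (R : realType) (E V : normedModType R) (k : nat) (U : set E)
    (F : E -> V) : Prop :=
  match k with
  | 0%N => forall x, U x -> {for x, continuous F}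
  | j.+1 => (forall x, U x -> differentiable F x) /\
            (forall v, Ck j U (fun x => 'D_v F x))
  end.

Definition smooth_on (R : realType) (E V : normedModType R) (U : set E)
    (F : E -> V) : Prop :=
  forall k, Ck k U F.

(* An n-dimensional manifold is a second countable Hausdorff space with a
   smooth atlas [chart p] (p in M) indexed by the points of the manifold, such
   that [p] belongs to the domain of [chart p].  Choosing for each point of M a
   chart around it turns any smooth atlas into one of this form.  The maps
   [chart p] and [chartI p] are total, but meaningful only on [cdom p] and
   [chart p @` cdom p].

   Since every point p comes with a chart, T_pM is represented by R^n: the row
   vector [v] stands for the tangent vector at p whose coordinates in the chart
   [chart p] are [v].  A tangent vector to M is thus a pair (p, v), and a vector
   field is a function M -> R^n. *)

Record smooth_manifold (R : realType) (n : nat) := SmoothManifold {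
  mpoint :> topologicalType;
  cdom : mpoint -> set mpoint;
  chart : mpoint -> mpoint -> 'rV[R]_n;
  chartI : mpoint -> 'rV[R]_n -> mpoint;
  hausdorffM : hausdorff_space mpoint;
  second_countableM : @second_countable mpoint;
  cdom_open : forall p, open (cdom p);
  cdom_center : forall p, cdom p p;
  chart_image_open : forall p, open (chart p @` cdom p);
  chartK : forall p q, cdom p q -> chartI p (chart p q) = q;
  chart_continuous : forall p q, cdom p q -> {for q, continuous (chart p)};
  chartI_continuous : forall p x, (chart p @` cdom p) x ->
    {for x, continuous (chartI p)};
  chart_transition : forall p q,
    smooth_on (chart p @` (cdom p `&` cdom q)) (chart q \o chartI p)
}.

Section Manifold.
Variables (R : realType) (n : nat) (M : smooth_manifold R n).

(* coordinates in the chart [chart p] of the tangent vector [v] at [q] *)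
Definition tchart (p q : M) (v : 'rV[R]_n) : 'rV[R]_n :=
  'd (chart p \o chartI q) (chart q q) v.

(* the tangent vector at the point [chartI p x] whose coordinates in the chart
   [chart p] are [v] *)
Definition tchartI (p : M) (x v : 'rV[R]_n) : 'rV[R]_n :=
  'd (chart (chartI p x) \o chartI p) x v.

(* Curves are parametrised by the whole real line; a curve on an open interval
   becomes one of these by a change of parameter, which affects neither
   smoothness nor parallelism. *)
Definition smooth_curve (c : R -> M) : Prop :=
  continuous c /\ forall q, smooth_on (c @^-1` cdom q) (chart q \o c).

Definition smooth_along_curve (c : R -> M) (V : R -> 'rV[R]_n) : Prop :=
  forall q, smooth_on (c @^-1` cdom q) (fun t => tchart q (c t) (V t)).

Definition velocity (c : R -> M) (t : R) : 'rV[R]_n :=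
  'D_1 (chart (c t) \o c) t.

End Manifold.

Section Maps.
Variables (R : realType) (m n : nat).
Variables (M : smooth_manifold R m) (N : smooth_manifold R n).

Definition smooth_map (f : M -> N) : Prop :=
  continuous f /\
  forall p q, smooth_on (chart p @` (cdom p `&` f @^-1` cdom q))
                        (chart q \o f \o chartI p).

(* the tangent map T_pf : T_pM -> T_(f p)N and its matrix (acting on rows) *)
Definition local_expr (f : M -> N) (p : M) : 'rV[R]_m -> 'rV[R]_n :=
  chart (f p) \o f \o chartI p.

Definition tmap (f : M -> N) (p : M) (x : 'rV[R]_m) : 'rV[R]_n :=
  'd (local_expr f p) (chart p p) x.

Definition tmap_mx (f : M -> N) (p : M) : 'M[R]_(m, n) :=
  'J (local_expr f p) (chart p p).

(* [W] is, on the open set [U], a smooth vector field along [f], that is, a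
   smooth section of f^*TN; [W q] belongs to T_(f q)N *)
Definition smooth_along (U : set M) (f : M -> N) (W : M -> 'rV[R]_n) : Prop :=
  forall p q,
    smooth_on (chart p @` (U `&` cdom p `&` f @^-1` cdom q))
              (fun x => tchart q (f (chartI p x)) (W (chartI p x))).

End Maps.

Definition smooth_field (R : realType) (m : nat) (M : smooth_manifold R m)
    (U : set M) (X : M -> 'rV[R]_m) : Prop :=
  smooth_along (N := M) U id X.

Definition bilin (R : realType) (n : nat) (G : 'M[R]_n) (u v : 'rV[R]_n) : R :=
  (u *m G *m v^T) 0 0.

(* Gram matrix, in the coordinates of [chart p] at [x], of the field of
   bilinear forms [g] *)
Definition gram (R : realType) (n : nat) (M : smooth_manifold R n)
    (g : M -> 'M[R]_n) (p : M) (x : 'rV[R]_n) : 'M[R]_n :=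
  \matrix_(i, j) bilin (g (chartI p x)) (tchartI p x (delta_mx 0 i))
                                        (tchartI p x (delta_mx 0 j)).

Record riemannian (R : realType) (n : nat) := Riemannian {
  rmanifold :> smooth_manifold R n;
  metric : rmanifold -> 'M[R]_n;
  metric_sym : forall p, (metric p)^T = metric p;
  metric_posdef : forall p v, v != 0 -> 0 < bilin (metric p) v v;
  metric_smooth : forall p,
    smooth_on (chart p @` cdom p) (gram metric p)
}.

Definition inner (R : realType) (n : nat) (M : riemannian R n) (p : M)
    (u v : 'rV[R]_n) : R :=
  bilin (metric p) u v.

Section LeviCivita.
Variables (R : realType) (n : nat) (N : riemannian R n).

(* The vector with components sum_(i,j) Gamma^k_(ij) u^i v^j, where
   Gamma^k_(ij) = 1/2 sum_l g^(kl) (d_i g_(jl) + d_j g_(il) - d_l g_(ij))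
   are the Christoffel symbols at [x] in the chart [chart p]. *)
Definition christoffel (p : N) (x u v : 'rV[R]_n) : 'rV[R]_n :=
  let G := gram (@metric R n N) p in
  (\row_l (2^-1 * ('D_u (fun y => bilin (G y) v (delta_mx 0 l)) x
                   + 'D_v (fun y => bilin (G y) u (delta_mx 0 l)) x
                   - 'D_(delta_mx 0 l) (fun y => bilin (G y) u v) x)))
    *m invmx (G x).

(* Pull-back of the Levi-Civita connection along a map [u : E -> N]:
   covariant derivative at [y], in the direction [v] of E, of the vector field
   [W] along [u].  It is computed in the chart attached to [u y], so its value
   is a vector of T_(u y)N. *)
Definition covd (E : normedModType R) (u : E -> N) (W : E -> 'rV[R]_n)
    (y v : E) : 'rV[R]_n :=
  'D_v (fun z => tchart (u y) (u z) (W z)) y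
  + christoffel (u y) (chart (u y) (u y)) ('D_v (chart (u y) \o u) y) (W y).

Definition covd_curve (c : R -> N) (V : R -> 'rV[R]_n) (t : R) : 'rV[R]_n :=
  covd c V t 1.

Definition parallel_along (c : R -> N) (V : R -> 'rV[R]_n) : Prop :=
  smooth_along_curve c V /\ forall t, covd_curve c V t = 0.

Definition geodesic_line (c : R -> N) : Prop :=
  smooth_curve c /\ forall t, covd_curve c (velocity c) t = 0.

(* graph of the parallel displacement T_(c a)N -> T_(c b)N along [c] *)
Definition parallel_displacement (c : R -> N) (a b : R) (x y : 'rV[R]_n) :=
  exists V, [/\ parallel_along c V, V a = x & V b = y].

End LeviCivita.

(* the covariant derivative at [p], in the direction [x] of T_pM, of the vector
   field [W] along [f : M -> N] *)
Definition nabla_along (R : realType) (m n : nat) (M : smooth_manifold R m)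
    (N : riemannian R n) (f : M -> N) (W : M -> 'rV[R]_n) (p : M)
    (x : 'rV[R]_m) : 'rV[R]_n :=
  covd (f \o chartI p) (W \o chartI p) (chart p p) x.

Definition nabla (R : realType) (m : nat) (M : riemannian R m)
    (Y : M -> 'rV[R]_m) (p : M) (x : 'rV[R]_m) : 'rV[R]_m :=
  nabla_along (id : M -> M) Y p x.

Section Symmetric.
Variables (R : realType) (n : nat) (M : riemannian R n).

Definition involutive_isometry (s : M -> M) : Prop :=
  [/\ smooth_map s, involutive s &
      forall p x y, inner (s p) (tmap s p x) (tmap s p y) = inner p x y].

(* An isometry fixing [p] with differential -id at [p] maps c(t) to c(-t) for
   each geodesic c with c(0) = p, so [s p] is the geodesic symmetry at [p]. *)
Definition symmetric_space (s : M -> M -> M) : Prop :=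
  connected [set: M] /\
  forall p, [/\ involutive_isometry (s p), s p p = p &
                forall x, tmap (s p) p x = - x].

End Symmetric.

(* path connected, and every loop is null-homotopic relative to its base point *)
Definition simply_connected (R : realType) (T : topologicalType) : Prop :=
  (forall x y : T, exists c : R -> T,
     [/\ {within `[0, 1]%classic, continuous c}, c 0 = x & c 1 = y]) /\
  (forall c : R -> T,
     {within `[0, 1]%classic, continuous c} -> c 0 = c 1 ->
     exists H : R * R -> T,
       [/\ {within `[0, 1]%classic `*` `[0, 1]%classic, continuous H},
           forall t, t \in `[0, 1] -> H (0, t) = c t,
           forall t, t \in `[0, 1] -> H (1, t) = c 0 &
           forall s, s \in `[0, 1] -> H (s, 0) = c 0 /\ H (s, 1) = c 0]).

Section Immersion.
Variables (R : realType) (m n : nat).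
Variables (M : riemannian R m) (N : riemannian R n) (f : M -> N).

Definition isometric_immersion : Prop :=
  smooth_map f /\
  forall p x y, inner (f p) (tmap f p x) (tmap f p y) = inner p x y.

(* the vector field near [p] with constant coordinates [y] in [chart p];
   its value at [p] is [y] *)
Definition const_field (p : M) (y : 'rV[R]_m) (q : M) : 'rV[R]_m :=
  tchartI p (chart p q) y.

(* h(X, Y) = nabla^N_X (Tf Y) - Tf (nabla^M_X Y); this is tensorial, so any
   local extension of [y] to a vector field can be used *)
Definition sff (p : M) (x y : 'rV[R]_m) : 'rV[R]_n :=
  let Y := const_field p y in
  nabla_along f (fun q => tmap f q (Y q)) p x - tmap f p (nabla Y p x).

Definition normal_space (p : M) (w : 'rV[R]_n) : Prop :=
  forall x, inner (f p) (tmap f p x) w = 0.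

(* For an isometric immersion, the tangential component of [w] is Tf x where x
   is determined by <x, y> = <w, Tf y> for all y. *)
Definition tangent_part (p : M) (w : 'rV[R]_n) : 'rV[R]_m :=
  w *m metric (f p) *m (tmap_mx f p)^T *m invmx (metric p).

Definition normal_part (p : M) (w : 'rV[R]_n) : 'rV[R]_n :=
  w - tmap f p (tangent_part p w).

Definition nabla_perp (xi : M -> 'rV[R]_n) (p : M) (x : 'rV[R]_m) :=
  normal_part p (nabla_along f xi p x).

Definition covd_perp_curve (c : R -> M) (xi : R -> 'rV[R]_n) (t : R) :=
  normal_part (c t) (covd_curve (f \o c) xi t).

(* graph of the parallel displacement in the normal bundle along [c] *)
Definition normal_displacement (c : R -> M) (a b : R) (v w : 'rV[R]_n) :=
  exists xi : R -> 'rV[R]_n,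
    [/\ forall t, normal_space (c t) (xi t),
        smooth_along_curve (f \o c) xi,
        forall t, covd_perp_curve c xi t = 0, xi a = v & xi b = w].

Definition parallel_immersion : Prop :=
  forall (U : set M) (X Y Z : M -> 'rV[R]_m), open U ->
  smooth_field U X -> smooth_field U Y -> smooth_field U Z ->
  forall p, U p ->
    nabla_perp (fun q => sff q (Y q) (Z q)) p (X p)
    = sff p (nabla Y p (X p)) (Z p) + sff p (Y p) (nabla Z p (X p)).

Definition first_normal_space (p : M) (w : 'rV[R]_n) : Prop :=
  exists (k : nat) (a : 'I_k -> R) (x y : 'I_k -> 'rV[R]_m),
    w = \sum_i a i *: sff p (x i) (y i).

Definition osc_space (p : M) (w : 'rV[R]_n) : Prop :=
  exists x xi, first_normal_space p xi /\ w = tmap f p x + xi.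

(* total space: pairs of a point q of M and a vector of O_q f in T_(f q)N *)
Record osc_bundle := OscVector {
  obase : M;
  ovec : 'rV[R]_n;
  ovecP : osc_space obase ovec
}.

(* The connection of the osculating bundle is the restriction of nabla^N. *)
Definition parallel_section (c : R -> M) (s : R -> osc_bundle) : Prop :=
  (forall t, obase (s t) = c t) /\ parallel_along (f \o c) (ovec \o s).

Definition smooth_section (U : set M) (s : M -> osc_bundle) : Prop :=
  (forall q, U q -> obase (s q) = q) /\ smooth_along U f (ovec \o s).

Section BundleMaps.
Variables (sigma : M -> M) (Sigma : osc_bundle -> osc_bundle).

(* Smoothness is tested on local smooth sections; [Sigma \o s] is then a section
   along [sigma]. *)
Definition bundle_hom_along : Prop :=
  [/\ forall e, obase (Sigma e) = sigma (obase e),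
      forall a e1 e2 e3, obase e1 = obase e3 -> obase e2 = obase e3 ->
        ovec e3 = a *: ovec e1 + ovec e2 ->
        ovec (Sigma e3) = a *: ovec (Sigma e1) + ovec (Sigma e2) &
      forall (U : set M) (s : M -> osc_bundle), open U -> smooth_section U s ->
        smooth_along U (f \o sigma) (ovec \o Sigma \o s)].

Definition fibrewise_isometric : Prop :=
  forall q e1 e2, obase e1 = q -> obase e2 = q ->
    inner (f (sigma q)) (ovec (Sigma e1)) (ovec (Sigma e2))
    = inner (f q) (ovec e1) (ovec e2).

Definition parallel_bundle_map : Prop :=
  forall (c : R -> M) (s : R -> osc_bundle), smooth_curve c ->
    parallel_section c s -> parallel_section (sigma \o c) (Sigma \o s).

(* on O_p f, [Sigma] is -id on T_pM and +id on the first normal space *)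
Definition reflection_at (p : M) : Prop :=
  forall e x xi, obase e = p -> first_normal_space p xi ->
    ovec e = tmap f p x + xi ->
    obase (Sigma e) = p /\ ovec (Sigma e) = - tmap f p x + xi.

End BundleMaps.

(* The submanifold is M itself, identified with its image under the injective
   immersion [f]; [s] are the geodesic symmetries of [M]. *)
Definition symmetric_submanifold (s : M -> M -> M) (sperp : M -> N -> N) :=
  [/\ isometric_immersion, injective f, symmetric_space s &
      forall p, [/\ involutive_isometry (sperp p),
        sperp p @` range f = range f,
        forall q, sperp p (f q) = f (s p q),
        forall x, tmap (sperp p) (f p) (tmap f p x) = - tmap f p x &
        forall xi, normal_space p xi -> tmap (sperp p) (f p) xi = xi]].

End Immersion.

(* Main.v *)
(* The tensor <h(x,y), h(z,w)> is parallel because h is; since sigma_p is an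
   isometry of the connected manifold M which fixes p with differential -id, the
   tensor is invariant under sigma_p.  Hence
     Tf x + sum_i h(x_i, y_i) |-> Tf(T sigma_p x) + sum_i h(T sigma_p x_i, T sigma_p y_i)
   is a well-defined fibrewise isometry Sigma_p.  Let E be a parallel frame along a
   curve c.  By the formulas of Gauss and Weingarten, a combination of the fields
   Tf E_i and h(E_i, E_j) is nabla^N-parallel as soon as its coefficients solve a
   linear system which involves only the metric, the velocity of c and the above
   tensor.  This system is the same for c and sigma_p o c, so Sigma_p is parallel;
   and a parallel map is determined by its value at p.  For (e), gamma(t) and
   sigma_p(gamma(-t)) are geodesics with the same initial data.  For (f), the second
   fundamental form of sigma^bot_p o f = f o sigma_p is computed in two ways. *)
From mathcomp Require Import all_boot all_order all_algebra.
From mathcomp Require Import all_classical all_reals all_analysis.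
From mathcomp Require Import ring lra.
Require Import Defs.
Set Implicit Arguments.
Unset Strict Implicit.
Unset Printing Implicit Defensive.
Import Order.TTheory GRing.Theory Num.Theory.
Import numFieldNormedType.Exports.
Local Open Scope classical_set_scope.
Local Open Scope ring_scope.

(** * Smooth functions between normed spaces *)

(** The vectors Tf x and h(x, y) span the osculating spaces but satisfy linear relations, and the
    dimension of the first normal space is not given; vectors are therefore handled through
    redundant presentations. The relations do no harm. The image of a combination has the same
    squared length as the combination, so a vanishing combination is sent to zero; and solving the
    coefficient system for a merely spanning family still yields a parallel field with the
    prescribed initial value. Only the smoothness of Sigma_p asks for a genuine frame. It exists
    near each point because the Gram matrix of the family spanned by a parallel frame is constant
    along curves, so the rank cannot jump. Curves live on the whole real line, so parallel fields
    must exist for all time: linear systems are solved locally and the solutions glued. Parallelism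
    of f is a hypothesis on vector fields over open sets of M and has to be transferred to fields
    given only along a curve. Identities spread over M by connectedness, through short curves inside
    charts. *)

Section NearDiff.
Context {R : realType} {V W : normedModType R}.
Implicit Types f g : V -> W.

Lemma near_eq_diff f g x : (\near x, f x = g x) -> differentiable f x ->
  differentiable g x /\ 'd g x = 'd f x :> (V -> W).
Proof.
move=> fg df.
have gE : g \o shift x = cst (g x) + 'd f x +o_ 0 id.
  apply/eqaddoP => _/posnumP[e].
  have /eqaddoP/(_ e%:num (gt0 e)) := diff_locally df.
  have fgx : f x = g x by exact: nbhs_singleton fg.
  move: fg; rewrite (near_shift 0) /= => fg.
  apply: filterS2 fg => h; rewrite subr0 /= => fgh.
  have gE : (g \o shift x) h = (f \o shift x) h by rewrite /= fgh.
  have -> : (g \o shift x - (cst (g x) + 'd f x)) h =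
            (f \o shift x - (cst (f x) + 'd f x)) h.
    by rewrite -[LHS]/((g \o shift x) h - (g x + 'd f x h)) gE -fgx.
  by [].
have dgE : 'd g x = 'd f x :> (V -> W).
  by apply: diff_unique => //; exact: diff_continuous.
split=> //; apply/diff_locallyP; rewrite dgE; split => //.
exact: diff_continuous.
Qed.

End NearDiff.

Section MatrixDiff.
Context {R : realType} {E : normedModType R}.

Lemma differentiable_mx m n (F : E -> 'M[R]_(m, n)) x :
  (forall i j, differentiable (fun y => F y i j) x) -> differentiable F x.
Proof.
move=> dF.
have -> : F = \sum_(i < m) \sum_(j < n) (fun y => F y i j *: delta_mx i j).
  apply/funext => y; rewrite fct_sumE [LHS]matrix_sum_delta.
  by apply: eq_bigr => i _; rewrite fct_sumE.
apply: differentiable_sum => i; apply: differentiable_sum => j.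
exact: differentiableZl.
Qed.

Lemma differentiable_entry m n (F : E -> 'M[R]_(m, n)) x i j :
  differentiable F x -> differentiable (fun y => F y i j) x.
Proof.
move=> dF; apply: (@differentiable_comp _ _ _ _ F (fun M => M i j)) => //.
exact: differentiable_coord.
Qed.

Lemma derive_entry m n (F : E -> 'M[R]_(m, n)) x v i j :
  differentiable F x -> ('D_v F x) i j = 'D_v (fun y => F y i j) x.
Proof. by move=> dF; rewrite derive_mx ?mxE//; exact: diff_derivable. Qed.

Lemma derive_comp (V W : normedModType R) (f : E -> V) (g : V -> W) x v :
  differentiable f x -> differentiable g (f x) ->
  'D_v (g \o f) x = 'd g (f x) ('D_v f x).
Proof.
move=> df dg; rewrite deriveE; last exact: differentiable_comp.
by rewrite diff_comp//= deriveE.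
Qed.

Lemma diffR_scale (V : normedModType R) (f : R -> V) x a :
  differentiable f x -> 'd f x a = a *: 'D_1 f x.
Proof. by move=> df; rewrite deriveE// -linearZ/= [_ *: _]mulr1. Qed.

Lemma diff_row_sum n (V : normedModType R) (f : 'rV[R]_n -> V) x v :
  differentiable f x -> 'd f x v = \sum_i v 0 i *: 'D_(delta_mx 0 i) f x.
Proof.
move=> df; rewrite [in LHS](row_sum_delta v) linear_sum.
by apply: eq_bigr => i _; rewrite linearZ deriveE.
Qed.

End MatrixDiff.

Section SmoothAt.
Context {R : realType}.

(** [Ck] at one point, so that smoothness depends only on the germ of F; chart expressions are
    meaningful only locally. *)
Fixpoint Cat (E V : normedModType R) (k : nat) (F : E -> V) (x : E) : Prop :=
  match k with
  | 0%N => {for x, continuous F}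
  | j.+1 => differentiable F x /\ forall v, Cat j (fun y => 'D_v F y) x
  end.

(** [Cat] at a single point says nothing about differentiability at nearby points, hence the
    neighbourhood. It is chosen before the order k, so one open set serves all orders, as
    [smooth_on] demands. *)
Definition smooth_at (E V : normedModType R) (F : E -> V) (x : E) :=
  \forall y \near x, forall k, Cat k F y.

Section General.
Context {E V : normedModType R}.
Implicit Types (F G : E -> V) (x v : E) (U : set E).

Lemma CkE k U F : Ck k U F <-> forall x, U x -> Cat k F x.
Proof.
elim: k F => [|k IH] F //=; split.
  move=> [dF CF] x Ux; split=> [|v]; first exact: dF.
  by move/IH: (CF v); exact.
move=> CF; split=> [x /CF[]//|v]; apply/IH => x /CF[_]; exact.
Qed.

Lemma smooth_onP U F : open U ->
  smooth_on U F <-> forall x, U x -> smooth_at F x.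
Proof.
move=> oU; split=> [sF x Ux|sF k].
  have := open_nbhs_nbhs (conj oU Ux); apply: filterS => y Uy k.
  by move/CkE: (sF k); exact.
by apply/CkE => x /sF /nbhs_singleton.
Qed.

Lemma smooth_at_near F x : smooth_at F x -> \near x, smooth_at F x.
Proof. by move=> /near_join. Qed.

Lemma smooth_at_diff F x : smooth_at F x -> differentiable F x.
Proof. by move=> /nbhs_singleton /(_ 1%N) []. Qed.

Lemma smooth_at_cont F x : smooth_at F x -> {for x, continuous F}.
Proof. by move=> /nbhs_singleton /(_ 0%N). Qed.

Lemma smooth_at_derive F x v : smooth_at F x -> smooth_at ('D_v F) x.
Proof. by apply: filterS => y CF k; have [_] := CF k.+1; exact. Qed.

Lemma Cat_ext k F G x : (\near x, F x = G x) -> Cat k F x -> Cat k G x.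
Proof.
elim: k F G => [|k IH] F G FG /=.
  have FGx := nbhs_singleton FG.
  move=> cF; change (G @ x --> G x); rewrite -FGx.
  by apply: cvg_trans cF; exact: near_eq_cvg.
move=> [dF CF]; split; first by have [] := near_eq_diff FG dF.
move=> v; apply: IH (CF v).
by move/near_join: FG; apply: filterS => y FG; exact: near_eq_derive.
Qed.

Lemma smooth_at_ext F G x : (\near x, F x = G x) -> smooth_at F x ->
  smooth_at G x.
Proof.
move=> /near_join FG CF; near=> y => k; apply: (@Cat_ext _ F).
  by near: y.
by move: k; near: y.
Unshelve. all: by end_near. Qed.

(** Higher derivatives never have to be computed: the induction on k treats all members of P at
    once, since a derivative of a member agrees on U with another member. Agreement on the open set
    U suffices because [Cat] depends on the germ only. *)
Lemma smooth_coind (P : (E -> V) -> Prop) U : open U ->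
  (forall F, P F -> (forall x, U x -> differentiable F x) /\
     forall v, exists2 G, P G & forall x, U x -> 'D_v F x = G x) ->
  forall F, P F -> forall x, U x -> smooth_at F x.
Proof.
move=> oU HP; suff CP k F x : P F -> U x -> Cat k F x.
  move=> F PF x Ux.
  by have := open_nbhs_nbhs (conj oU Ux); apply: filterS => y Uy k; exact: CP.
elim: k F x => [|k IH] F x PF Ux /=; have [dF DF] := HP F PF.
  exact/differentiable_continuous/dF.
split; first exact: dF.
move=> v; have [G PG GE] := DF v; apply: Cat_ext (IH G x PG Ux).
have := open_nbhs_nbhs (conj oU Ux).
by apply: filterS => y Uy; rewrite GE.
Qed.

Lemma smooth_on_diff U F x : smooth_on U F -> U x -> differentiable F x.
Proof. by move=> /(_ 1%N)[dF _] /dF. Qed.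

Lemma smooth_on_derive U F v : smooth_on U F -> smooth_on U ('D_v F).
Proof. by move=> sF k; have [_] := sF k.+1; exact. Qed.

Lemma smooth_at_on F x : smooth_at F x ->
  exists U, [/\ open U, U x & smooth_on U F].
Proof.
rewrite /smooth_at /prop_near1 nbhsE => -[U [oU Ux] sU].
by exists U; split => // k; apply/CkE => y /sU.
Qed.

Lemma smooth_on_at U F x : open U -> smooth_on U F -> U x -> smooth_at F x.
Proof. by move=> oU /(smooth_onP _ oU); exact. Qed.

Lemma smooth_at_cst (a : V) x : smooth_at (cst a) x.
Proof.
apply: (@smooth_coind (fun F => exists a, F = cst a) setT openT) => //.
  move=> F [{}a ->]; split=> [y _|v]; first exact: differentiable_cst.
  by exists (cst 0); [exists 0|move=> y _; rewrite derive_cst].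
by exists a.
Qed.

Lemma smooth_at_lin (F : {linear E -> V}) x : continuous F -> smooth_at F x.
Proof.
move=> cF; pose P (f : E -> V) := f = F \/ exists a, f = cst a.
apply: (@smooth_coind P setT openT) => //; last by left.
move=> f [->|[{}a ->]]; split=> [y _|v].
- exact: linear_differentiable.
- exists (cst (F v)); first by right; exists (F v).
  move=> y _; rewrite deriveE; last exact: linear_differentiable.
  by rewrite diff_lin.
- exact: differentiable_cst.
- by exists (cst 0); [right; exists 0|move=> y _; rewrite derive_cst].
Qed.

End General.

Section Algebra.
Context {E : normedModType R}.
Variable U : set E.
Hypothesis oU : open U.

(* Closing the smooth functions under algebra and composition gives a class
   stable under directional derivatives, to which coinduction applies. *)
Inductive smooth_alg : (E -> R) -> Prop :=
| SABase f : smooth_on U f -> smooth_alg f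
| SAAdd f g : smooth_alg f -> smooth_alg g -> smooth_alg (f + g)
| SAMul f g : smooth_alg f -> smooth_alg g -> smooth_alg (f * g)
| SAInv f : smooth_alg f -> (forall x, U x -> f x != 0) ->
    smooth_alg (fun x => (f x)^-1)
| SAComp n (A : set 'rV[R]_n) phi G : open A -> smooth_on A phi ->
    (forall x, U x -> A (G x)) ->
    (forall i, smooth_alg (fun x => G x 0 i)) -> smooth_alg (phi \o G)
| SAComp1 (A : set R) phi g : open A -> smooth_on A phi ->
    (forall x, U x -> A (g x)) -> smooth_alg g -> smooth_alg (phi \o g).

Lemma smooth_on_cst (V : normedModType R) (a : V) : smooth_on U (cst a).
Proof. by apply/smooth_onP => // x _; exact: smooth_at_cst. Qed.

Lemma smooth_alg_sum n (h : 'I_n -> E -> R) :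
  (forall i, smooth_alg (h i)) -> smooth_alg (\sum_i h i).
Proof.
move=> Hh; apply: (big_ind (fun f => smooth_alg f)) => //.
  exact/SABase/smooth_on_cst.
by move=> f g; exact: SAAdd.
Qed.

(** The sum, Leibniz, quotient and chain rules express the derivative of each constructor by
    constructors; partial derivatives of an outer function phi are again smooth on A, so [SAComp]
    and [SAComp1] reproduce themselves. *)
Lemma smooth_alg_derive f : smooth_alg f ->
  (forall x, U x -> differentiable f x) /\
  forall v, exists2 g, smooth_alg g & forall x, U x -> 'D_v f x = g x.
Proof.
elim=> {f}.
- move=> f sf; split=> [x|v]; first exact: smooth_on_diff.
  by exists ('D_v f) => //; exact/SABase/smooth_on_derive.
- move=> f g _ [df Df] _ [dg Dg]; split=> [x Ux|v].
    by apply: differentiableD; [exact: df|exact: dg].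
  have [f' af' f'E] := Df v; have [g' ag' g'E] := Dg v.
  exists (f' + g'); first exact: SAAdd.
  move=> x Ux; rewrite deriveD ?f'E ?g'E//; apply: diff_derivable.
    exact: df.
  exact: dg.
- move=> f g af [df Df] ag [dg Dg]; split=> [x Ux|v].
    by apply: differentiableM; [exact: df|exact: dg].
  have [f' af' f'E] := Df v; have [g' ag' g'E] := Dg v.
  exists (f * g' + g * f'); first by apply: SAAdd; exact: SAMul.
  move=> x Ux; rewrite deriveM ?f'E ?g'E//; apply: diff_derivable.
    exact: df.
  exact: dg.
- move=> f af [df Df] f0; split=> [x Ux|v].
    by apply: differentiableV; [exact: df|exact: f0].
  have [f' af' f'E] := Df v.
  exists (cst (-1) * ((fun x => (f x)^-1) * (fun x => (f x)^-1)) * f').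
    apply: SAMul => //; apply: SAMul.
      exact/SABase/smooth_on_cst.
    by apply: SAMul; exact: SAInv.
  move=> x Ux; rewrite deriveV ?f0//; last exact/diff_derivable/df.
  rewrite f'E// -[RHS]/(-1 * ((f x)^-1 * (f x)^-1) * f' x) mulN1r.
  by rewrite -invfM -expr2.
- move=> n A phi G oA sphi AG aG IH.
  have dG x : U x -> differentiable G x.
    move=> Ux; apply: differentiable_mx => i j.
    by have [d _] := IH j; rewrite ord1; exact: d.
  split=> [x Ux|v].
    apply: differentiable_comp; first exact: dG.
    by apply: smooth_on_diff sphi _; exact: AG.
  pose g' i := sval (cid2 ((IH i).2 v)).
  have ag' i : smooth_alg (g' i) by rewrite /g'; case: cid2.
  have g'E i x : U x -> 'D_v (fun x => G x 0 i) x = g' i x.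
    by rewrite /g'; case: cid2 => ? /= _; exact.
  exists (\sum_i (g' i * ('D_(delta_mx 0 i) phi \o G))).
    apply: smooth_alg_sum => i; apply: SAMul => //; apply: (SAComp oA) => //.
    exact: smooth_on_derive.
  move=> x Ux; have dphi : differentiable phi (G x).
    by apply: smooth_on_diff sphi _; exact: AG.
  rewrite derive_comp//; last exact: dG.
  rewrite diff_row_sum// fct_sumE; apply: eq_bigr => i _ /=.
  by rewrite derive_entry ?g'E//; exact: dG.
- move=> A phi g oA sphi Ag ag [dg Dg]; split=> [x Ux|v].
    apply: differentiable_comp; first exact: dg.
    by apply: smooth_on_diff sphi _; exact: Ag.
  have [g' ag' g'E] := Dg v.
  exists (g' * ('D_1 phi \o g)).
    apply: SAMul => //; apply: (SAComp1 oA) => //; exact: smooth_on_derive.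
  move=> x Ux; have dphi : differentiable phi (g x).
    by apply: smooth_on_diff sphi _; exact: Ag.
  rewrite derive_comp//; last exact: dg.
  by rewrite g'E// diffR_scale.
Qed.

Lemma smooth_alg_at f x : smooth_alg f -> U x -> smooth_at f x.
Proof. move=> af; exact: (smooth_coind oU smooth_alg_derive af). Qed.

End Algebra.
End SmoothAt.

Lemma continuous_near (T V : topologicalType) (F : T -> V) x (A : set V) :
  {for x, continuous F} -> open A -> A (F x) -> \forall y \near x, A (F y).
Proof. by move=> cF oA Ax; apply: cF; exact: open_nbhs_nbhs. Qed.

Lemma smooth_at_near_comp (R : realType) (D V W : normedModType R) (phi : V -> W)
    (c : D -> V) x : smooth_at phi (c x) -> {for x, continuous c} ->
  \forall y \near x, smooth_at phi (c y).
Proof. by move=> sphi cc; exact: (cc _ (smooth_at_near sphi)). Qed.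

Section SmoothAtOps.
Context {R : realType} {E : normedModType R}.
Implicit Types (f g : E -> R) (x v : E).

Lemma smooth_on_sub (V : normedModType R) (U U' : set E) (F : E -> V) :
  U' `<=` U -> smooth_on U F -> smooth_on U' F.
Proof. by move=> UU sF k; apply/CkE => x /UU; have /CkE := sF k; exact. Qed.

Lemma smooth_at2_on (V W : normedModType R) (F : E -> V) (G : E -> W) x :
  smooth_at F x -> smooth_at G x ->
  exists U, [/\ open U, U x, smooth_on U F & smooth_on U G].
Proof.
move=> /smooth_at_on[U [oU Ux sF]] /smooth_at_on[U' [oU' Ux' sG]].
exists (U `&` U'); split => //; first exact: openI.
  by apply: smooth_on_sub sF => y [].
by apply: smooth_on_sub sG => y [].
Qed.

Lemma smooth_atD f g x : smooth_at f x -> smooth_at g x ->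
  smooth_at (fun y => f y + g y) x.
Proof.
move=> sf sg; have [U [oU Ux {}sf {}sg]] := smooth_at2_on sf sg.
by apply: (smooth_alg_at oU) Ux; apply: (@SAAdd _ _ _ f g); exact: SABase.
Qed.

Lemma smooth_atM f g x : smooth_at f x -> smooth_at g x ->
  smooth_at (fun y => f y * g y) x.
Proof.
move=> sf sg; have [U [oU Ux {}sf {}sg]] := smooth_at2_on sf sg.
by apply: (smooth_alg_at oU) Ux; apply: (@SAMul _ _ _ f g); exact: SABase.
Qed.

Lemma smooth_atN f x : smooth_at f x -> smooth_at (fun y => - f y) x.
Proof.
move=> sf; apply: (@smooth_at_ext _ _ _ (fun y => -1 * f y)).
  by near=> y; rewrite mulN1r.
by apply: smooth_atM => //; exact: smooth_at_cst.
Unshelve. all: by end_near. Qed.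

Lemma smooth_atB f g x : smooth_at f x -> smooth_at g x ->
  smooth_at (fun y => f y - g y) x.
Proof. by move=> sf sg; apply: smooth_atD => //; exact: smooth_atN. Qed.

Lemma smooth_at_sum (I : Type) (r : seq I) (P : pred I) (f : I -> E -> R) x :
  (forall i, P i -> smooth_at (f i) x) ->
  smooth_at (fun y => \sum_(i <- r | P i) f i y) x.
Proof.
move=> sf; rewrite -fct_sumE; elim/big_ind : _ => //.
  exact: (smooth_at_cst (0 : R)).
by move=> F G; exact: smooth_atD.
Qed.

Lemma smooth_at_prod (I : Type) (r : seq I) (P : pred I) (f : I -> E -> R) x :
  (forall i, P i -> smooth_at (f i) x) ->
  smooth_at (fun y => \prod_(i <- r | P i) f i y) x.
Proof.
move=> sf; elim: r => [|i r IH].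
  apply: smooth_at_ext (smooth_at_cst (1 : R) x).
  by near=> y; rewrite big_nil.
case Pi : (P i); last first.
  by apply: smooth_at_ext IH; near=> y; rewrite big_cons Pi.
apply: (@smooth_at_ext _ _ _ (fun y => f i y * \prod_(i <- r | P i) f i y)).
  by near=> y; rewrite big_cons Pi.
by apply: smooth_atM => //; exact: sf.
Unshelve. all: by end_near. Qed.

Lemma smooth_atV f x : smooth_at f x -> f x != 0 ->
  smooth_at (fun y => (f y)^-1) x.
Proof.
move=> sf f0; have [U [oU Ux sU]] := smooth_at_on sf.
have nf0 : \forall y \near x, f y != 0.
  have op0 : open [set y : R | y != 0] by exact: open_neq.
  exact: (continuous_near (smooth_at_cont sf) op0).
move: nf0; rewrite /prop_near1 nbhsE => -[A [oA Ax] A0].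
apply: (@smooth_alg_at _ _ (U `&` A)) => //; first exact: openI.
apply: SAInv => [|y [_ /A0]//]; apply: SABase.
by apply: smooth_on_sub sU => y [].
Qed.

Lemma smooth_at_compR n (phi : 'rV[R]_n -> R) (G : E -> 'rV[R]_n) x :
  (forall i, smooth_at (fun y => G y 0 i) x) -> smooth_at phi (G x) ->
  smooth_at (fun y => phi (G y)) x.
Proof.
move=> sG /smooth_at_on[A [oA Ax sphi]].
have cG : {for x, continuous G}.
  apply: differentiable_continuous; apply: differentiable_mx => i j.
  by rewrite ord1; exact: smooth_at_diff.
have : \forall y \near x, A (G y).
  exact: continuous_near.
rewrite /prop_near1 nbhsE => -[B [oB Bx] BA].
have : \forall y \near x, forall i, smooth_at (fun y => G y 0 i) y.
  by apply: filter_forall => i; exact: smooth_at_near.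
rewrite /prop_near1 nbhsE => -[C [oC Cx] CG].
apply: (@smooth_alg_at _ _ (B `&` C)) => //; first exact: openI.
apply: (SAComp oA sphi) => [y [/BA]//|i].
apply: SABase; apply/smooth_onP; first exact: openI.
by move=> y [_ /CG].
Qed.

Lemma smooth_at_comp1R (phi : R -> R) (g : E -> R) x :
  smooth_at g x -> smooth_at phi (g x) -> smooth_at (fun y => phi (g y)) x.
Proof.
move=> sG /smooth_at_on[A [oA Ax sphi]].
have : \forall y \near x, A (g y).
  exact: (continuous_near (smooth_at_cont sG)).
rewrite /prop_near1 nbhsE => -[B [oB Bx] BA].
have [C [oC Cx CG]] := smooth_at_on sG.
apply: (@smooth_alg_at _ _ (B `&` C)) => //; first exact: openI.
apply: (SAComp1 oA sphi) => [y [/BA]//|].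
by apply: SABase; apply: smooth_on_sub CG => y [].
Qed.

(** Coinduction in both directions: on functions agreeing on U with an entry of a smooth matrix
    function, and on matrix functions all of whose entries are smooth. Entries commute with ['D_v]
    only where the matrix function is differentiable, so both classes are tied to an open U. *)
Lemma smooth_at_mxP m n (F : E -> 'M[R]_(m, n)) x :
  smooth_at F x <-> forall i j, smooth_at (fun y => F y i j) x.
Proof.
split=> [/smooth_at_on[U [oU Ux sF]] i j|sF].
  pose P (g : E -> R) := exists2 G : E -> 'M[R]_(m, n), smooth_on U G &
    forall y, U y -> G y i j = g y.
  apply: (@smooth_coind _ _ _ P U) => //; last by exists F.
  move=> {F sF}g [F sF Fg].
  have nFg y : U y -> \near y, F y i j = g y.
    by move=> Uy; apply: filterS (open_nbhs_nbhs (conj oU Uy)) => z; exact: Fg.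
  split=> [y Uy|v].
    have [] // := near_eq_diff (nFg y Uy); apply: differentiable_entry.
    exact: smooth_on_diff sF Uy.
  exists (fun y => ('D_v F y) i j).
    by exists ('D_v F) => //; exact: smooth_on_derive.
  move=> y Uy; rewrite derive_entry; last exact: smooth_on_diff sF Uy.
  by apply: near_eq_derive; apply: filterS (nFg y Uy) => z ->.
have : \forall y \near x, forall i j, smooth_at (fun y => F y i j) y.
  apply: filter_forall => i; apply: filter_forall => j.
  exact: smooth_at_near.
rewrite /prop_near1 nbhsE => -[U [oU Ux] UF].
pose P (F : E -> 'M[R]_(m, n)) :=
  forall y i j, U y -> smooth_at (fun y => F y i j) y.
apply: (@smooth_coind _ _ _ P U) => //.
  move=> {x Ux F sF UF}F UF.
  have dF y : U y -> differentiable F y.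
    move=> Uy; apply: differentiable_mx => i j; exact: smooth_at_diff (UF _ _ _ Uy).
  split=> // v; exists ('D_v F) => // y i j Uy.
  apply: smooth_at_ext (smooth_at_derive v (UF y i j Uy)).
  apply: filterS (open_nbhs_nbhs (conj oU Uy)) => z Uz.
  by rewrite derive_entry//; exact: dF.
by move=> y i j Uy; exact: UF.
Qed.

End SmoothAtOps.

Section SmoothAtMatrices.
Context {R : realType} {E : normedModType R}.
Implicit Types (f g : E -> R) (x v : E).

Section Matrices.
Variables (m n p : nat).
Implicit Types (F G : E -> 'M[R]_(m, n)) (H : E -> 'M[R]_(n, p)).

Lemma smooth_at_mxD F G x : smooth_at F x -> smooth_at G x ->
  smooth_at (fun y => F y + G y) x.
Proof.
move=> /smooth_at_mxP sF /smooth_at_mxP sG; apply/smooth_at_mxP => i j.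
apply: smooth_at_ext (smooth_atD (sF i j) (sG i j)).
by near=> y; rewrite mxE.
Unshelve. all: by end_near. Qed.

Lemma smooth_at_mxN F x : smooth_at F x -> smooth_at (fun y => - F y) x.
Proof.
move=> /smooth_at_mxP sF; apply/smooth_at_mxP => i j.
by apply: smooth_at_ext (smooth_atN (sF i j)); near=> y; rewrite mxE.
Unshelve. all: by end_near. Qed.

Lemma smooth_at_mxB F G x : smooth_at F x -> smooth_at G x ->
  smooth_at (fun y => F y - G y) x.
Proof. by move=> sF sG; apply: smooth_at_mxD => //; exact: smooth_at_mxN. Qed.

Lemma smooth_at_mxZ f F x : smooth_at f x -> smooth_at F x ->
  smooth_at (fun y => f y *: F y) x.
Proof.
move=> sf /smooth_at_mxP sF; apply/smooth_at_mxP => i j.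
by apply: smooth_at_ext (smooth_atM sf (sF i j)); near=> y; rewrite mxE.
Unshelve. all: by end_near. Qed.

Lemma smooth_at_mx_sum (I : Type) (r : seq I) (P : pred I)
    (F : I -> E -> 'M[R]_(m, n)) x :
  (forall i, P i -> smooth_at (F i) x) ->
  smooth_at (fun y => \sum_(i <- r | P i) F i y) x.
Proof.
move=> sf; rewrite -fct_sumE; elim/big_ind : _ => //.
  exact: (smooth_at_cst (0 : 'M[R]_(m, n))).
by move=> K G; exact: smooth_at_mxD.
Qed.

Lemma smooth_at_mulmx F H x : smooth_at F x -> smooth_at H x ->
  smooth_at (fun y => F y *m H y) x.
Proof.
move=> /smooth_at_mxP sF /smooth_at_mxP sH; apply/smooth_at_mxP => i j.
have : smooth_at (fun y => \sum_k F y i k * H y k j) x.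
  by apply: smooth_at_sum => k _; exact: smooth_atM.
by apply: smooth_at_ext; near=> y; rewrite mxE.
Unshelve. all: by end_near. Qed.

Lemma smooth_at_trmx F x : smooth_at F x -> smooth_at (fun y => (F y)^T) x.
Proof.
move=> /smooth_at_mxP sF; apply/smooth_at_mxP => i j.
by apply: smooth_at_ext (sF j i); near=> y; rewrite mxE.
Unshelve. all: by end_near. Qed.

Lemma smooth_at_comp k (phi : 'rV[R]_k -> 'M[R]_(m, n)) (G : E -> 'rV[R]_k) x :
  smooth_at G x -> smooth_at phi (G x) -> smooth_at (fun y => phi (G y)) x.
Proof.
move=> /smooth_at_mxP sG /smooth_at_mxP sphi; apply/smooth_at_mxP => i j.
by apply: (@smooth_at_compR _ _ k (fun y => phi y i j) G) => // l; exact: sG.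
Qed.

Lemma smooth_at_comp1 (phi : R -> 'M[R]_(m, n)) (g : E -> R) x :
  smooth_at g x -> smooth_at phi (g x) -> smooth_at (fun y => phi (g y)) x.
Proof.
move=> sg /smooth_at_mxP sphi; apply/smooth_at_mxP => i j.
exact: (@smooth_at_comp1R _ _ (fun y => phi y i j) g).
Qed.

(** Expanding w y in the standard basis replaces the differential, a function with values in linear
    maps, by finitely many partial derivatives of phi composed with c. *)
Lemma smooth_at_dapp k (phi : 'rV[R]_k -> 'M[R]_(m, n)) (c w : E -> 'rV[R]_k) x :
  smooth_at phi (c x) -> smooth_at c x -> smooth_at w x ->
  smooth_at (fun y => 'd phi (c y) (w y)) x.
Proof.
move=> sphi sc sw.
have nphi : \forall y \near x, smooth_at phi (c y).
  exact: smooth_at_near_comp sphi (smooth_at_cont sc).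
apply: (@smooth_at_ext _ _ _
  (fun y => \sum_i w y 0 i *: 'D_(delta_mx 0 i) phi (c y))).
  near=> y; rewrite diff_row_sum//.
  by apply: smooth_at_diff; near: y.
apply: smooth_at_mx_sum => i _; apply: smooth_at_mxZ.
  by move/smooth_at_mxP : sw; exact.
by apply: (@smooth_at_comp k ('D_(delta_mx 0 i) phi) c) => //; exact: smooth_at_derive.
Unshelve. all: by end_near. Qed.

End Matrices.

Lemma smooth_at_det n (A : E -> 'M[R]_n) x : smooth_at A x ->
  smooth_at (fun y => \det (A y)) x.
Proof.
move=> /smooth_at_mxP sA; apply: smooth_at_sum => s _; apply: smooth_atM.
  exact: smooth_at_cst.
by apply: smooth_at_prod => i _.
Qed.

(** Cramer's rule: near x the determinant stays nonzero, which settles the test inside [invmx], and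
    the inverse is the adjugate divided by the determinant. *)
Lemma smooth_at_invmx n (A : E -> 'M[R]_n) x : smooth_at A x ->
  A x \in unitmx -> smooth_at (fun y => invmx (A y)) x.
Proof.
move=> sA Ax; have dA := smooth_at_det sA.
have dAx : \det (A x) != 0 by rewrite -unitfE -unitmxE.
have nA : \forall y \near x, \det (A y) != 0.
  have op0 : open [set y : R | y != 0] by exact: open_neq.
  exact: (continuous_near (smooth_at_cont dA) op0).
apply: (@smooth_at_ext _ _ _ (fun y => (\det (A y))^-1 *: \adj (A y))).
  near=> y; rewrite /invmx unitmxE unitfE ifT//.
  by near: y.
apply: smooth_at_mxZ; first exact: smooth_atV.
apply/smooth_at_mxP => i j.
apply: (@smooth_at_ext _ _ _ (fun y => cofactor (A y) j i)).
  by near=> y; rewrite mxE.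
apply: smooth_atM; first exact: smooth_at_cst.
apply: smooth_at_det; apply/smooth_at_mxP => k l.
move/smooth_at_mxP: sA => /(_ (lift j k) (lift i l)); apply: smooth_at_ext.
by near=> y; rewrite !mxE.
Unshelve. all: by end_near. Qed.

Lemma smooth_at_bilin n (G : E -> 'M[R]_n) (u w : E -> 'rV[R]_n) x :
  smooth_at G x -> smooth_at u x -> smooth_at w x ->
  smooth_at (fun y => bilin (G y) (u y) (w y)) x.
Proof.
move=> sG su sw.
have /smooth_at_mxP := smooth_at_mulmx (smooth_at_mulmx su sG) (smooth_at_trmx sw).
by move=> /(_ 0 0).
Qed.

Lemma smooth_at_id x : smooth_at (fun y : E => y) x.
Proof. by apply: (@smooth_at_lin R E E idfun) => y; exact: cvg_id. Qed.

End SmoothAtMatrices.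

Local Opaque derive diff.

(** * Symmetry of second derivatives *)

Section Clairaut.
Context {R : realType} {E : normedModType R}.

Lemma is_derive_line (V : normedModType R) (F : E -> V) (u y : E) (s : R) :
  differentiable F (s *: u + y) ->
  is_derive s 1 (fun s => F (s *: u + y)) ('D_u F (s *: u + y)).
Proof.
move=> dF; pose L s := s *: u + y.
have dL : is_derive s 1 L u.
  rewrite -[u in is_derive _ _ _ u]addr0.
  apply: is_deriveD.
  have dS : is_diff s (fun s : R => s *: u) (fun s => s *: u).
    exact: is_diff_scalel.
  apply: DeriveDef; first exact/diff_derivable.
  by rewrite deriveE// diff_val scale1r.
have dLf : differentiable L s.
  by apply/derivable1_diffP; exact: ex_derive.
have dLF := differentiable_comp dLf dF.
apply: DeriveDef; first exact: diff_derivable.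
by rewrite (derive_comp _ dLf dF) derive_val deriveE.
Qed.

(** The mean value theorem twice: for the increment of F over h v as a function of s, then for D_u F
    as a function of t at the s just found. *)
Lemma second_difference (F : E -> R) (x u v : E) (h : R) : 0 < h ->
  (forall s t, 0 <= s <= h -> 0 <= t <= h ->
     differentiable F (s *: u + (t *: v + x)) /\
     differentiable ('D_u F) (s *: u + (t *: v + x))) ->
  exists s t, [/\ 0 <= s <= h, 0 <= t <= h &
    F (h *: u + (h *: v + x)) - F (h *: u + x) - (F (h *: v + x) - F x) =
    'D_v ('D_u F) (s *: u + (t *: v + x)) * h * h].
Proof.
move=> h0 HF.
have hh : 0 <= h <= h by rewrite (ltW h0) lexx.
have h00 : 0 <= (0 : R) <= h by rewrite (ltW h0) lexx.
pose g (s : R) := F (s *: u + (h *: v + x)) - F (s *: u + x).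
have dg s : 0 <= s <= h -> is_derive s 1 g
    ('D_u F (s *: u + (h *: v + x)) - 'D_u F (s *: u + x)).
  move=> sh; apply: is_deriveB; apply: is_derive_line.
    by have [] := HF s h sh hh.
  by have [] := HF s 0 sh h00; rewrite scale0r add0r.
have [s + gE] : exists2 s, s \in `]0, h[ & g h - g 0 =
    ('D_u F (s *: u + (h *: v + x)) - 'D_u F (s *: u + x)) * (h - 0).
  apply: (MVT (f := g) (df := fun s => 'D_u F (s *: u + (h *: v + x)) - 'D_u F (s *: u + x)) h0).
    by move=> s; rewrite in_itv/= => /andP[? ?]; apply: dg; rewrite !ltW.
  apply: derivable_within_continuous => s; rewrite in_itv/= => sh.
  by have [] := dg s sh.
rewrite in_itv/= => /andP[s0 sh].
have {s0}{}sh : 0 <= s <= h by rewrite !ltW.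
pose k (t : R) := 'D_u F (s *: u + (t *: v + x)).
have kE t : k t = 'D_u F (t *: v + (s *: u + x)) by rewrite /k addrCA.
have dk t : 0 <= t <= h ->
    is_derive t 1 k ('D_v ('D_u F) (s *: u + (t *: v + x))).
  move=> th; rewrite (funext kE) addrCA; apply: is_derive_line.
  by rewrite addrCA; have [] := HF s t sh th.
have [t + kh] : exists2 t, t \in `]0, h[ & k h - k 0 =
    'D_v ('D_u F) (s *: u + (t *: v + x)) * (h - 0).
  apply: (MVT (f := k) (df := fun t => 'D_v ('D_u F) (s *: u + (t *: v + x))) h0).
    by move=> t; rewrite in_itv/= => /andP[? ?]; apply: dk; rewrite !ltW.
  apply: derivable_within_continuous => t; rewrite in_itv/= => th.
  by have [] := dk t th.
rewrite in_itv/= => /andP[t0 th].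
exists s, t; split => //; first by rewrite !ltW.
move: gE kh; rewrite /g /k !scale0r !add0r !subr0 => -> ->.
by rewrite -mulrA.
Qed.

(** The second difference of F over a parallelogram with sides h u and h v is symmetric in u and v,
    so the two mixed derivatives take a common value, at two possibly different points of it.
    Continuity puts each within e/2 of its value at x. *)
Lemma clairautR (F : E -> R) (x u v : E) : smooth_at F x ->
  'D_u ('D_v F) x = 'D_v ('D_u F) x.
Proof.
move=> sF; apply/eqP; rewrite -subr_eq0 -normr_le0.
apply/ler_addgt0Pl => e e0; rewrite addr0.
have nF : \forall y \near x, smooth_at F y /\
    (`|'D_u ('D_v F) x - 'D_u ('D_v F) y| < e / 2 /\
    `|'D_v ('D_u F) x - 'D_v ('D_u F) y| < e / 2).
  have c1 := smooth_at_cont (smooth_at_derive u (smooth_at_derive v sF)).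
  have c2 := smooth_at_cont (smooth_at_derive v (smooth_at_derive u sF)).
  have e20 : 0 < e / 2 by rewrite divr_gt0.
  move/cvgrPdist_lt : c1 => /(_ _ e20) c1; move/cvgrPdist_lt : c2 => /(_ _ e20) c2.
  apply: filterS3 (smooth_at_near sF) c1 c2 => y sy d1 d2.
  split; [exact: sy|split; [exact: d1|exact: d2]].
move/nbhs_ballP : nF => -[r /= r0 rF].
(* Small enough for the closed parallelogram to lie within r/2 of x; the summand 1 keeps the
   denominator positive when u = v = 0. *)
pose h := r / (2 * (1 + `|u| + `|v|)).
have K0 : 0 < 1 + `|u| + `|v| by rewrite -addrA ltr_wpDr ?addr_ge0.
have h0 : 0 < h by rewrite divr_gt0// mulr_gt0.
have inB s t : 0 <= s <= h -> 0 <= t <= h -> ball x r (s *: u + (t *: v + x)).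
  move=> /andP[s0 sh] /andP[t0 th].
  rewrite -ball_normE /ball_/= addrA opprD addrCA subrr addr0 normrN.
  apply: le_lt_trans (ler_normD _ _) _; rewrite !normrZ !ger0_norm//.
  apply: (@le_lt_trans _ _ (h * (1 + `|u| + `|v|))).
    rewrite !mulrDr mulr1 -addrA; apply: ler_wpDl; first exact: ltW.
    by apply: lerD; apply: ler_wpM2r.
  rewrite /h invfM mulrA -mulrA mulVf ?gt_eqF// mulr1.
  by rewrite ltr_pdivrMr// ltr_pMr// ltr1n.
have [s [t [sh th E1]]] : exists s t, [/\ 0 <= s <= h, 0 <= t <= h &
    F (h *: u + (h *: v + x)) - F (h *: u + x) - (F (h *: v + x) - F x) =
    'D_v ('D_u F) (s *: u + (t *: v + x)) * h * h].
  apply: second_difference => // s t sh th.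
  have [sFy _] := rF _ (inB s t sh th).
  split; apply: smooth_at_diff => //; exact: smooth_at_derive.
have [s' [t' [sh' th' E2]]] : exists s t, [/\ 0 <= s <= h, 0 <= t <= h &
    F (h *: v + (h *: u + x)) - F (h *: v + x) - (F (h *: u + x) - F x) =
    'D_u ('D_v F) (s *: v + (t *: u + x)) * h * h].
  apply: second_difference => // s' t' sh' th'.
  have [sFy _] := rF _ (inB t' s' th' sh'); rewrite addrCA in sFy.
  split; apply: smooth_at_diff => //; exact: smooth_at_derive.
have E12 : 'D_v ('D_u F) (s *: u + (t *: v + x)) =
           'D_u ('D_v F) (s' *: v + (t' *: u + x)).
  have h0' : h != 0 by rewrite gt_eqF.
  move: E1 E2; move: ('D_v _ _) ('D_u _ _) => a b E1 E2.
  apply: (mulIf h0'); apply: (mulIf h0'); rewrite -E1 -E2.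
  by rewrite [h *: v + (h *: u + x)]addrCA; ring.
have [_ [_ B1]] := rF _ (inB s t sh th).
have [_ [B2 _]] := rF _ (inB t' s' th' sh').
rewrite addrCA -E12 in B2.
move: B1 B2; move: ('D_v ('D_u F) (_ + _)) ('D_v ('D_u F) x) ('D_u ('D_v F) x).
move=> c a b B1 B2; rewrite -(subrKA c); apply: le_trans (ler_normD _ _) _.
by rewrite (splitr e); apply: lerD; [exact: ltW|rewrite distrC; exact: ltW].
Qed.

Lemma clairaut m n (F : E -> 'M[R]_(m, n)) (x u v : E) : smooth_at F x ->
  'D_u ('D_v F) x = 'D_v ('D_u F) x.
Proof.
move=> sF; have sFij := (smooth_at_mxP _ _).1 sF.
apply/matrixP => i j.
have dDF w : differentiable ('D_w F) x.
  by apply: smooth_at_diff; exact: smooth_at_derive.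
have E1 := derive_entry u i j (dDF v).
have E2 := derive_entry v i j (dDF u).
rewrite [LHS]E1 [RHS]E2.
have H w : \near x, ('D_w F x) i j = 'D_w (fun y => F y i j) x.
  apply: filterS (smooth_at_near sF) => y sFy.
  by rewrite derive_entry//; exact: smooth_at_diff.
rewrite [LHS](near_eq_derive _ (H v)) [RHS](near_eq_derive _ (H u)).
exact: clairautR.
Qed.

End Clairaut.

Section Hessian.
Context {R : realType}.
Variables (m n : nat).
Implicit Types (F : 'rV[R]_m -> 'rV[R]_n) (x u v : 'rV[R]_m).

Definition hess F x u v : 'rV[R]_n := 'D_u ('D_v F) x.

Lemma hessC F x u v : smooth_at F x -> hess F x u v = hess F x v u.
Proof. exact: clairaut. Qed.

Lemma hess_suml F x u v : smooth_at F x ->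
  hess F x u v = \sum_i u 0 i *: hess F x (delta_mx 0 i) v.
Proof.
move=> sF; have dF : differentiable ('D_v F) x.
  exact/smooth_at_diff/smooth_at_derive.
by rewrite /hess deriveE// diff_row_sum.
Qed.

Lemma hess_sumr F x u v : smooth_at F x ->
  hess F x u v = \sum_i v 0 i *: hess F x u (delta_mx 0 i).
Proof.
move=> sF; rewrite (hessC u v sF) (hess_suml v u sF).
by apply: eq_bigr => i _; rewrite (hessC _ u sF).
Qed.

(** Leibniz on the expansion of w in the standard basis. Recombining the second derivatives uses
    linearity of [hess] in its second slot, which rests on the symmetry of second derivatives. *)
Lemma derive_dapp (E : normedModType R) F (c w : E -> 'rV[R]_m) z e :
  smooth_at F (c z) -> differentiable c z -> differentiable w z ->
  differentiable (fun y => 'd F (c y) (w y)) z /\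
  'D_e (fun y => 'd F (c y) (w y)) z =
  hess F (c z) ('D_e c z) (w z) + 'd F (c z) ('D_e w z).
Proof.
move=> sF dc dw.
have nF : \near z, \sum_i w z 0 i *: 'D_(delta_mx 0 i) F (c z) =
                   'd F (c z) (w z).
  apply: filterS (smooth_at_near_comp sF (differentiable_continuous dc)) => y sFy.
  by rewrite diff_row_sum//; exact: smooth_at_diff.
have dwi i : differentiable (fun y => w y 0 i) z by exact: differentiable_entry.
have dDc i : differentiable (fun y => 'D_(delta_mx 0 i) F (c y)) z.
  apply: (differentiable_comp (f := c) (g := 'D_(delta_mx 0 i) F)) => //.
  exact/smooth_at_diff/smooth_at_derive.
have dT i : differentiable (fun y => w y 0 i *: 'D_(delta_mx 0 i) F (c y)) z.
  apply: differentiable_mx => a b.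
  have -> : (fun y => (w y 0 i *: 'D_(delta_mx 0 i) F (c y)) a b) =
     (fun y => w y 0 i) * (fun y => 'D_(delta_mx 0 i) F (c y) a b).
    by apply/funext => y; rewrite mxE.
  by apply: differentiableM => //; exact: differentiable_entry.
have dS : differentiable (fun y => \sum_i w y 0 i *: 'D_(delta_mx 0 i) F (c y)) z.
  by rewrite -fct_sumE; exact: differentiable_sum.
split; first by have [] := near_eq_diff nF dS.
rewrite -(near_eq_derive _ nF) -fct_sumE derive_sum; last first.
  by move=> i; exact: diff_derivable.
rewrite (hess_sumr _ _ sF) [in X in _ + X]diff_row_sum; last exact: smooth_at_diff.
rewrite -big_split/=; apply: eq_bigr => i _.
apply/rowP => b.
rewrite derive_entry//.
have -> : (fun y => (w y 0 i *: 'D_(delta_mx 0 i) F (c y)) 0 b) =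
     (fun y => w y 0 i) * (fun y => 'D_(delta_mx 0 i) F (c y) 0 b).
  by apply/funext => y; rewrite mxE.
rewrite deriveM; try exact/diff_derivable/differentiable_entry.
rewrite -(derive_entry e 0 b (dDc i)) -(derive_entry e 0 i dw).
have dDi : differentiable ('D_(delta_mx 0 i) F) (c z).
  by apply: smooth_at_diff; exact: smooth_at_derive.
have HE : hess F (c z) ('D_e c z) (delta_mx 0 i) =
    'D_e (fun y => 'D_(delta_mx 0 i) F (c y)) z.
  by rewrite [LHS](deriveE _ dDi) [RHS](derive_comp e dc dDi).
rewrite -HE !mxE /= [_ *: 'D_e w z 0 i]mulrC.
by [].
Qed.

End Hessian.

(** * Ordinary differential equations *)

(** The local hypothesis is symmetric in y and z, so P and its complement are both relatively open
    in A. *)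
Lemma connected_const (T : topologicalType) (A : set T) (P : T -> Prop) :
  connected A ->
  (forall x, A x -> exists U, [/\ open U, U x &
     forall y z, A y -> A z -> U y -> U z -> P y -> P z]) ->
  forall x y, A x -> A y -> P x -> P y.
Proof.
move=> cA loc x y Ax Ay Px.
pose B := A `&` P.
have oU (Q : T -> Prop) : (forall y z U, A y -> A z -> U y -> U z ->
    (forall y z, A y -> A z -> U y -> U z -> P y -> P z) -> Q y -> Q z) ->
    exists2 C, open C & A `&` Q = A `&` C.
  move=> HQ.
  exists (\bigcup_(U in [set U | open U /\ forall y z, A y -> A z -> U y -> U z -> Q y -> Q z]
     `&` [set U | exists2 z, A z /\ U z & Q z]) U).
    by apply: bigcup_open => U [[]].
  apply/seteqP; split => z /= [Az Hz]; split => //.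
    have [U [oU Uz UP]] := loc z Az.
    exists U => //; split; last by exists z.
    by split => // y1 z1 Ay1 Az1 Uy1 Uz1; apply: (HQ y1 z1 U).
  by case: Hz => U [[_ UQ] [w [Aw Uw] Qw]] Uz; exact: (UQ w z).
have BA : B = A.
  apply: cA; first by exists x.
    by apply: oU => y1 z1 U Ay1 Az1 Uy1 Uz1; exact.
  have [C oC CE] : exists2 C, open C & A `&` (~` P) = A `&` C.
    apply: oU => y1 z1 U Ay1 Az1 Uy1 Uz1 UP nP /(UP z1 y1 Az1 Ay1 Uz1 Uy1).
    exact: nP.
  exists (~` C); first exact: open_closedC.
  apply/seteqP; split => z [Az Hz]; split => //.
    by move=> Cz; have [] : (A `&` (~` P)) z by rewrite CE.
  apply: contrapT => nPz; apply: Hz.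
  by have [] : (A `&` C) z by rewrite -CE.
by have [] : B y by rewrite BA.
Qed.

Section RealFunctions.
Context {R : realType}.

Lemma itv_const (a b : R) (P : R -> Prop) :
  (forall t : R, a < t < b -> exists2 e, 0 < e &
     forall s u, a < s < b -> a < u < b -> `|t - s| < e -> `|t - u| < e -> P s -> P u) ->
  forall s t, a < s < b -> a < t < b -> P s -> P t.
Proof.
move=> loc s t sab tab.
have cI : connected [set` `]a, b[].
  exact/connected_intervalP/interval_is_interval.
apply: (connected_const cI); last 2 first.
- by rewrite /= in_itv.
- by rewrite /= in_itv.
move=> x; rewrite /= in_itv/= => /loc[e e0 He].
exists (ball x e); split; [exact: ball_open|exact: ballxx|].
move=> y z; rewrite /= !in_itv/= -ball_normE/= => yab zab xy xz.
exact: He.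
Qed.

Lemma derive0_const_itv (f : R -> R) (a b : R) :
  (forall t : R, a < t < b -> is_derive t 1 f 0) ->
  forall s t, a < s < b -> a < t < b -> f s = f t.
Proof.
move=> df; suff H s t : a < s < b -> a < t < b -> s <= t -> f s = f t.
  move=> s t sab tab; have [st|ts] := leP s t; first exact: H.
  by apply/esym/H => //; exact: ltW.
move=> /andP[as_ sb] /andP[at_ tb] st.
have [c _ /eqP] : exists2 c, c \in `[s, t] & f t - f s = 0 * (t - s).
  apply: (MVT_segment (df := fun=> 0)) => // [x|].
    rewrite in_itv/= => /andP[sx xt]; apply: df.
    by rewrite (lt_trans as_)//= (lt_trans _ tb).
  apply: derivable_within_continuous => x; rewrite in_itv/= => /andP[sx xt].
  have [|dx _] := df x _ => //.
  by rewrite (lt_le_trans as_)//= (le_lt_trans _ tb).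
by rewrite mul0r subr_eq0 => /eqP.
Qed.

Lemma derive0_const (f : R -> R) : (forall t : R, is_derive t 1 f 0) ->
  forall s t, f s = f t.
Proof.
by move=> df s t; exact: is_derive_0_is_cst.
Qed.

(* f e^{-Kt} is nonincreasing and f e^{Kt} nondecreasing. *)
Lemma gronwall0 (f df : R -> R) (a b K s : R) :
  (forall t : R, a < t < b -> 0 <= f t) ->
  (forall t : R, a < t < b -> is_derive t 1 f (df t)) ->
  (forall t : R, a < t < b -> `|df t| <= K * f t) ->
  a < s < b -> f s = 0 -> forall t, a < t < b -> f t = 0.
Proof.
move=> f0 dfE dfK /andP[as_ sb] fs t /andP[at_ tb].
have dexp (k x : R) : is_derive x 1 (fun x => expR (k * x)) (k * expR (k * x)).
  have H1 : is_derive x 1 (fun x : R => k * x) (k * 1) by exact: is_deriveZ.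
  have := @is_derive1_comp _ expR (fun x => k * x) x _ _ (is_derive_expR (k * x)) H1.
  by rewrite mulr1 mulrC.
pose g (k x : R) := f x * expR (k * x).
have dg k x : a < x < b -> is_derive x 1 (g k) ((k * f x + df x) * expR (k * x)).
  move=> xab; have dfx := dfE x xab.
  have := is_deriveM dfx (dexp k x).
  by rewrite /GRing.scale/= => H; apply: is_derive_eq H _; ring.
have mvt k u v : a < u -> v < b -> u <= v -> exists2 c, u <= c <= v &
    g k v - g k u = (k * f c + df c) * expR (k * c) * (v - u).
  move=> au vb uv.
  have [c cuv E] : exists2 c, c \in `[u, v] &
      g k v - g k u = (k * f c + df c) * expR (k * c) * (v - u).
    apply: (MVT_segment (df := fun c => (k * f c + df c) * expR (k * c))) => // [x|].
      rewrite in_itv/= => /andP[ux xv]; apply: dg.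
      by rewrite (lt_trans au)//= (lt_trans _ vb).
    apply: derivable_within_continuous => x; rewrite in_itv/= => /andP[ux xv].
    have [|dx _] := dg k x _ => //.
    by rewrite (lt_le_trans au)//= (le_lt_trans _ vb).
  by exists c => //; rewrite in_itv in cuv.
have gE k x : g k x <= 0 -> a < x < b -> f x = 0.
  rewrite /g pmulr_lle0 ?expR_gt0// => fx xab.
  by apply/eqP; rewrite eq_le fx f0.
have [st|ts] := leP s t.
- apply: (gE (- K)); last by rewrite at_ tb.
  have [c /andP[sc ct] E] := mvt (- K) s t as_ tb st.
  have : g (- K) t - g (- K) s <= 0.
    rewrite E mulr_le0_ge0 ?subr_ge0// mulr_le0_ge0 ?expR_ge0//.
    have cab : a < c < b by rewrite (lt_le_trans as_)//= (le_lt_trans ct).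
    have := dfK c cab; rewrite ler_norml mulNr => /andP[_]; lra.
  by rewrite /g fs mul0r subr0.
- apply: (gE K); last by rewrite at_ tb.
  have [c /andP[tc cs] E] := mvt K t s at_ sb (ltW ts).
  have : 0 <= g K s - g K t.
    rewrite E mulr_ge0 ?subr_ge0 ?(ltW ts)// mulr_ge0 ?expR_ge0//.
    have cab : a < c < b by rewrite (lt_le_trans at_)//= (le_lt_trans cs).
    have := dfK c cab; rewrite ler_norml => /andP[]; lra.
  by rewrite /g fs mul0r sub0r oppr_ge0.
Qed.

Lemma entry_le_norm m n (A : 'M[R]_(m, n)) i j : `|A i j| <= `|A|.
Proof.
rewrite [leRHS]/Num.Def.normr/= mx_normrE.
exact: (le_bigmax _ (fun ij : 'I_m * 'I_n => `|A ij.1 ij.2|) (i, j)).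
Qed.

Lemma norm_mx_le m n (A : 'M[R]_(m, n)) K : 0 <= K ->
  (forall i j, `|A i j| <= K) -> `|A| <= K.
Proof.
move=> K0 AK; rewrite [leLHS]/Num.Def.normr/= mx_normrE.
by apply: bigmax_le => // ij _.
Qed.

(** Scalar Gronwall for the sum of squares, which is differentiable while the maximum norm is not:
    each |w_i w_i'| is at most K |w|^2, whence the constant 2nK. *)
Lemma gronwall_rV n (w dw : R -> 'rV[R]_n) (a b K s : R) : 0 <= K ->
  (forall t : R, a < t < b -> is_derive t 1 w (dw t)) ->
  (forall t : R, a < t < b -> `|dw t| <= K * `|w t|) ->
  a < s < b -> w s = 0 -> forall t, a < t < b -> w t = 0.
Proof.
move=> K0 wE wK sab ws.
pose f t := \sum_i w t 0 i ^+ 2.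
have f0 t : 0 <= f t by apply: sumr_ge0 => i _; exact: sqr_ge0.
have w2 t : `|w t| ^+ 2 <= f t.
  have [->|wt0] := eqVneq (w t) 0; first by rewrite normr0 expr0n.
  rewrite -[leRHS]sqr_sqrtr// lerXn2r ?nnegrE ?sqrtr_ge0//.
  apply: norm_mx_le => [|i j]; first exact: sqrtr_ge0.
  rewrite -(sqrtr_sqr (w t i j)) ler_wsqrtr// /f ord1 (bigD1 j)//= lerDl.
  by apply: sumr_ge0 => k _; exact: sqr_ge0.
pose df t := \sum_i (w t 0 i * dw t 0 i + w t 0 i * dw t 0 i).
have fE t : a < t < b -> is_derive t 1 f (df t).
  move=> tab; have [dwt dwE] := wE t tab.
  have -> : f = \sum_i ((fun t => w t 0 i) * (fun t => w t 0 i)).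
    by apply/funext => u; rewrite fct_sumE.
  apply: is_derive_sum => i.
  have di : is_derive t 1 (fun t => w t 0 i) (dw t 0 i).
    have dwt' : differentiable w t by apply/derivable1_diffP.
    apply: DeriveDef; first exact/diff_derivable/differentiable_entry.
    by rewrite -(derive_entry (1 : R) 0 i dwt') dwE.
  exact: is_deriveM.
have dfK t : a < t < b -> `|df t| <= (n%:R * (2 * K)) * f t.
  move=> tab; apply: le_trans (ler_norm_sum _ _ _) _.
  apply: (@le_trans _ _ (\sum_(i < n) (2 * K) * f t)).
    apply: ler_sum => i _.
    rewrite -mulr2n -[X in `|X|]mulr_natl normrM ger0_norm// -mulrA ler_wpM2l//.
    rewrite normrM.
    apply: (@le_trans _ _ (`|w t| * (K * `|w t|))).
      apply: ler_pM => //; first exact: entry_le_norm.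
      by apply: le_trans (wK t tab); exact: entry_le_norm.
    by rewrite mulrCA ler_wpM2l// -expr2; exact: w2.
  by rewrite sumr_const card_ord -[leRHS]mulrA [leRHS]mulr_natl lexx.
have fs : f s = 0 by rewrite /f big1// => i _; rewrite ws mxE expr0n.
move=> t tab; have ft := gronwall0 (fun t _ => f0 t) fE dfK sab fs tab.
apply/eqP; rewrite -normr_eq0 -sqrf_eq0 eq_le sqr_ge0 andbT -ft.
exact: w2.
Qed.

(** Mean value theorem on the segment from z to y, which stays in the ball by convexity. Near x each
    partial derivative exceeds its size at x by at most 1, and K adds up these bounds. *)
Lemma smooth_lipschitzR n (f : 'rV[R]_n -> R) x : smooth_at f x ->
  exists2 r, 0 < r & exists2 K, 0 <= K & forall y z, ball x r y -> ball x r z ->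
    `|f y - f z| <= K * `|y - z|.
Proof.
move=> sf.
pose K := \sum_i (`|'D_(delta_mx 0 i) f x| + 1).
have nf : \forall y \near x, smooth_at f y /\
    forall i, `|'D_(delta_mx 0 i) f y| <= `|'D_(delta_mx 0 i) f x| + 1.
  have nD : \forall y \near x,
      forall i, `|'D_(delta_mx 0 i) f y| <= `|'D_(delta_mx 0 i) f x| + 1.
    apply: (filter_forall (nbhs_filter x)) => i.
    have /cvg_norm ci := smooth_at_cont (smooth_at_derive (delta_mx 0 i) sf).
    by apply: (cvgr_le _ ci); rewrite ltrDl.
  apply: filterS2 (smooth_at_near sf) nD => y sy Dy.
  by split; [exact: sy|exact: Dy].
move/nbhs_ballP : nf => -[r /= r0 rf].
exists r => //; exists K.
  by apply: sumr_ge0 => i _; rewrite addr_ge0.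
move=> y z xy xz.
have seg (t : R) : 0 <= t <= 1 -> ball x r (t *: (y - z) + z).
  move=> /andP[t0 t1]; move: xy xz; rewrite -!ball_normE /ball_/= => xy xz.
  have -> : x - (t *: (y - z) + z) = t *: (x - y) + (1 - t) *: (x - z).
    by apply/rowP => i; rewrite !mxE; ring.
  apply: le_lt_trans (ler_normD _ _) _; rewrite !normrZ (ger0_norm t0) ger0_norm ?subr_ge0//.
  have [->|tn0] := eqVneq t 0; first by rewrite mul0r add0r subr0 mul1r.
  have tp : 0 < t by rewrite lt_def tn0.
  have : t * `|x - y| < t * r by rewrite ltr_pM2l.
  have : (1 - t) * `|x - z| <= (1 - t) * r by rewrite ler_wpM2l ?subr_ge0// ltW.
  by lra.
have [c + E] : exists2 c, c \in `]0, 1[ &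
    f (1 *: (y - z) + z) - f (0 *: (y - z) + z) =
    'D_(y - z) f (c *: (y - z) + z) * (1 - 0).
  apply: (MVT (f := fun t => f (t *: (y - z) + z))
    (df := fun c => 'D_(y - z) f (c *: (y - z) + z))) => //.
    move=> t; rewrite in_itv/= => /andP[t0 t1]; apply: is_derive_line.
    by apply/smooth_at_diff; have [] := rf _ (seg t _) => //; rewrite !ltW.
  apply: derivable_within_continuous => t; rewrite in_itv/= => t01.
  have [sft _] := rf _ (seg t t01).
  by have [] := is_derive_line (smooth_at_diff sft).
rewrite in_itv/= => /andP[c0 c1].
have [|sfc fi] := rf _ (seg c _); first by rewrite !ltW.
have -> : f y - f z = 'D_(y - z) f (c *: (y - z) + z).
  by move: E; rewrite scale1r scale0r add0r subrK subr0 mulr1.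
have dfc := smooth_at_diff sfc.
rewrite (deriveE _ dfc) (diff_row_sum _ dfc).
apply: le_trans (ler_norm_sum _ _ _) _; rewrite mulr_suml.
apply: ler_sum => i _; rewrite normrM mulrC.
by apply: ler_pM => //; exact: entry_le_norm.
Qed.

Lemma smooth_lipschitz m n (f : 'rV[R]_n -> 'rV[R]_m) x : smooth_at f x ->
  exists2 r, 0 < r & exists2 K, 0 <= K & forall y z, ball x r y -> ball x r z ->
    `|f y - f z| <= K * `|y - z|.
Proof.
move=> /smooth_at_mxP sf.
have /choice[r rP] : forall i, exists r, 0 < r /\ exists2 K, 0 <= K &
    forall y z, ball x r y -> ball x r z -> `|f y 0 i - f z 0 i| <= K * `|y - z|.
  by move=> i; have [r r0 H] := smooth_lipschitzR (sf 0 i); exists r.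
have /choice[K KP] : forall i, exists K, 0 <= K /\
    forall y z, ball x (r i) y -> ball x (r i) z -> `|f y 0 i - f z 0 i| <= K * `|y - z|.
  by move=> i; have [_ [K K0 H]] := rP i; exists K.
(* A common radius is any sufficiently small positive number; this also covers an empty index set,
   where there is no minimum to take. *)
have : \forall e \near 0^'+, forall i, e < r i.
  apply: filter_forall => i; apply: nbhs_right_lt; exact: (rP i).1.
move=> nr; near (0 : R)^'+ => e.
have er : forall i, e < r i by near: e.
exists e => //; exists (\sum_i K i).
  by apply: sumr_ge0 => i _; exact: (KP i).1.
move=> y z xy xz; apply: norm_mx_le.
  by rewrite mulr_ge0// sumr_ge0// => i _; exact: (KP i).1.
move=> j i; rewrite ord1 !mxE.
apply: le_trans ((KP i).2 y z _ _) _; do ?by apply: le_ball xy; exact: ltW.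
  by apply: le_ball xz; exact: ltW.
apply: ler_wpM2r => //; rewrite (bigD1 i)//= lerDl.
by apply: sumr_ge0 => k _; exact: (KP k).1.
Unshelve. all: by end_near. Qed.

End RealFunctions.

Section ODE.
Context {R : realType}.

Lemma near_oo (a b t : R) : a < t < b -> \forall y \near t, a < y < b.
Proof.
move=> tab; have tin : t \in `]a, b[ by rewrite in_itv.
by apply: filterS (near_in_itvoo tin) => y; rewrite in_itv.
Qed.

Lemma continuous_antiderivative (f : R -> R) (a b : R) : a < b -> continuous f ->
  exists F : R -> R, forall t, a < t < b -> is_derive t 1 F (f t).
Proof.
move=> ab cf.
have intf : (@lebesgue_measure R).-integrable `[a, b] (EFin \o f).
  apply: continuous_compact_integrable; first exact: segment_compact.
  exact: continuous_subspaceT.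
exists (fun x => \int[@lebesgue_measure R]_(t in [set` `[a, x]]) f t)%R.
move=> t /andP[at_ tb].
have [d1 d2] := continuous_FTC1_closed tb intf at_ (cf t).
by apply: DeriveDef; [exact: d1|rewrite -derive1E; exact: d2].
Qed.

Lemma is_derive_entry m n (F : R -> 'M[R]_(m, n)) (t : R) dF i j :
  is_derive t 1 F dF -> is_derive t 1 (fun t => F t i j) (dF i j).
Proof.
move=> [dFt dFE]; have dFt' : differentiable F t by apply/derivable1_diffP.
apply: DeriveDef; first exact/diff_derivable/differentiable_entry.
by rewrite -(derive_entry (1 : R) i j dFt') dFE.
Qed.

Lemma is_derive_mx m n (F : R -> 'M[R]_(m, n)) (t : R) (dF : 'M[R]_(m, n)) :
  (forall i j, is_derive t 1 (fun t => F t i j) (dF i j)) -> is_derive t 1 F dF.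
Proof.
move=> dFij; have dFt : differentiable F t.
  by apply: differentiable_mx => i j; apply/derivable1_diffP; have [] := dFij i j.
apply: DeriveDef; first exact: diff_derivable.
by apply/matrixP => i j; rewrite derive_entry//; have [] := dFij i j.
Qed.

Lemma continuous_mx (T : topologicalType) m n (F : T -> 'M[R]_(m, n)) (t : T) :
  (forall i j, {for t, continuous (fun t => F t i j)}) -> {for t, continuous F}.
Proof.
move=> cF; apply/cvgrPdist_le => e e0.
have : \forall u \near t, forall i j, `|F t i j - F u i j| <= e.
  apply: (filter_forall (nbhs_filter t)) => i.
  apply: (filter_forall (nbhs_filter t)) => j.
  by move/cvgrPdist_le : (cF i j) => /(_ _ e0).
apply: filterS => u He; apply: norm_mx_le => [|i j]; first exact: ltW.
by rewrite !mxE; exact: He.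
Qed.

Lemma continuous_entry (T : topologicalType) m n (F : T -> 'M[R]_(m, n)) (t : T) i j :
  {for t, continuous F} -> {for t, continuous (fun t => F t i j)}.
Proof.
move=> cF; apply: (@continuous_comp _ _ _ F (fun M : 'M[R]_(m, n) => M i j) t cF).
exact: coord_continuous.
Qed.

Lemma continuous_antiderivative_mx m n (f : R -> 'M[R]_(m, n)) (a b : R) :
  a < b -> continuous f ->
  exists F : R -> 'M[R]_(m, n), forall t, a < t < b -> is_derive t 1 F (f t).
Proof.
move=> ab cf.
have /choice[F FP] : forall ij : 'I_m * 'I_n, exists F : R -> R,
    forall t, a < t < b -> is_derive t 1 F (f t ij.1 ij.2).
  move=> ij; apply: (@continuous_antiderivative (fun t => f t ij.1 ij.2)) => // t.
  exact: continuous_entry (cf t).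
exists (fun t => \matrix_(i, j) F (i, j) t) => t tab.
apply: is_derive_mx => i j.
under [X in is_derive _ _ X _]eq_fun do rewrite mxE.
exact: (FP (i, j)).
Qed.

(** Entry by entry, each with its own intermediate point; the maximum norm reassembles the entries
    without loss. *)
Lemma mean_value_mx m n (F f : R -> 'M[R]_(m, n)) (a b K s t : R) : 0 <= K ->
  (forall u, a <= u <= b -> is_derive u 1 F (f u)) ->
  (forall u, a <= u <= b -> `|f u| <= K) ->
  a <= s <= b -> a <= t <= b -> `|F t - F s| <= K * (b - a).
Proof.
move=> K0; wlog st : s t / s <= t.
  move=> H Ff fK sab tab; have [st|ts] := leP s t; first exact: H.
  by rewrite distrC; apply: H => //; exact: ltW.
move=> Ff fK /andP[as_ sb] /andP[at_ tb].
have ba : 0 <= b - a by rewrite subr_ge0 (le_trans as_).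
apply: norm_mx_le => [|i j]; first exact: mulr_ge0.
have dij u : a <= u <= b -> is_derive u 1 (fun u => F u i j) (f u i j).
  by move=> uab; apply: is_derive_entry; exact: Ff.
have [c + E] : exists2 c, c \in `[s, t] & F t i j - F s i j = f c i j * (t - s).
  apply: (MVT_segment (f := fun u => F u i j) (df := fun u => f u i j)) => // [x|].
    rewrite in_itv/= => /andP[sx xt]; apply: dij.
    by rewrite (le_trans as_ (ltW sx))/= (le_trans (ltW xt)).
  apply: derivable_within_continuous => x; rewrite in_itv/= => /andP[sx xt].
  have [|dx _] := dij x _ => //.
  by rewrite (le_trans as_)//= (le_trans xt).
rewrite in_itv/= => /andP[sc ct]; rewrite !mxE E normrM.
apply: ler_pM => //.
  apply: le_trans (fK c _); first exact: entry_le_norm.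
  by rewrite (le_trans as_)//= (le_trans ct).
by rewrite ger0_norm ?subr_ge0//; lra.
Qed.

Lemma norm_mulmx_le n (u : 'rV[R]_n) (A : 'M[R]_n) C : 0 <= C ->
  (forall i j, `|A i j| <= C) -> `|u *m A| <= (n%:R * C) * `|u|.
Proof.
move=> C0 AC; apply: norm_mx_le => [|i j].
  by rewrite !mulr_ge0.
rewrite mxE; apply: le_trans (ler_norm_sum _ _ _) _.
apply: (@le_trans _ _ (\sum_(k < n) C * `|u|)).
  apply: ler_sum => k _; rewrite normrM mulrC; apply: ler_pM => //.
  exact: entry_le_norm.
by rewrite sumr_const card_ord -[leRHS]mulrA [leRHS]mulr_natl lexx.
Qed.

(** * Picard iteration for a linear system on a short interval *)

Section Picard.
Variables (k : nat) (A : R -> 'M[R]_k) (a b c d C s : R) (x : 'rV[R]_k).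
Hypotheses (ac : a < c) (cd : c < d) (db : d < b).
Hypothesis cA : continuous A.
Hypothesis C0 : 0 <= C.
Hypothesis AC : forall t i j, c <= t <= d -> `|A t i j| <= C.
Hypothesis small : (k%:R * C) * (d - c) <= 2^-1.
Hypothesis scd : c < s < d.

(** Freezing time outside [c, d] keeps every iterate continuous on the whole line, with uniform
    bounds. The larger interval (a, b) leaves room for two-sided derivatives at c and d. *)
Let clamp (t : R) : R := Num.max c (Num.min d t).

Let clampP t : c <= clamp t <= d.
Proof. by rewrite /clamp le_max lexx/= ge_max (ltW cd) ge_min lexx. Qed.

Let clamp_id t : c <= t <= d -> clamp t = t.
Proof. by move=> /andP[ct td]; rewrite /clamp (min_idPr td) (max_idPr ct). Qed.

Let clamp_cont : continuous clamp.
Proof.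
move=> t; apply: continuous_max; first exact: cst_continuous.
by apply: continuous_min; [exact: cst_continuous|].
Qed.

(** One Picard step: v t is x plus the integral of u A from s to [clamp t]. It is a relation because
    the antiderivative comes from an existence statement. *)
Let step (u : R -> 'rV[R]_k) (v : R -> 'rV[R]_k) :=
  exists2 F, forall t, a < t < b -> is_derive t 1 F (u t *m A t) &
    forall t, v t = x + (F (clamp t) - F s).

Let continuous_mulA (u : R -> 'rV[R]_k) : continuous u ->
  continuous (fun t => u t *m A t).
Proof.
move=> cu t; apply: continuous_mx => i j.
have -> : (fun t => (u t *m A t) i j) = \sum_l ((fun t => u t i l) * (fun t => A t l j)).
  by apply/funext => y; rewrite mxE fct_sumE.
apply: (@big_ind _ (fun f : R -> R => {for t, continuous f})).
- exact: cst_continuous.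
- by move=> f g cf cg; exact: continuousD.
- move=> l _; apply: continuousM; apply: continuous_entry; [exact: cu|exact: cA].
Qed.

Let step_ex u : continuous u -> exists v, step u v.
Proof.
move=> cu; have ab : a < b by rewrite (lt_trans ac)// (lt_trans cd).
have [F FP] := continuous_antiderivative_mx ab (continuous_mulA cu).
by exists (fun t => x + (F (clamp t) - F s)), F.
Qed.

Let in_ab t : c <= t <= d -> a < t < b.
Proof. by move=> /andP[ct td]; rewrite (lt_le_trans ac)//= (le_lt_trans td). Qed.

Let step_cont u v : step u v -> continuous v.
Proof.
move=> [F FP vE] t; rewrite (funext vE).
apply: cvgD; first exact: cvg_cst.
apply: cvgB; last exact: cvg_cst.
apply: (@continuous_comp _ _ _ clamp F t (@clamp_cont t)).
apply: differentiable_continuous; apply/derivable1_diffP.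
by have [] := FP (clamp t) (in_ab (clampP t)).
Qed.

(** By the mean value bound a step multiplies uniform distances by at most k C (d - c), which
    [small] makes at most 1/2. *)
Let step_lip u u' v v' K : 0 <= K -> step u v -> step u' v' ->
  (forall t, c <= t <= d -> `|u t - u' t| <= K) ->
  forall t, `|v t - v' t| <= K / 2.
Proof.
move=> K0 [F FP vE] [F' FP' vE'] uK t.
have -> : v t - v' t = (F - F') (clamp t) - (F - F') s.
  rewrite vE vE' -![(F - F') _]/(_ - _).
  by apply/rowP => i; rewrite !mxE; ring.
apply: (@le_trans _ _ ((k%:R * C) * K * (d - c))).
  apply: (@mean_value_mx _ _ (F - F') (fun t => u t *m A t - u' t *m A t) c d) => //.
  - by rewrite !mulr_ge0.
  - move=> w wcd; have := FP w (in_ab wcd); have := FP' w (in_ab wcd).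
    by move=> H1 H2; exact: is_deriveB.
  - move=> w wcd; rewrite -mulmxBl; apply: le_trans (norm_mulmx_le _ C0 _) _.
      by move=> i j; exact: AC.
    by rewrite ler_wpM2l ?mulr_ge0//; exact: uK.
  - by case/andP: scd => *; rewrite !ltW.
by rewrite mulrAC mulrC ler_wpM2l.
Qed.

Let step_at u v : step u v -> v s = x.
Proof.
move=> [F FP vE]; rewrite vE clamp_id ?subrr ?addr0//.
by case/andP: scd => *; rewrite !ltW.
Qed.

Let step_derive u v t : step u v -> c < t < d -> is_derive t 1 v (u t *m A t).
Proof.
move=> [F FP vE] /andP[ct td].
have tcd : c <= t <= d by rewrite !ltW.
have := FP t (in_ab tcd) => dF.
have d1 : is_derive t 1 (fun t => x + (F t - F s)) (u t *m A t).
  have -> : (fun t => x + (F t - F s)) = cst x + (F - cst (F s)) by [].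
  have H : is_derive t 1 (cst x + (F - cst (F s))) (0 + (u t *m A t - 0)).
    by apply: is_deriveD; apply: is_deriveB.
  by apply: is_derive_eq H _; rewrite add0r subr0.
apply: near_eq_is_derive d1.
have tcd' : c < t < d by rewrite ct td.
apply: filterS (near_oo tcd') => y /andP[cy yd].
by rewrite vE clamp_id// !ltW.
Qed.

Lemma picard_linear : exists2 w, w s = x &
  forall t, c < t < d -> is_derive t 1 w (w t *m A t).
Proof.
pose T (u : R -> 'rV[R]_k) : R -> 'rV[R]_k := get (step u).
have TP u : continuous u -> step u (T u).
  by move=> cu; have [v uv] := step_ex cu; apply: getI uv.
pose u n := iter n T (cst x).
have cu n : continuous (u n).
  elim: n => [|n IH]; first exact: cst_continuous.
  exact: step_cont (TP _ IH).
(* Bound for the first increment, an integral of x A with |x A| <= k C |x|; each later increment is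
   at most half the one before. *)
pose M := (k%:R * C) * `|x| * (d - c).
have M0 : 0 <= M.
  have : 0 <= d - c by rewrite subr_ge0 ltW.
  by move=> ?; rewrite !mulr_ge0.
have u1 t : `|u 1%N t - u 0%N t| <= M.
  have [F FP vE] := TP _ (cu 0%N).
  rewrite /u /= vE /= /cst addrAC subrr add0r.
  apply: (@mean_value_mx _ _ F (fun t => x *m A t) c d) => //.
  - by rewrite !mulr_ge0.
  - by move=> w wcd; exact: (FP w (in_ab wcd)).
  - by move=> w wcd; apply: norm_mulmx_le => // i j; exact: AC.
  - by case/andP: scd => *; rewrite !ltW.
have uS n t : `|u n.+1 t - u n t| <= M / 2 ^+ n.
  elim: n t => [|n IH] t; first by rewrite expr0 divr1.
  have Mn0 : 0 <= M / 2 ^+ n by apply: divr_ge0 => //; exact: exprn_ge0.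
  have -> : M / 2 ^+ n.+1 = (M / 2 ^+ n) / 2 by rewrite exprSr invfM mulrA.
  apply: (step_lip Mn0 (TP _ (cu n.+1)) (TP _ (cu n))) => t' _; exact: IH.
(* The geometric sum of M / 2^j for n <= j < n + p, written as a difference so that the induction on
   p closes. *)
have uD n p t : `|u (n + p)%N t - u n t| <= (2 * M) / 2 ^+ n - (2 * M) / 2 ^+ (n + p).
  elim: p => [|p IH]; first by rewrite addn0 !subrr normr0.
  rewrite addnS -(subrKA (u (n + p)%N t)); apply: le_trans (ler_normD _ _) _.
  apply: le_trans (lerD (uS _ _) IH) _.
  rewrite exprSr invfM.
  by set z := (2 ^+ (n + p))^-1; lra.
have uB n p t : (n <= p)%N -> `|u p t - u n t| <= (2 * M) / 2 ^+ n.
  move=> np; rewrite -(subnKC np); apply: le_trans (uD _ _ _) _.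
  by rewrite gerBl; apply: divr_ge0; [exact: mulr_ge0|exact: exprn_ge0].
have geo : (2 * M) / 2 ^+ n @[n --> \oo] --> (0 : R).
  have -> : (fun n => (2 * M) / 2 ^+ n) = (fun n => (2 * M) * (2^-1) ^+ n).
    by apply/funext => n; rewrite exprVn.
  rewrite -[X in _ --> X](mulr0 (2 * M)); apply: cvgM; first exact: cvg_cst.
  by apply: cvg_expr; rewrite ger0_norm ?invr_ge0// invf_lt1 ?ltr1n.
have cvu t : cvgn (u ^~ t).
  apply/cauchy_cvgP; apply: cauchy_exP => e e0.
  have : \forall n \near \oo, (2 * M) / 2 ^+ n < e by exact: (cvgr_lt _ geo).
  move=> [N _ NP]; exists (u N t); exists N => // p /= Np.
  rewrite -ball_normE/= distrC.
  by apply: le_lt_trans (uB _ _ _ Np) (NP N _) => /=.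
pose w t := limn (u ^~ t).
have uw n t : `|w t - u n t| <= (2 * M) / 2 ^+ n.
  have cvd : `|u p t - u n t| @[p --> \oo] --> `|w t - u n t|.
    by apply: cvg_norm; apply: cvgB; [exact: cvu|exact: cvg_cst].
  apply: (cvgr_to_le cvd); exists n => // p /= np; exact: uB.
have cw : continuous w.
  move=> t; apply/cvgrPdist_lt => e e0.
  have e30 : 0 < e / 3 by rewrite divr_gt0.
  have [N _ NP] : \forall n \near \oo, (2 * M) / 2 ^+ n < e / 3.
    exact: (cvgr_lt _ geo).
  have NN : (2 * M) / 2 ^+ N < e / 3 by apply: NP => /=.
  have /cvgrPdist_lt /(_ _ e30) := cu N t.
  apply: filterS => y uy.
  have := uw N t; have := uw N y; rewrite [`|w y - _|]distrC => wy wt.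
  have -> : w t - w y = (w t - u N t) + (u N t - u N y) + (u N y - w y).
    by rewrite subrKA subrKA.
  apply: le_lt_trans (ler_normD _ _) _.
  apply: le_lt_trans (lerD (ler_normD _ _) (lexx _)) _.
  by lra.
have sw := TP _ cw.
(* T w and w are both close to the iterate n + 1: the first by contraction from w and the iterate n,
   the second because w is the limit. The two distances add up to at most twice 2M / 2^n. *)
have wE : T w = w.
  apply/funext => t; apply/eqP; rewrite -subr_eq0 -normr_le0.
  have g2 : 2 * ((2 * M) / 2 ^+ n) @[n --> \oo] --> (0 : R).
    by rewrite -[X in _ --> X](mulr0 2); apply: cvgM; [exact: cvg_cst|].
  apply: (cvgr_to_ge g2); exists 0%N => // n _ /=.
  have Mn0 : 0 <= (2 * M) / 2 ^+ n.
    by apply: divr_ge0; [exact: mulr_ge0|exact: exprn_ge0].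
  have h1 := step_lip Mn0 sw (TP _ (cu n)) (fun t _ => uw n t) t.
  have h2 : `|u n.+1 t - w t| <= (2 * M) / 2 ^+ n.
    rewrite distrC; apply: le_trans (uw n.+1 t) _.
    by rewrite exprSr invfM mulrA ler_piMr// invf_le1// ler1n.
  rewrite -(subrKA (u n.+1 t)); apply: le_trans (ler_normD _ _) _.
  apply: le_trans (lerD h1 h2) _.
  by lra.
exists w => [|t tcd]; first by rewrite -wE; exact: step_at sw.
by rewrite -{1}wE; exact: step_derive sw tcd.
Qed.

End Picard.
End ODE.

(** * From local to global solutions *)

Section Gluing.
Context {R : realType} {V : Type}.
Variable sol : (R -> V) -> R -> Prop.
Hypothesis sol_local : forall v w t, (\forall u \near t, v u = w u) ->
  sol v t -> sol w t.
Hypothesis sol_exists : forall t0, exists2 e, 0 < e & forall s x,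
  t0 - e < s < t0 + e -> exists2 v, v s = x & forall t, t0 - e < t < t0 + e -> sol v t.
Hypothesis sol_unique : forall a b s v w, (forall t, a < t < b -> sol v t) ->
  (forall t, a < t < b -> sol w t) -> a < s < b -> v s = w s ->
  forall t, a < t < b -> v t = w t.

Let solvable a b := forall s x, a < s < b ->
  exists2 v, v s = x & forall t, a < t < b -> sol v t.

Let solvable_sub a b a' b' : a <= a' -> b' <= b -> solvable a b -> solvable a' b'.
Proof.
move=> aa bb Q s x /andP[as_ sb].
have [|v vs vsol] := Q s x _; first by rewrite (le_lt_trans aa)//= (lt_le_trans sb).
exists v => // t /andP[at_ tb]; apply: vsol.
by rewrite (le_lt_trans aa)//= (lt_le_trans tb).
Qed.

(** The problem is solved first on the side of m that contains s, then continued from m on the other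
    side. Uniqueness on the overlap (a', b), of which m is the midpoint, makes the function switched
    at m a solution near every point. *)
Let solvable_glue a b a' b' : a <= a' -> a' < b -> b <= b' ->
  solvable a b -> solvable a' b' -> solvable a b'.
Proof.
move=> aa ab bb Q Q' s x sab.
pose m := (a' + b) / 2.
have am : a' < m by rewrite /m; lra.
have mb : m < b by rewrite /m; lra.
have [v [w [vsol wsol vwm sx]]] : exists v w,
    [/\ forall t, a < t < b -> sol v t, forall t, a' < t < b' -> sol w t,
      v m = w m & (if s < m then v s else w s) = x].
  have [sm|ms] := ltP s m.
    have [|v vs vsol] := Q s x _; first by lra.
    have [|w wm wsol] := Q' m (v m) _; first by lra.
    by exists v, w.
  have [|w ws wsol] := Q' s x _; first by lra.
  have [|v vm vsol] := Q m (w m) _; first by lra.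
  by exists v, w.
have vw t : a' < t < b -> v t = w t.
  move=> tab; apply: (@sol_unique a' b m) => // [u uab|u uab|].
  - by apply: vsol; lra.
  - by apply: wsol; lra.
  - by rewrite am mb.
exists (fun t => if t < m then v t else w t) => // t tab.
have [tb|bt] := ltP t b.
  apply: (@sol_local v); last by apply: vsol; lra.
  have [tm|mt] := ltP t m.
    have tam : t - 1 < t < m by lra.
    by apply: filterS (near_oo tam) => u /andP[_ um]; rewrite um.
  have tab' : a' < t < b by lra.
  apply: filterS (near_oo tab') => u uab.
  by case: ifPn => // _; exact: vw.
apply: (@sol_local w); last by apply: wsol; lra.
have tam : m < t < t + 1 by lra.
by apply: filterS (near_oo tam) => u /andP[mu _]; rewrite ltNge (ltW mu).
Qed.

(** With a fixed, solvability on (a, u) is a locally constant property of the right end u, hence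
    constant on (a, b + 1), an interval that has b in its interior. *)
Let solvable_all a b : a < b -> solvable a b.
Proof.
move=> ab; have [e e0 Qe] := sol_exists a.
(* A first right end that works: solutions around a restrict to (a, c). *)
pose c := Num.min (a + e / 2) b.
have Qc : solvable a c.
  by apply: solvable_sub Qe; rewrite ?lerBlDr ?lerDl ?(ltW e0)// /c ge_min; lra.
have cab : a < c < b + 1.
  by rewrite /c lt_min gt_min; apply/andP; split; lra.
apply: (@itv_const _ a (b + 1) (solvable a) _ c b) => //; last by lra.
move=> t tab; have [e' e0' Qt] := sol_exists t.
exists e' => // s u sab uab ts tu Qs.
have [us|su] := leP u s; first exact: solvable_sub Qs.
move: ts tu; rewrite !ltr_distlC => ts tu.
apply: (@solvable_sub a (t + e')) => //; first by lra.
apply: (@solvable_glue _ s (Num.max a (t - e'))) => //.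
- by rewrite le_max lexx.
- by rewrite gt_max; apply/andP; split; lra.
- by lra.
- by apply: solvable_sub Qt => //; rewrite le_max lexx orbT.
Qed.

(** At time t take the solution on the interval of radius |t - s| + 1 around s; all these solutions
    have the value x at s, so by uniqueness the radius does not matter. *)
Lemma solution_glue s x : exists2 v, v s = x & forall t, sol v t.
Proof.
have /choice[v vP] : forall r : R, exists v : R -> V, 0 < r -> v s = x /\
    forall t, s - r < t < s + r -> sol v t.
  move=> r; have [r0|r0] := ltP 0 r; last first.
    by exists (fun=> x).
  have sr : s - r < s + r by lra.
  have [|v vs vsol] := @solvable_all _ _ sr s x; first by lra.
  by exists v.
exists (fun t => v (`|t - s| + 1) t).
  by rewrite subrr normr0 add0r; have [|->] := vP 1 _.
(* Radius |t - s| + 2 covers every radius |u - s| + 1 used at times u within 1 of t, so a single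
   solution represents the glued function near t. *)
move=> t; have r0 : 0 < `|t - s| + 2 by rewrite ltr_wpDl.
have [vs vsol] := vP _ r0.
apply: (@sol_local (v (`|t - s| + 2))); last first.
  apply: vsol; clear vs; have := ler_norm (t - s); have := ler_norm (s - t); rewrite distrC; lra.
have tt : t - 1 < t < t + 1 by lra.
apply: filterS (near_oo tt) => u ut.
have q0 : 0 < `|u - s| + 1 by rewrite ltr_wpDl.
have [us usol] := vP _ q0.
have us1 := ler_norm (u - s); have us2 := ler_norm (s - u); rewrite distrC in us2.
have ts1 := ler_norm (t - s); have ts2 := ler_norm (s - t); rewrite distrC in ts2.
have uts : `|u - s| <= `|t - s| + 1.
  by clear us vs; rewrite ler_norml; lra.
apply: (@sol_unique (s - (`|u - s| + 1)) (s + (`|u - s| + 1)) s) => //.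
- by move=> y ys; apply: vsol; clear us vs; lra.
- by clear us vs; have := normr_ge0 (u - s); lra.
- by rewrite vs us.
- by clear us vs; lra.
Qed.

End Gluing.

(** * Linear systems with smooth coefficients *)

Section LinearODE.
Context {R : realType}.
Variable k : nat.
Implicit Types (A : R -> 'M[R]_k) (w : R -> 'rV[R]_k).

Lemma smooth_at_bounded A (t0 : R) : smooth_at A t0 ->
  exists2 r, 0 < r & exists2 C, 0 <= C & forall t, t0 - r <= t <= t0 + r ->
    (forall i j, `|A t i j| <= C) /\ {for t, continuous A}.
Proof.
move=> sA; have /cvg_norm cA := smooth_at_cont sA.
have nA : \forall t \near t0, `|A t| <= `|A t0| + 1.
  by apply: (cvgr_le _ cA); rewrite ltrDl.
have : \forall t \near t0, `|A t| <= `|A t0| + 1 /\ {for t, continuous A}.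
  by apply: filterS2 nA (smooth_at_near sA) => t At /smooth_at_cont.
move/nbhs_ballP => -[r /= r0 rP].
exists (r / 2); first by rewrite divr_gt0.
exists (`|A t0| + 1); first by rewrite addr_ge0.
move=> t tr; have [|At cAt] := rP t.
  by rewrite -ball_normE /ball_/= ltr_distlC; lra.
by split=> // i j; apply: le_trans At; exact: entry_le_norm.
Qed.

Lemma lin_ode_local A (t0 : R) : smooth_at A t0 -> exists2 e, 0 < e &
  forall s (x : 'rV[R]_k),
  t0 - e < s < t0 + e -> exists2 w, w s = x & forall t : R, t0 - e < t < t0 + e ->
    is_derive t 1 w (w t *m A t).
Proof.
move=> /smooth_at_bounded[r r0 [C C0 rP]].
pose clamp (t : R) : R := Num.max (t0 - r) (Num.min (t0 + r) t).
have clampP t : t0 - r <= clamp t <= t0 + r.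
  by rewrite /clamp le_max lexx/= ge_max ge_min lexx/= andbT; lra.
have clamp_id t : t0 - r <= t <= t0 + r -> clamp t = t.
  by move=> /andP[ct td]; rewrite /clamp (min_idPr td) (max_idPr ct).
have cclamp : continuous clamp.
  move=> t; rewrite /clamp.
  apply: (@continuous_max R R (cst (t0 - r)) (fun t => Num.min (t0 + r) t)).
    exact: cst_continuous.
  by apply: (@continuous_min R R (cst (t0 + r)) id); [exact: cst_continuous|].
have cA : continuous (fun t => A (clamp t)).
  move=> t; apply: (@continuous_comp _ _ _ clamp A t (@cclamp t)).
  by have [] := rP _ (clampP t).
pose K := k%:R * C; have K0 : 0 <= K by rewrite mulr_ge0.
(* The second bound gives 2 e K <= 1/2, the contraction condition, with K + 1 to avoid dividing by
   zero; e <= r/2 keeps the interval inside [t0 - r, t0 + r], where [clamp] is the identity. *)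
pose e := Num.min (r / 2) (4 * (K + 1))^-1.
have e0 : 0 < e by rewrite lt_min divr_gt0//= invr_gt0 mulr_gt0// ltr_wpDl.
have er : e <= r / 2 by rewrite ge_min lexx.
have Ke : K * (t0 + e - (t0 - e)) <= 2^-1.
  have -> : t0 + e - (t0 - e) = 2 * e by ring.
  have : e <= (4 * (K + 1))^-1 by rewrite /e ge_min lexx orbT.
  move=> /(ler_wpM2l K0) H; have : K * (4 * (K + 1))^-1 <= 4^-1.
    rewrite invfM mulrCA ler_piMr ?invr_ge0// ler_pdivrMr ?ltr_wpDl//; lra.
  lra.
exists e => // s x ste.
have [||||||||w ws wP] := @picard_linear _ k (fun t => A (clamp t))
   (t0 - r) (t0 + r) (t0 - e) (t0 + e) C s x; try (by []); try lra.
  by move=> t i j _; have [] := rP _ (clampP t).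
exists w => // t te; have := wP t te.
by rewrite clamp_id//; lra.
Qed.

(** The Gronwall constant is only local, since the coefficients may be unbounded towards a and b;
    agreement at one time spreads locally in both directions and then over the interval by
    connectedness. *)
Lemma lin_ode_unique A (a b s : R) w w' :
  (forall t, a < t < b -> smooth_at A t) ->
  (forall t : R, a < t < b -> is_derive t 1 w (w t *m A t)) ->
  (forall t : R, a < t < b -> is_derive t 1 w' (w' t *m A t)) ->
  a < s < b -> w s = w' s -> forall t, a < t < b -> w t = w' t.
Proof.
move=> sA dw dw' sab ws t tab.
apply: (itv_const (P := fun t => w t = w' t) (a := a) (b := b) _ sab tab ws).
move=> {ws s sab t tab} t tab; have [r r0 [C C0 rP]] := smooth_at_bounded (sA t tab).
exists r => // s u sab uab ts tu wws.
pose c := Num.max a (t - r); pose d := Num.min b (t + r).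
have cdP y : c < y < d -> (a < y < b) /\ (t - r < y < t + r).
  by rewrite /c /d gt_max lt_min => /andP[/andP[-> ->] /andP[-> ->]].
have cdI y : a < y < b -> `|t - y| < r -> c < y < d.
  by rewrite ltr_distlC /c /d gt_max lt_min => /andP[-> ->] /andP[-> ->].
have K0 : 0 <= k%:R * C by rewrite mulr_ge0.
have H1 (y : R) : c < y < d -> is_derive y 1 (w - w') (w y *m A y - w' y *m A y).
  move=> /cdP[yab _]; have := dw y yab; have := dw' y yab => *.
  exact: is_deriveB.
have H2 (y : R) : c < y < d -> `|w y *m A y - w' y *m A y| <= (k%:R * C) * `|(w - w') y|.
  move=> /cdP[_ /andP[y1 y2]]; rewrite -mulmxBl; apply: norm_mulmx_le => // i j.
  by have [|] := rP y _; first by rewrite !ltW.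
have H3 : (w - w') s = 0 by rewrite -[LHS]/(w s - w' s) wws subrr.
have := gronwall_rV K0 H1 H2 (cdI s sab ts) H3 (cdI u uab tu).
by rewrite -[LHS]/(w u - w' u) => /eqP; rewrite subr_eq0 => /eqP.
Qed.

Lemma lin_ode_global A s (x : 'rV[R]_k) : (forall t, smooth_at A t) ->
  exists2 w, w s = x & forall t : R, is_derive t 1 w (w t *m A t).
Proof.
move=> sA; apply: (@solution_glue _ _ (fun w (t : R) => is_derive t 1 w (w t *m A t))).
- move=> v w t vw; rewrite (nbhs_singleton vw).
  exact: near_eq_is_derive.
- by move=> t0; exact: lin_ode_local.
- move=> a b s' v w vsol wsol sab vws.
  exact: (lin_ode_unique (A := A) (a := a) (b := b) (s := s')).
Qed.

Lemma derive_mulmx (E : normedModType R) m n p (F : E -> 'M[R]_(m, n))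
    (G : E -> 'M[R]_(n, p)) x v : differentiable F x -> differentiable G x ->
  differentiable (fun y => F y *m G y) x /\
  'D_v (fun y => F y *m G y) x = 'D_v F x *m G x + F x *m 'D_v G x.
Proof.
move=> dF dG.
have FGE i j : (fun y => (F y *m G y) i j) =
    \sum_l ((fun y => F y i l) * (fun y => G y l j)).
  by apply/funext => y; rewrite mxE fct_sumE.
have dl i j l : differentiable ((fun y => F y i l) * (fun y => G y l j)) x.
  by apply: differentiableM; exact: differentiable_entry.
have dFG : differentiable (fun y => F y *m G y) x.
  by apply: differentiable_mx => i j; rewrite FGE; exact: differentiable_sum.
split => //; apply/matrixP => i j.
rewrite (derive_entry v i j dFG) FGE derive_sum; last first.
  by move=> l; exact: diff_derivable.
rewrite !mxE -big_split/=; apply: eq_bigr => l _.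
rewrite deriveM; try exact/diff_derivable/differentiable_entry.
rewrite -(derive_entry v i l dF) -(derive_entry v l j dG).
rewrite addrC; congr (_ + _); exact: mulrC.
Qed.

(** Coinduction on the functions w B with B smooth: the derivative of w B is w (A B + B'), of the
    same form, and w itself is the case B = 1. *)
Lemma lin_ode_smooth A w (U : set R) : open U ->
  (forall t, U t -> smooth_at A t) ->
  (forall t : R, U t -> is_derive t 1 w (w t *m A t)) ->
  forall t, U t -> smooth_at w t.
Proof.
move=> oU sA dw.
pose P (f : R -> 'rV[R]_k) := exists2 B : R -> 'M[R]_k,
  (forall t, U t -> smooth_at B t) & f = fun t => w t *m B t.
apply: (smooth_coind (P := P) oU); last first.
  exists (cst 1%:M); first by move=> t _; exact: smooth_at_cst.
  by apply/funext => t; rewrite mulmx1.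
move=> f [B sB ->].
have dwt t : U t -> differentiable w t.
  by move=> Ut; apply/derivable1_diffP; have [] := dw t Ut.
split=> [t Ut|v].
  have [] := derive_mulmx (0 : R) (dwt t Ut) (smooth_at_diff (sB t Ut)).
  by [].
exists (fun t => w t *m (v *: (A t *m B t + 'D_1 B t))).
  exists (fun t => v *: (A t *m B t + 'D_1 B t)) => // t Ut.
  apply: smooth_at_mxZ; first exact: smooth_at_cst.
  apply: smooth_at_mxD; last exact/smooth_at_derive/sB.
  by apply: smooth_at_mulmx; [exact: sA|exact: sB].
move=> t Ut; have [dwB DE] := derive_mulmx (1 : R) (dwt t Ut) (smooth_at_diff (sB t Ut)).
rewrite (deriveE _ dwB) (diffR_scale _ dwB) DE.
have [_ ->] := dw t Ut.
by rewrite -scalemxAr mulmxDr mulmxA.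
Qed.

End LinearODE.

(* The difference of two solutions satisfies |w'| <= K|w|, K a local Lipschitz
   constant of the field. *)
Lemma ode_unique_local (R : realType) k (Phi : 'rV[R]_k -> 'rV[R]_k)
    (y z : R -> 'rV[R]_k) (t0 : R) : smooth_at Phi (y t0) -> y t0 = z t0 ->
  (\forall t \near t0, is_derive t (1 : R) y (Phi (y t))) ->
  (\forall t \near t0, is_derive t (1 : R) z (Phi (z t))) ->
  \forall t \near t0, y t = z t.
Proof.
move=> sPhi yz dy dz; have [r r0 [K K0 Lip]] := smooth_lipschitz sPhi.
have cy : {for t0, continuous y}.
  apply: differentiable_continuous; apply/derivable1_diffP.
  by have [] := nbhs_singleton dy.
have cz : {for t0, continuous z}.
  apply: differentiable_continuous; apply/derivable1_diffP.
  by have [] := nbhs_singleton dz.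
have ny : \forall t \near t0, ball (y t0) r (y t).
  exact: (cy _ (nbhsx_ballx (y t0) r r0)).
have nz : \forall t \near t0, ball (y t0) r (z t).
  by rewrite yz; exact: (cz _ (nbhsx_ballx (z t0) r r0)).
have nyz := @filterI _ _ (nbhs_filter t0) _ _ ny nz.
have dyz := @filterI _ _ (nbhs_filter t0) _ _ dy dz.
have /nbhs_ballP[e /= e0 eP] := @filterI _ _ (nbhs_filter t0) _ _ nyz dyz.
have eI t : t0 - e < t < t0 + e -> ball t0 e t.
  by move=> te; rewrite -ball_normE/= ltr_distlC.
have H1 (t : R) : t0 - e < t < t0 + e -> is_derive t 1 (y - z) (Phi (y t) - Phi (z t)).
  by move=> /eI/eP[_ [? ?]]; exact: is_deriveB.
have H2 (t : R) : t0 - e < t < t0 + e -> `|Phi (y t) - Phi (z t)| <= K * `|(y - z) t|.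
  by move=> /eI/eP[[? ?] _]; exact: Lip.
have H3 : (y - z) t0 = 0 by rewrite -[LHS]/(y t0 - z t0) yz subrr.
have t0e : t0 - e < t0 < t0 + e by lra.
apply: filterS (near_oo t0e) => t te.
have := gronwall_rV K0 H1 H2 t0e H3 te.
by rewrite -[LHS]/(y t - z t) => /eqP; rewrite subr_eq0 => /eqP.
Qed.

(** * Christoffel symbols and second fundamental forms in coordinates *)

Section Bilin.
Context {R : realType}.
Variable n : nat.
Implicit Types (G : 'M[R]_n) (u v w : 'rV[R]_n).

Lemma bilin_linl G a u u' v :
  bilin G (a *: u + u') v = a * bilin G u v + bilin G u' v.
Proof. by rewrite /bilin !mulmxDl -!scalemxAl !mxE. Qed.

Lemma bilin_linr G a u v v' :
  bilin G u (a *: v + v') = a * bilin G u v + bilin G u v'.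
Proof. by rewrite /bilin linearD linearZ/= mulmxDr -scalemxAr !mxE. Qed.

Lemma bilin_linm a G G' u v :
  bilin (a *: G + G') u v = a * bilin G u v + bilin G' u v.
Proof. by rewrite /bilin mulmxDr mulmxDl -scalemxAr -scalemxAl !mxE. Qed.

Lemma bilin0l G v : bilin G 0 v = 0.
Proof. by rewrite /bilin !mul0mx mxE. Qed.

Lemma bilin0r G v : bilin G v 0 = 0.
Proof. by rewrite /bilin linear0 mulmx0 mxE. Qed.

Lemma bilinDl G u u' v : bilin G (u + u') v = bilin G u v + bilin G u' v.
Proof. by have := bilin_linl G 1 u u' v; rewrite scale1r mul1r. Qed.

Lemma bilinDr G u v v' : bilin G u (v + v') = bilin G u v + bilin G u v'.
Proof. by have := bilin_linr G 1 u v v'; rewrite scale1r mul1r. Qed.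

Lemma bilinZl G a u v : bilin G (a *: u) v = a * bilin G u v.
Proof. by have := bilin_linl G a u 0 v; rewrite bilin0l !addr0. Qed.

Lemma bilinZr G a u v : bilin G u (a *: v) = a * bilin G u v.
Proof. by have := bilin_linr G a u v 0; rewrite bilin0r !addr0. Qed.

Lemma bilinNl G u v : bilin G (- u) v = - bilin G u v.
Proof. by rewrite -scaleN1r bilinZl mulN1r. Qed.

Lemma bilinNr G u v : bilin G u (- v) = - bilin G u v.
Proof. by rewrite -scaleN1r bilinZr mulN1r. Qed.

Lemma bilinBl G u u' v : bilin G (u - u') v = bilin G u v - bilin G u' v.
Proof. by rewrite bilinDl bilinNl. Qed.

Lemma bilinBr G u v v' : bilin G u (v - v') = bilin G u v - bilin G u v'.
Proof. by rewrite bilinDr bilinNr. Qed.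

Lemma bilin_suml G (I : Type) (r : seq I) (P : pred I) (F : I -> 'rV[R]_n) v :
  bilin G (\sum_(i <- r | P i) F i) v = \sum_(i <- r | P i) bilin G (F i) v.
Proof.
by apply: (big_morph (fun u => bilin G u v)) => [u u'|]; rewrite ?bilinDl ?bilin0l.
Qed.

Lemma bilin_sumr G (I : Type) (r : seq I) (P : pred I) (F : I -> 'rV[R]_n) v :
  bilin G v (\sum_(i <- r | P i) F i) = \sum_(i <- r | P i) bilin G v (F i).
Proof.
by apply: (big_morph (fun u => bilin G v u)) => [u u'|]; rewrite ?bilinDr ?bilin0r.
Qed.

Lemma bilinC G u v : G^T = G -> bilin G u v = bilin G v u.
Proof.
move=> GT; rewrite /bilin -[in RHS]GT.
have -> : v *m G^T *m u^T = (u *m G *m v^T)^T by rewrite !trmx_mul trmxK mulmxA.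
by rewrite [RHS]mxE.
Qed.

Lemma bilin_delta G i j : bilin G (delta_mx 0 i) (delta_mx 0 j) = G i j.
Proof. by rewrite /bilin -rowE trmx_delta -colE !mxE. Qed.

Lemma bilin_sym G : (forall u v, bilin G u v = bilin G v u) -> G^T = G.
Proof. by move=> H; apply/matrixP => i j; rewrite mxE -!bilin_delta; exact: H. Qed.

Lemma bilin_nondeg G u : G \in unitmx -> (forall v, bilin G u v = 0) -> u = 0.
Proof.
move=> Gu H; have uG : u *m G = 0.
  apply/rowP => i; have := H (delta_mx 0 i).
  by rewrite /bilin trmx_delta -colE !mxE.
by rewrite -(mulmxK Gu u) uG mul0mx.
Qed.

Lemma bilin_mul_invmx G r v : G \in unitmx ->
  bilin G (r *m invmx G) v = \sum_l v 0 l * r 0 l.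
Proof.
move=> Gu; rewrite /bilin mulmxKV// mxE.
by apply: eq_bigr => l _; rewrite mxE mulrC.
Qed.

Lemma posdef_unitmx G : (forall v, v != 0 -> 0 < bilin G v v) -> G \in unitmx.
Proof.
move=> pG; rewrite -row_free_unit -kermx_eq0; apply/eqP/row_matrixP => i.
rewrite row0; apply/eqP/negPn/negP => /pG; rewrite /bilin.
suff -> : row i (kermx G) *m G = 0 by rewrite mul0mx mxE ltxx.
by rewrite -row_mul mulmx_ker row0.
Qed.

End Bilin.

Lemma derive_bilin (R : realType) n (E : normedModType R) (G : E -> 'M[R]_n)
    (a b : E -> 'rV[R]_n) x v : differentiable G x -> differentiable a x ->
  differentiable b x ->
  differentiable (fun y => bilin (G y) (a y) (b y)) x /\
  'D_v (fun y => bilin (G y) (a y) (b y)) x =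
  bilin ('D_v G x) (a x) (b x) + bilin (G x) ('D_v a x) (b x) +
  bilin (G x) (a x) ('D_v b x).
Proof.
move=> dG da db; have [d1 D1] := derive_mulmx v da dG.
have dbT : differentiable (fun y => (b y)^T) x.
  apply: differentiable_mx => i j.
  have -> : (fun y => (b y)^T i j) = (fun y => b y j i).
    by apply/funext => y; rewrite mxE.
  exact: differentiable_entry.
have DbT : 'D_v (fun y => (b y)^T) x = ('D_v b x)^T.
  apply/matrixP => i j; rewrite (derive_entry v i j dbT) mxE (derive_entry v j i db).
  by apply: near_eq_derive; near=> y; rewrite mxE.
have [d2 D2] := derive_mulmx v d1 dbT.
split; first exact: differentiable_entry.
rewrite -[LHS](derive_entry v 0 0 d2) D2 D1 DbT /bilin.
have addE (A B : 'M[R]_1) : (A + B) 0 0 = A 0 0 + B 0 0 by rewrite mxE.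
by rewrite mulmxDl !addE; congr (_ + _); rewrite addrC.
Unshelve. all: by end_near. Qed.

Section LocalGeometry.
Context {R : realType}.

(** [christoffel] with the Gram field as a parameter; for the Gram field of a chart the two are
    convertible. *)
Definition chr n (G : 'rV[R]_n -> 'M[R]_n) (x u v : 'rV[R]_n) : 'rV[R]_n :=
  (\row_l (2^-1 * ('D_u (fun y => bilin (G y) v (delta_mx 0 l)) x
                   + 'D_v (fun y => bilin (G y) u (delta_mx 0 l)) x
                   - 'D_(delta_mx 0 l) (fun y => bilin (G y) u v) x)))
    *m invmx (G x).

(** Koszul's formula for constant fields: the Christoffel symbols of the first kind as a trilinear
    form. *)
Definition koszul n (G : 'rV[R]_n -> 'M[R]_n) (x u v w : 'rV[R]_n) : R :=
  2^-1 * (bilin ('d G x u) v w + bilin ('d G x v) u w - bilin ('d G x w) u v).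

(** Symmetry is required near x, so that it passes to the derivative of G. *)
Definition metric_at n (G : 'rV[R]_n -> 'M[R]_n) (x : 'rV[R]_n) :=
  [/\ smooth_at G x, \near x, (G x)^T = G x & G x \in unitmx].

Section OneSpace.
Variables (n : nat) (G : 'rV[R]_n -> 'M[R]_n).
Implicit Types x u v w : 'rV[R]_n.

Lemma derive_bilin_cst x u v w : differentiable G x ->
  'D_u (fun y => bilin (G y) v w) x = bilin ('d G x u) v w.
Proof.
move=> dG; have [_ ->] := derive_bilin u dG (differentiable_cst v x) (differentiable_cst w x).
by rewrite !derive_cst bilin0l bilin0r !addr0 deriveE.
Qed.

Lemma chrE x u v : differentiable G x ->
  chr G x u v = (\row_l koszul G x u v (delta_mx 0 l)) *m invmx (G x).
Proof.
move=> dG; congr (_ *m _); apply/rowP => l; rewrite !mxE.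
by rewrite !(derive_bilin_cst _ _ _ dG).
Qed.

Lemma koszul_linr x a u v w w' : differentiable G x ->
  koszul G x u v (a *: w + w') = a * koszul G x u v w + koszul G x u v w'.
Proof. by move=> dG; rewrite /koszul linearP !bilin_linr bilin_linm; ring. Qed.

Lemma koszul_lin1 x a u u' v w : differentiable G x ->
  koszul G x (a *: u + u') v w = a * koszul G x u v w + koszul G x u' v w.
Proof. by move=> dG; rewrite /koszul linearP !bilin_linl bilin_linm; ring. Qed.

Lemma koszul_lin2 x a u v v' w : differentiable G x ->
  koszul G x u (a *: v + v') w = a * koszul G x u v w + koszul G x u v' w.
Proof.
by move=> dG; rewrite /koszul linearP bilin_linl !bilin_linr bilin_linm; ring.
Qed.

Lemma koszul_sumr x u v w : differentiable G x ->
  koszul G x u v w = \sum_l w 0 l * koszul G x u v (delta_mx 0 l).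
Proof.
move=> dG; have H0 : koszul G x u v 0 = 0.
  by have := koszul_linr (-1) u v 0 0 dG; rewrite scaler0 addr0 mulN1r addNr.
rewrite [in LHS](row_sum_delta w); elim/big_rec2 : _ => // i r s _ <-.
exact: koszul_linr.
Qed.

Lemma metric_at_diff x : metric_at G x -> differentiable G x.
Proof. by move=> [/smooth_at_diff]. Qed.

Lemma metric_at_dsym x w : metric_at G x -> ('d G x w)^T = 'd G x w.
Proof.
move=> [sG nG _]; have dG := smooth_at_diff sG; rewrite -deriveE//.
apply/matrixP => i j; rewrite mxE (derive_entry w j i dG) (derive_entry w i j dG).
by apply: near_eq_derive; apply: filterS nG => y {1}<-; rewrite mxE.
Qed.

Lemma koszulC x u v w : metric_at G x -> koszul G x u v w = koszul G x v u w.
Proof.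
move=> mG; rewrite /koszul [bilin _ v u](bilinC _ _ (metric_at_dsym w mG)).
by congr (_ * (_ - _)); rewrite addrC.
Qed.

Lemma chr_bilin x u v w : metric_at G x ->
  bilin (G x) (chr G x u v) w = koszul G x u v w.
Proof.
move=> mG; have dG := metric_at_diff mG; have [_ _ Gu] := mG.
rewrite (chrE _ _ dG) (bilin_mul_invmx _ _ Gu) (koszul_sumr _ _ _ dG).
by apply: eq_bigr => l _; rewrite mxE.
Qed.

Lemma chrC x u v : metric_at G x -> chr G x u v = chr G x v u.
Proof.
move=> mG; have dG := metric_at_diff mG; rewrite !(chrE _ _ dG); congr (_ *m _).
by apply/rowP => l; rewrite !mxE koszulC.
Qed.

Lemma chr_linl x a u u' v : differentiable G x ->
  chr G x (a *: u + u') v = a *: chr G x u v + chr G x u' v.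
Proof.
move=> dG; rewrite !(chrE _ _ dG) scalemxAl -mulmxDl; congr (_ *m _).
by apply/rowP => l; rewrite !mxE koszul_lin1.
Qed.

Lemma chr_linr x a u v v' : differentiable G x ->
  chr G x u (a *: v + v') = a *: chr G x u v + chr G x u v'.
Proof.
move=> dG; rewrite !(chrE _ _ dG) scalemxAl -mulmxDl; congr (_ *m _).
by apply/rowP => l; rewrite !mxE koszul_lin2.
Qed.

(** Metric compatibility: in the sum of the Koszul expressions for (u, v, w) and (u, w, v)
    everything but the derivative along u cancels. *)
Lemma chr_metric x u v w : metric_at G x ->
  bilin ('d G x u) v w = bilin (G x) (chr G x u v) w + bilin (G x) v (chr G x u w).
Proof.
move=> mG; have [_ nG _] := mG.
rewrite [bilin (G x) v _](bilinC _ _ (nbhs_singleton nG)) !(chr_bilin _ _ _ mG) /koszul.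
rewrite [bilin _ w v](bilinC _ _ (metric_at_dsym u mG)).
rewrite [bilin _ u w](bilinC _ _ (metric_at_dsym v mG)).
rewrite [bilin _ u v](bilinC _ _ (metric_at_dsym w mG)).
by field.
Qed.

Lemma smooth_at_koszul (E : normedModType R) (c u v w : E -> 'rV[R]_n) z :
  smooth_at G (c z) -> smooth_at c z -> smooth_at u z -> smooth_at v z ->
  smooth_at w z ->
  smooth_at (fun y => koszul G (c y) (u y) (v y) (w y)) z.
Proof.
move=> sG sc su sv sw.
apply: smooth_atM; first exact: smooth_at_cst.
apply: smooth_atB; first apply: smooth_atD.
all: apply: smooth_at_bilin => //; exact: smooth_at_dapp.
Qed.

Lemma smooth_at_chr (E : normedModType R) (c u v : E -> 'rV[R]_n) z :
  smooth_at G (c z) -> G (c z) \in unitmx -> smooth_at c z -> smooth_at u z ->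
  smooth_at v z -> smooth_at (fun y => chr G (c y) (u y) (v y)) z.
Proof.
move=> sG Gu sc su sv.
apply: (@smooth_at_ext _ _ _ (fun y =>
  (\row_l koszul G (c y) (u y) (v y) (delta_mx 0 l)) *m invmx (G (c y)))).
  apply: filterS (smooth_at_near_comp sG (smooth_at_cont sc)) => y /smooth_at_diff dG.
  by rewrite (chrE _ _ dG).
apply: smooth_at_mulmx; last first.
  by apply: smooth_at_invmx => //; exact: (smooth_at_comp sc sG).
apply/smooth_at_mxP => i l; rewrite ord1.
apply: (@smooth_at_ext _ _ _ (fun y => koszul G (c y) (u y) (v y) (delta_mx 0 l))).
  by near=> y; rewrite mxE.
by apply: smooth_at_koszul => //; exact: smooth_at_cst.
Unshelve. all: by end_near. Qed.

End OneSpace.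

Section TwoSpaces.
Variables (m n : nat).
Variables (G : 'rV[R]_m -> 'M[R]_m) (G' : 'rV[R]_n -> 'M[R]_n).
Variable (F : 'rV[R]_m -> 'rV[R]_n).
Implicit Types x u v w : 'rV[R]_m.

Definition isometric_near x := \forall y \near x, forall u v,
  bilin (G y) u v = bilin (G' (F y)) ('d F y u) ('d F y v).

(* The second fundamental form of [F] in coordinates: the Hessian of [F] with
   respect to the Levi-Civita connections of [G] and [G']. *)
Definition II x u v : 'rV[R]_n :=
  hess F x u v + chr G' (F x) ('d F x u) ('d F x v) - 'd F x (chr G x u v).

Lemma derive_diff x u v : smooth_at F x ->
  differentiable (fun y => 'd F y v) x /\ 'D_u (fun y => 'd F y v) x = hess F x u v.
Proof.
move=> sF; have nF : \forall y \near x, 'D_v F y = 'd F y v.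
  by apply: filterS (smooth_at_near sF) => y /smooth_at_diff; exact: deriveE.
have dF : differentiable ('D_v F) x by exact/smooth_at_diff/smooth_at_derive.
split; first by have [] := near_eq_diff nF dF.
by apply/esym; exact: near_eq_derive.
Qed.

(** Differentiate the isometry relation and form the Koszul combination: of the six Hessian terms
    four cancel by symmetry and the remaining two are equal. *)
Lemma isometric_koszul x u v w : smooth_at F x -> metric_at G x ->
  metric_at G' (F x) -> isometric_near x ->
  bilin (G' (F x)) (hess F x u v) ('d F x w) +
  koszul G' (F x) ('d F x u) ('d F x v) ('d F x w) = koszul G x u v w.
Proof.
move=> sF mG mG' iso; have dG := metric_at_diff mG; have dG' := metric_at_diff mG'.
have dF := smooth_at_diff sF; have [_ nG' _] := mG'.
have G'T := nbhs_singleton nG'.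
have D a b c : bilin ('d G x a) b c =
    bilin ('d G' (F x) ('d F x a)) ('d F x b) ('d F x c) +
    bilin (G' (F x)) (hess F x a b) ('d F x c) +
    bilin (G' (F x)) ('d F x b) (hess F x a c).
  rewrite -(derive_bilin_cst _ _ _ dG).
  have nE : \forall y \near x, bilin (G y) b c = bilin (G' (F y)) ('d F y b) ('d F y c).
    by apply: filterS iso.
  rewrite (near_eq_derive _ nE).
  have [d1 D1] := derive_diff a b sF; have [d2 D2] := derive_diff a c sF.
  have [_ ->] := derive_bilin a (differentiable_comp dF dG') d1 d2.
  by rewrite D1 D2 (derive_comp a dF dG') deriveE.
rewrite /koszul !D (hessC v u sF) (hessC w u sF) (hessC w v sF).
move: (hess F x u v) (hess F x u w) (hess F x v w) => p q r.
by rewrite (bilinC ('d F x v) q G'T); field.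
Qed.

Lemma II_normal x u v w : smooth_at F x -> metric_at G x ->
  metric_at G' (F x) -> isometric_near x ->
  bilin (G' (F x)) (II x u v) ('d F x w) = 0.
Proof.
move=> sF mG mG' iso; rewrite /II bilinBl bilinDl (chr_bilin _ _ _ mG').
rewrite isometric_koszul// -(nbhs_singleton iso) (chr_bilin _ _ _ mG).
by rewrite subrr.
Qed.

Lemma II_linr x a u v v' : smooth_at F x -> differentiable G x ->
  differentiable G' (F x) -> II x u (a *: v + v') = a *: II x u v + II x u v'.
Proof.
move=> sF dG dG'.
have hl : hess F x u (a *: v + v') = a *: hess F x u v + hess F x u v'.
  rewrite (hessC u _ sF) (hessC u v sF) (hessC u v' sF) /hess.
  have dDF : differentiable ('D_u F) x by exact/smooth_at_diff/smooth_at_derive.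
  by rewrite !(deriveE _ dDF) linearP.
rewrite /II hl linearP (chr_linr _ _ _ _ dG') (chr_linr _ _ _ _ dG) linearP.
move: (hess F x u v) (hess F x u v') (chr G' _ _ ('d F x v)) (chr G' _ _ ('d F x v')).
move: ('d F x (chr G x u v)) ('d F x (chr G x u v')) => ? ? ? ? ? ?.
by apply/rowP => i; rewrite !mxE; ring.
Qed.

Lemma IIC x u v : smooth_at F x -> metric_at G x -> metric_at G' (F x) ->
  II x u v = II x v u.
Proof.
move=> sF mG mG'; rewrite /II (hessC u v sF) (chrC u v mG).
by rewrite (chrC ('d F x u) ('d F x v) mG').
Qed.

Lemma smooth_at_II x u v : smooth_at F x -> metric_at G x ->
  metric_at G' (F x) -> smooth_at (fun y => II y u v) x.
Proof.
move=> sF [sG _ uG] [sG' _ uG'].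
have sD w : smooth_at (fun y => 'd F y w) x.
  apply: (@smooth_at_dapp _ _ _ _ _ F (fun y => y) (cst w)) => //.
    exact: smooth_at_id.
  exact: smooth_at_cst.
apply: smooth_at_mxB; first apply: smooth_at_mxD.
- exact/smooth_at_derive/smooth_at_derive.
- exact: smooth_at_chr.
- apply: (@smooth_at_dapp _ _ _ _ _ F (fun y => y)) => //.
    exact: smooth_at_id.
  apply: (@smooth_at_chr _ _ _ (fun y => y)) => //; try exact: smooth_at_cst.
  exact: smooth_at_id.
Qed.

End TwoSpaces.

(** Second fundamental forms have normal values, and an onto differential leaves no nonzero normal
    vector. *)
Lemma II_equidim n (G G' : 'rV[R]_n -> 'M[R]_n) (F : 'rV[R]_n -> 'rV[R]_n) x u v :
  smooth_at F x -> metric_at G x -> metric_at G' (F x) ->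
  isometric_near G G' F x -> (forall w, exists w', 'd F x w' = w) ->
  II G G' F x u v = 0.
Proof.
move=> sF mG mG' iso surj; have [_ _ uG'] := mG'.
apply: (bilin_nondeg uG') => w; have [w' <-] := surj w.
exact: II_normal.
Qed.

(** Chain rule for the Hessian; the Christoffel term of the middle field G2 enters once with each
    sign, so every G2 gives the same sum. *)
Lemma II_comp m n p (G1 : 'rV[R]_m -> 'M[R]_m) (G2 : 'rV[R]_n -> 'M[R]_n)
    (G3 : 'rV[R]_p -> 'M[R]_p) (B : 'rV[R]_m -> 'rV[R]_n)
    (A : 'rV[R]_n -> 'rV[R]_p) x u v :
  smooth_at B x -> smooth_at A (B x) ->
  II G1 G3 (A \o B) x u v =
  II G2 G3 A (B x) ('d B x u) ('d B x v) + 'd A (B x) (II G1 G2 B x u v).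
Proof.
move=> sB sA; have dB := smooth_at_diff sB; have dA := smooth_at_diff sA.
have dAB w : 'd (A \o B) x w = 'd A (B x) ('d B x w) by rewrite diff_comp.
have hAB : hess (A \o B) x u v =
    hess A (B x) ('d B x u) ('d B x v) + 'd A (B x) (hess B x u v).
  have nD : \forall y \near x, 'D_v (A \o B) y = 'd A (B y) ('d B y v).
    have nA := smooth_at_near_comp sA (smooth_at_cont sB).
    apply: filterS2 nA (smooth_at_near sB) => y /smooth_at_diff dAy /smooth_at_diff dBy.
    have dABy := differentiable_comp dBy dAy.
    by rewrite (deriveE _ dABy) (diff_comp dBy dAy).
  rewrite /hess (near_eq_derive _ nD).
  have [d1 D1] := derive_diff u v sB.
  have [_ ->] := derive_dapp u sA dB d1.
  by rewrite D1 (deriveE _ dB).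
rewrite /II hAB !dAB linearB linearD/=.
move: (hess A _ _ _) ('d A _ (hess B x u v)) ('d A _ (chr G2 _ _ _)).
move: ('d A _ ('d B x (chr G1 x u v))) (chr G3 _ _ _) => ? ? ? ? ?.
by apply/rowP => i; rewrite !mxE; ring.
Qed.

End LocalGeometry.

(** * Charts, tangent maps and covariant derivatives on manifolds *)

Arguments cdom_open {R n s} p : rename.
Arguments cdom_center {R n s} p : rename.
Arguments chart_image_open {R n s} p : rename.
Arguments metric_smooth {R n r} p : rename.
Arguments metric_sym {R n r} p : rename.
Arguments metric_posdef {R n r} p : rename.

Section Charts.
Context {R : realType} {n : nat} {M : smooth_manifold R n}.
Implicit Types (p q r : M) (x v : 'rV[R]_n).

Lemma chartIK p x : (chart p @` cdom p) x ->
  chart p (chartI p x) = x /\ cdom p (chartI p x).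
Proof. by move=> [q pq <-]; rewrite chartK. Qed.

Lemma near_chartI p q (A : set M) : cdom p q -> open A -> A q ->
  \forall x \near chart p q,
    [/\ cdom p (chartI p x), A (chartI p x) & chart p (chartI p x) = x].
Proof.
move=> pq oA Aq.
have imq : (chart p @` cdom p) (chart p q) by exists q.
have n1 := open_nbhs_nbhs (conj (chart_image_open p) imq).
have n2 : \forall x \near chart p q, A (chartI p x).
  by apply: continuous_near oA _; [exact: chartI_continuous|rewrite chartK].
by apply: filterS2 n1 n2 => x /chartIK[].
Qed.

Lemma open_chart_image p (B : set M) : open B -> B `<=` cdom p ->
  open (chart p @` B).
Proof.
move=> oB Bp; rewrite openE => _ [q Bq <-].
apply: filterS (near_chartI (Bp _ Bq) oB Bq) => x [_ Bx xE].
by exists (chartI p x).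
Qed.

Lemma near_cdom p q : cdom p q -> \forall y \near q, cdom p y.
Proof. by move=> pq; exact: open_nbhs_nbhs (conj (cdom_open p) pq). Qed.

End Charts.

Section LocalExpressions.
Context {R : realType}.

(** Unlike in [local_expr], the target chart is free; for f = id this is a chart transition. *)
Definition lexpr m n (M : smooth_manifold R m) (N : smooth_manifold R n)
    (f : M -> N) (p : M) (r : N) : 'rV[R]_m -> 'rV[R]_n :=
  chart r \o f \o chartI p.

Lemma smooth_map_id n (M : smooth_manifold R n) : smooth_map (id : M -> M).
Proof.
by split=> [q|p q]; [exact: cvg_id|exact: chart_transition].
Qed.

Lemma lexpr_chart m n (M : smooth_manifold R m) (N : smooth_manifold R n)
    (f : M -> N) p r q : cdom p q -> lexpr f p r (chart p q) = chart r (f q).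
Proof. by move=> pq; rewrite /lexpr /= chartK. Qed.

Lemma smooth_lexpr m n (M : smooth_manifold R m) (N : smooth_manifold R n)
    (f : M -> N) p r q : smooth_map f -> cdom p q -> cdom r (f q) ->
  smooth_at (lexpr f p r) (chart p q).
Proof.
move=> [cf sf] pq rq; apply: smooth_on_at (sf p r) _; last by exists q.
apply: open_chart_image; last by move=> ? [].
apply: openI; first exact: cdom_open.
by apply: open_comp => [x _|]; [exact: cf|exact: cdom_open].
Qed.

Lemma near_lexpr_cdom m n (M : smooth_manifold R m) (N : smooth_manifold R n)
    (f : M -> N) p r q : smooth_map f -> cdom p q -> cdom r (f q) ->
  \forall x \near chart p q, [/\ cdom p (chartI p x), cdom r (f (chartI p x)) &
    chart p (chartI p x) = x].
Proof.
move=> [cf _] pq rq.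
have oA : open (f @^-1` cdom r).
  by apply: open_comp => [x _|]; [exact: cf|exact: cdom_open].
exact: near_chartI pq oA rq.
Qed.

Lemma smooth_map_comp m n k (M : smooth_manifold R m) (N : smooth_manifold R n)
    (L : smooth_manifold R k) (g : N -> L) (f : M -> N) :
  smooth_map g -> smooth_map f -> smooth_map (g \o f).
Proof.
move=> sg sf; have [cg _] := sg; have [cf _] := sf.
have cgf : continuous (g \o f).
  by move=> x; apply: continuous_comp; [exact: cf|exact: cg].
split=> // p s; apply/smooth_onP.
  apply: open_chart_image; last by move=> ? [].
  apply: openI; first exact: cdom_open.
  by apply: open_comp => [x _|]; [exact: cgf|exact: cdom_open].
move=> _ [q [pq sq] <-]; pose r := f q.
have rq : cdom r (f q) by exact: cdom_center.
apply: (@smooth_at_ext _ _ _ (fun x => lexpr g r s (lexpr f p r x))).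
  apply: filterS (near_lexpr_cdom sf pq rq) => x [_ rx _].
  by rewrite /lexpr /= chartK.
apply: (smooth_at_comp (phi := lexpr g r s)); first exact: smooth_lexpr.
by rewrite lexpr_chart//; exact: smooth_lexpr.
Qed.

Section Composition.
Context {m n k : nat}.
Variables (M : smooth_manifold R m) (N : smooth_manifold R n)
  (L : smooth_manifold R k) (g : N -> L) (f : M -> N).
Variables (p : M) (r : N) (s : L) (q : M).
Hypotheses (sg : smooth_map g) (sf : smooth_map f).
Hypotheses (pq : cdom p q) (rq : cdom r (f q)) (sq : cdom s (g (f q))).

Lemma lexpr_comp_near : \forall x \near chart p q,
  lexpr (g \o f) p s x = (lexpr g r s \o lexpr f p r) x.
Proof.
apply: filterS (near_lexpr_cdom sf pq rq) => x [_ rx _].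
by rewrite /lexpr /= chartK.
Qed.

Lemma diff_lexpr_comp x :
  'd (lexpr (g \o f) p s) (chart p q) x =
  'd (lexpr g r s) (chart r (f q)) ('d (lexpr f p r) (chart p q) x).
Proof.
have df := smooth_at_diff (smooth_lexpr sf pq rq).
have dg : differentiable (lexpr g r s) (lexpr f p r (chart p q)).
  by rewrite lexpr_chart//; exact: smooth_at_diff (smooth_lexpr sg rq sq).
have nE : \forall x \near chart p q,
    (lexpr g r s \o lexpr f p r) x = lexpr (g \o f) p s x.
  by apply: filterS lexpr_comp_near => y ->.
have [_ ->] := near_eq_diff nE (differentiable_comp df dg).
by rewrite (diff_comp df dg) /= lexpr_chart.
Qed.

End Composition.

Lemma diff_lexpr_id n (M : smooth_manifold R n) (p q : M) v : cdom p q ->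
  'd (lexpr id p p) (chart p q) v = v.
Proof.
move=> pq; have nE : \forall x \near chart p q, x = lexpr id p p x.
  by apply: filterS (near_chartI pq (cdom_open p) pq) => x [_ _].
have did : differentiable (fun x : 'rV[R]_n => x) (chart p q).
  exact: smooth_at_diff (smooth_at_id _).
have [_ ->] := near_eq_diff nE did.
exact: (congr1 (@^~ v) (diff_val (f := id))).
Qed.

Section TangentCharts.
Context {n : nat} {M : smooth_manifold R n}.
Implicit Types (p q r : M) (u v : 'rV[R]_n).

Lemma tchartE p q v : tchart p q v = 'd (lexpr id q p) (chart q q) v.
Proof. by []. Qed.

Lemma tchart_lin p q a u v :
  tchart p q (a *: u + v) = a *: tchart p q u + tchart p q v.
Proof. exact: (linearP ('d (chart p \o chartI q) (chart q q))). Qed.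

Lemma tchartB p q u v : tchart p q (u - v) = tchart p q u - tchart p q v.
Proof. exact: (linearB ('d (chart p \o chartI q) (chart q q))). Qed.

Lemma tchart0 p q : tchart p q (0 : 'rV[R]_n) = 0.
Proof. exact: (linear0 ('d (chart p \o chartI q) (chart q q))). Qed.

Lemma tchartZ p q a u : tchart p q (a *: u) = a *: tchart p q u.
Proof. by have := tchart_lin p q a u 0; rewrite !addr0 tchart0 addr0. Qed.

Lemma tchart_sum p q (I : Type) (s : seq I) (P : pred I) (F : I -> 'rV[R]_n) :
  tchart p q (\sum_(i <- s | P i) F i) = \sum_(i <- s | P i) tchart p q (F i).
Proof. exact: (linear_sum ('d (chart p \o chartI q) (chart q q))). Qed.

Lemma tchart_self p v : tchart p p v = v.
Proof. exact/diff_lexpr_id/cdom_center. Qed.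

Lemma tchartIE p q v : cdom p q ->
  tchartI p (chart p q) v = 'd (lexpr id p q) (chart p q) v.
Proof. by move=> pq; rewrite /tchartI chartK. Qed.

Lemma diff_trans p r s q v : cdom p q -> cdom r q -> cdom s q ->
  'd (lexpr id r s) (chart r q) ('d (lexpr id p r) (chart p q) v) =
  'd (lexpr id p s) (chart p q) v.
Proof.
move=> pq rq sq; apply/esym.
exact: (diff_lexpr_comp (g := id) (f := id) (smooth_map_id M) (smooth_map_id M)).
Qed.

Lemma diff_transK p r q v : cdom p q -> cdom r q ->
  'd (lexpr id r p) (chart r q) ('d (lexpr id p r) (chart p q) v) = v.
Proof. by move=> pq rq; rewrite diff_trans// diff_lexpr_id. Qed.

Lemma tchart_trans p r q v : cdom p q -> cdom r q ->
  tchart r q v = 'd (lexpr id p r) (chart p q) (tchart p q v).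
Proof.
by move=> pq rq; apply/esym; apply: diff_trans => //; exact: cdom_center.
Qed.

Lemma tchartK p q v : cdom p q -> tchartI p (chart p q) (tchart p q v) = v.
Proof.
move=> pq; rewrite tchartIE// -[tchart p q v]/('d (lexpr id q p) (chart q q) v).
by rewrite diff_trans ?diff_lexpr_id//; exact: cdom_center.
Qed.

Lemma tchartIK p q v : cdom p q -> tchart p q (tchartI p (chart p q) v) = v.
Proof.
move=> pq; rewrite tchartIE//; apply: diff_transK => //; exact: cdom_center.
Qed.

Lemma tchart_inj p q u v : cdom p q -> tchart p q u = tchart p q v -> u = v.
Proof. by move=> pq H; rewrite -(tchartK u pq) H tchartK. Qed.

Lemma tchartI_lin p q a u v : cdom p q -> tchartI p (chart p q) (a *: u + v) =
  a *: tchartI p (chart p q) u + tchartI p (chart p q) v.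
Proof. by move=> pq; rewrite !tchartIE// linearP. Qed.

End TangentCharts.

Section TangentMaps.
Context {m n : nat} {M : smooth_manifold R m} {N : smooth_manifold R n}.
Variable f : M -> N.
Implicit Types (p q : M) (r : N) (u v : 'rV[R]_m).

Lemma tmapE p v : tmap f p v = 'd (lexpr f p (f p)) (chart p p) v.
Proof. by []. Qed.

Lemma tmap_lin p a u v : tmap f p (a *: u + v) = a *: tmap f p u + tmap f p v.
Proof. exact: (linearP ('d (local_expr f p) (chart p p))). Qed.

Lemma tmapD p u v : tmap f p (u + v) = tmap f p u + tmap f p v.
Proof. by have := tmap_lin p 1 u v; rewrite !scale1r. Qed.

Lemma tmapN p u : tmap f p (- u) = - tmap f p u.
Proof. exact: (linearN ('d (local_expr f p) (chart p p))). Qed.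

Lemma tmap0 p : tmap f p 0 = 0.
Proof. exact: (linear0 ('d (local_expr f p) (chart p p))). Qed.

Lemma tmapZ p a u : tmap f p (a *: u) = a *: tmap f p u.
Proof. by have := tmap_lin p a u 0; rewrite !addr0 tmap0 addr0. Qed.

Lemma tmap_sum p (I : Type) (s : seq I) (P : pred I) (F : I -> 'rV[R]_m) :
  tmap f p (\sum_(i <- s | P i) F i) = \sum_(i <- s | P i) tmap f p (F i).
Proof. exact: (linear_sum ('d (local_expr f p) (chart p p))). Qed.

Lemma tmap_mxE p v : tmap f p v = v *m tmap_mx f p.
Proof. by rewrite /tmap_mx /jacobian mul_rV_lin1. Qed.

Hypothesis sf : smooth_map f.

(** Chain rule for f written as id after f and as f after id; the intermediate charts, at f q and at
    p, give the two sides. *)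
Lemma tmap_chart p q r v : cdom p q -> cdom r (f q) ->
  tchart r (f q) (tmap f q v) = 'd (lexpr f p r) (chart p q) (tchart p q v).
Proof.
move=> pq rq; have qq := cdom_center q; have ff := cdom_center (f q).
rewrite (tchartE r) (tmapE q) (tchartE p).
have H1 := diff_lexpr_comp (g := id) (f := f) (smooth_map_id N) sf qq ff rq v.
have H2 := diff_lexpr_comp (g := f) (f := id) sf (smooth_map_id M) qq pq rq v.
exact: etrans (esym H1) H2.
Qed.

End TangentMaps.

Lemma tmap_comp m n k (M : smooth_manifold R m) (N : smooth_manifold R n)
    (L : smooth_manifold R k) (g : N -> L) (f : M -> N) p v :
  smooth_map g -> smooth_map f ->
  tmap (g \o f) p v = tmap g (f p) (tmap f p v).
Proof.
move=> sg sf; rewrite !tmapE.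
by rewrite (diff_lexpr_comp (r := f p) sg sf)//; exact: cdom_center.
Qed.

Lemma tmap_id n (M : smooth_manifold R n) (p : M) v : tmap id p v = v.
Proof. exact: tchart_self. Qed.

End LocalExpressions.

Section Metric.
Context {R : realType} {n : nat} {M : riemannian R n}.
Implicit Types (p q : M) (u v : 'rV[R]_n).

Lemma bilin_gram p q u v : cdom p q -> bilin (gram (@metric R n M) p (chart p q)) u v =
  inner q (tchartI p (chart p q) u) (tchartI p (chart p q) v).
Proof.
move=> pq; have lI w : tchartI p (chart p q) w =
    \sum_i w 0 i *: tchartI p (chart p q) (delta_mx 0 i).
  rewrite !tchartIE// [in LHS](row_sum_delta w) linear_sum.
  by apply: eq_bigr => i _; rewrite linearZ/= tchartIE.
rewrite /inner [in RHS](lI u) [in RHS](lI v) bilin_suml.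
rewrite [in LHS](row_sum_delta u) bilin_suml; apply: eq_bigr => i _.
rewrite [in LHS](row_sum_delta v) bilin_sumr [RHS]bilin_sumr.
apply: eq_bigr => j _.
by rewrite !bilinZl !bilinZr bilin_delta mxE chartK.
Qed.

Lemma inner_gram p q u v : cdom p q -> inner q u v =
  bilin (gram (@metric R n M) p (chart p q)) (tchart p q u) (tchart p q v).
Proof. by move=> pq; rewrite bilin_gram// !tchartK. Qed.

Lemma innerC q u v : inner q u v = inner q v u :> R.
Proof. by apply: bilinC; exact: metric_sym. Qed.

Lemma inner_eq0 q u : inner q u u = 0 -> u = 0.
Proof.
move=> u0; apply/eqP/negPn/negP => /(metric_posdef q).
by rewrite -/(inner q u u) u0 ltxx.
Qed.

Lemma metric_unit q : metric q \in unitmx.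
Proof. exact/posdef_unitmx/metric_posdef. Qed.

Lemma metric_at_gram p q : cdom p q ->
  metric_at (gram (@metric R n M) p) (chart p q).
Proof.
move=> pq; split.
- apply: smooth_on_at (metric_smooth p) _; first exact: chart_image_open.
  by exists q.
- apply: filterS (near_chartI pq (cdom_open p) pq) => x [px _ xE].
  by apply: bilin_sym => u v; rewrite -xE !bilin_gram// innerC.
- apply: posdef_unitmx => v v0; rewrite bilin_gram//; apply: metric_posdef.
  apply: contra_neq v0 => v0; rewrite -(tchartIK v pq) v0; exact: tchart0.
Qed.

End Metric.

Lemma isometric_near_lexpr (R : realType) m n (M : riemannian R m) (N : riemannian R n)
    (f : M -> N) p r q : smooth_map f ->
  (forall p x y, inner (f p) (tmap f p x) (tmap f p y) = inner p x y) ->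
  cdom p q -> cdom r (f q) ->
  isometric_near (gram (@metric R m M) p) (gram (@metric R n N) r) (lexpr f p r)
    (chart p q).
Proof.
move=> sf isof pq rq.
apply: filterS (near_lexpr_cdom sf pq rq) => x [px rx xE] u v.
suff H q' : cdom p q' -> cdom r (f q') ->
    bilin (gram (@metric R m M) p (chart p q')) u v =
    bilin (gram (@metric R n N) r (lexpr f p r (chart p q')))
      ('d (lexpr f p r) (chart p q') u) ('d (lexpr f p r) (chart p q') v).
  by have := H _ px rx; rewrite xE.
move=> pq' rq'; rewrite (bilin_gram u v pq') -isof (inner_gram _ _ rq').
rewrite (tmap_chart sf _ pq' rq') (tmap_chart sf _ pq' rq').
by rewrite (tchartIK u pq') (tchartIK v pq') (lexpr_chart f r pq').
Qed.

Local Opaque chr.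

Notation cgram p := (gram (@metric _ _ _) p).

Section Connection.
Context {R : realType}.

Lemma II_near m n (G : 'rV[R]_m -> 'M[R]_m) (G' : 'rV[R]_n -> 'M[R]_n)
    (F F' : 'rV[R]_m -> 'rV[R]_n) x u v : (\forall y \near x, F y = F' y) ->
  differentiable F x -> II G G' F x u v = II G G' F' x u v.
Proof.
move=> FF dF; have [_ dE] := near_eq_diff FF dF.
have hE : hess F x u v = hess F' x u v.
  apply: near_eq_derive; apply: filterS (near_join FF) => y.
  exact: near_eq_derive.
have dw w : 'd F x w = 'd F' x w by exact/esym/(congr1 (@^~ w) dE).
suff H h h' a a' b b' c c' d d' : h = h' -> a = a' -> b = b' -> c = c' -> d = d' ->
    h + chr G' a b c - d = h' + chr G' a' b' c' - d' :> 'rV[R]_n.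
  exact: (H _ _ _ _ _ _ _ _ _ _ hE (nbhs_singleton FF) (dw u) (dw v) (dw _)).
by move=> -> -> -> -> ->.
Qed.

Lemma II_comp_at m n k (G1 : 'rV[R]_m -> 'M[R]_m) (G2 : 'rV[R]_n -> 'M[R]_n)
    (G3 : 'rV[R]_k -> 'M[R]_k) (B : 'rV[R]_m -> 'rV[R]_n)
    (A : 'rV[R]_n -> 'rV[R]_k) x z u v :
  B x = z -> smooth_at B x -> smooth_at A z ->
  II G1 G3 (A \o B) x u v =
  II G2 G3 A z ('d B x u) ('d B x v) + 'd A z (II G1 G2 B x u v).
Proof. by move=> <-; exact: II_comp. Qed.

Lemma II_transition n (L : riemannian R n) (a b c : L) u v : cdom a c -> cdom b c ->
  II (cgram a) (cgram b) (lexpr (id : L -> L) a b) (chart a c) u v = 0.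
Proof.
move=> ac bc; have sid := smooth_map_id L.
have isoid (q : L) x y : inner q (tmap id q x) (tmap id q y) = inner q x y.
  by rewrite !tmap_id.
apply: II_equidim.
- exact: (smooth_lexpr sid ac bc).
- exact: metric_at_gram.
- by rewrite (lexpr_chart id b ac); exact: metric_at_gram.
- exact: (isometric_near_lexpr (f := id) sid isoid ac bc).
- move=> w; exists ('d (lexpr (id : L -> L) b a) (chart b c) w).
  exact: (diff_transK w bc ac).
Qed.

Section Covd.
Context {n : nat} {N : riemannian R n} {E : normedModType R}.
Variables (u : E -> N) (W : E -> 'rV[R]_n) (y v : E).

(** The chart in which [covd] is computed moves with [u y]. Substituting all four ingredients at
    once lets that point be traded for an equal [r] without isolated rewriting inside
    derivatives. *)
Lemma covd_val r X Y Z : u y = r -> 'D_v (fun z => tchart r (u z) (W z)) y = X ->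
  'D_v (chart r \o u) y = Y -> W y = Z ->
  covd u W y v = X + chr (cgram r) (chart r r) Y Z.
Proof. by move=> <- <- <- <-. Qed.

Lemma near_cdom_along r : {for y, continuous u} -> cdom r (u y) ->
  \forall z \near y, cdom r (u z).
Proof. by move=> cu ry; exact: continuous_near cu (cdom_open r) ry. Qed.

(* The expression defining [covd] in the chart at [u y] transforms as a tangent
   vector, since chart transitions are isometries and hence have vanishing
   second fundamental form. *)
Lemma covd_chart r : {for y, continuous u} -> cdom r (u y) ->
  differentiable (chart r \o u) y ->
  differentiable (fun z => tchart r (u z) (W z)) y ->
  tchart r (u y) (covd u W y v) =
  'D_v (fun z => tchart r (u z) (W z)) y +
  chr (cgram r) (chart r (u y)) ('D_v (chart r \o u) y) (tchart r (u y) (W y)).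
Proof.
move=> cu ry dc dW; set p := u y; set c := chart r \o u in dc *.
set w := (fun z => _) in dW *.
have pp : cdom p p := cdom_center p.
pose T := lexpr (id : N -> N) r p.
have sT : smooth_at T (c y) by exact: (smooth_lexpr (smooth_map_id N) ry pp).
have nr := near_cdom_along cu ry; have np := near_cdom_along cu pp.
have cE : \forall z \near y, (T \o c) z = (chart p \o u) z.
  by apply: filterS nr => z rz; rewrite /T /c /= /lexpr /= chartK.
have wE : \forall z \near y, 'd T (c z) (w z) = tchart p (u z) (W z).
  by apply: filterS2 nr np => z rz pz; rewrite (tchart_trans _ rz pz).
have [_ Dw] := derive_dapp v sT dc dW.
have dT := smooth_at_diff sT.
have covdE := covd_val (erefl p) (etrans (esym (near_eq_derive v wE)) Dw)
  (etrans (esym (near_eq_derive v cE)) (derive_comp v dc dT)) (erefl (W y)).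
have Wy : W y = 'd T (c y) (w y).
  exact: etrans (esym (tchart_self p (W y))) (esym (nbhs_singleton wE)).
have TcE : T (c y) = chart p p by exact: (nbhs_singleton cE).
have II0 := II_transition ('D_v c y) (w y) ry pp.
have H : hess T (c y) ('D_v c y) (w y) +
    chr (cgram p) (chart p p) ('d T (c y) ('D_v c y)) ('d T (c y) (w y)) =
    'd T (c y) (chr (cgram r) (c y) ('D_v c y) (w y)).
  by apply/eqP; rewrite -subr_eq0 -TcE; apply/eqP; exact: II0.
have {}covdE : covd u W y v = 'd T (c y) ('D_v w y + chr (cgram r) (c y) ('D_v c y) (w y)).
  rewrite [LHS]covdE Wy; apply/esym.
  rewrite [LHS](linearD ('d T (c y)) ('D_v w y) (chr (cgram r) (c y) ('D_v c y) (w y))).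
  rewrite -H; move: (hess _ _ _ _) (chr _ _ _ _) ('d T (c y) ('D_v w y)) => a b d.
  by rewrite addrA [d + a]addrC.
rewrite covdE; exact: (diff_transK (p := r) (r := p) (q := p)).
Qed.

End Covd.

Section SecondFundamentalForm.
Context {m n : nat} {M : riemannian R m} {N : riemannian R n}.
Variable f : M -> N.
Hypothesis sf : smooth_map f.
Implicit Types (p q : M) (r : N) (x y : 'rV[R]_m).

Lemma const_field_center p y : const_field p y p = y.
Proof.
by rewrite /const_field tchartIE ?diff_lexpr_id//; exact: cdom_center.
Qed.

Lemma nabla_const_field p x y :
  nabla (const_field p y) p x = chr (cgram p) (chart p p) x y.
Proof.
have pp := cdom_center p.
have uy : (id \o chartI p) (chart p p) = p by rewrite /= chartK.
have nC : \forall z \near chart p p, y =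
    tchart p ((id \o chartI p) z) ((const_field p y \o chartI p) z).
  apply: filterS (near_chartI pp (cdom_open p) pp) => z [pz _ zE].
  by rewrite /const_field /= tchartIK.
have sI := smooth_lexpr (smooth_map_id M) pp pp.
have HY : 'D_x (chart p \o (id \o chartI p)) (chart p p) = x.
  by apply: etrans (deriveE _ (smooth_at_diff sI)) _; exact: diff_lexpr_id.
have HZ : (const_field p y \o chartI p) (chart p p) = y.
  by rewrite /= chartK// const_field_center.
have HX := etrans (esym (near_eq_derive x nC)) (derive_cst _ _ _).
exact: etrans (covd_val uy HX HY HZ) (add0r _).
Qed.

Lemma sff_center p x y : sff f p x y =
  II (cgram p) (cgram (f p)) (lexpr f p (f p)) (chart p p) x y.
Proof.
have pp := cdom_center p; have rr := cdom_center (f p).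
have uy : (f \o chartI p) (chart p p) = f p by rewrite /= chartK.
set F := lexpr f p (f p).
have sF : smooth_at F (chart p p) by exact: smooth_lexpr.
have nC : \forall z \near chart p p, 'd F z y =
    tchart (f p) ((f \o chartI p) z)
      (((fun q => tmap f q (const_field p y q)) \o chartI p) z).
  apply: filterS (near_lexpr_cdom sf pp rr) => z [pz rz zE].
  by rewrite /= (tmap_chart sf _ pz rz) zE /const_field tchartIK.
have HX := etrans (esym (near_eq_derive x nC)) (derive_diff x y sF).2.
have HY : 'D_x (chart (f p) \o (f \o chartI p)) (chart p p) = 'd F (chart p p) x.
  exact: deriveE _ (smooth_at_diff sF).
have HZ : ((fun q => tmap f q (const_field p y q)) \o chartI p) (chart p p) =
    'd F (chart p p) y.
  by rewrite /= chartK// const_field_center.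
have E := covd_val uy HX HY HZ.
rewrite /sff /= nabla_const_field [nabla_along _ _ _ _]E.
have FE : F (chart p p) = chart (f p) (f p) by exact: lexpr_chart.
by rewrite /II FE.
Qed.

Lemma sff_chart p r q x y : cdom p q -> cdom r (f q) ->
  tchart r (f q) (sff f q x y) =
  II (cgram p) (cgram r) (lexpr f p r) (chart p q) (tchart p q x) (tchart p q y).
Proof.
move=> pq rq; have qq := cdom_center q; have ss := cdom_center (f q).
set s := f q in rq ss *.
pose A := lexpr (id : N -> N) r s; pose B := lexpr (id : M -> M) q p.
pose F := lexpr f p r.
have sB : smooth_at B (chart q q) by exact: (smooth_lexpr (smooth_map_id M)).
have Bq : B (chart q q) = chart p q by exact: lexpr_chart.
have sF : smooth_at F (chart p q) by exact: smooth_lexpr.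
have Fq : F (chart p q) = chart r s by exact: lexpr_chart.
have sA : smooth_at A (chart r s) by exact: (smooth_lexpr (smooth_map_id N)).
have Aq : A (chart r s) = chart s s by exact: lexpr_chart.
have nE : \forall z \near chart q q, lexpr f q s z = (A \o (F \o B)) z.
  have n1 := lexpr_comp_near f r (smooth_map_id M) qq pq.
  have n2 := lexpr_comp_near (id : N -> N) s sf qq rq.
  apply: filterS2 n1 n2 => z z1 z2.
  by rewrite [LHS]z2 /= -[RHS]/(A ((F \o B) z)) -[(F \o B) z]z1.
have dL := smooth_at_diff (smooth_lexpr sf qq ss).
have FBq : (F \o B) (chart q q) = chart r s by rewrite /= Bq.
have sFB : smooth_at (F \o B) (chart q q).
  by apply: (@smooth_at_comp _ _ _ _ _ F B) => //; rewrite Bq.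
have EFB : II (cgram q) (cgram r) (F \o B) (chart q q) x y =
    II (cgram p) (cgram r) F (chart p q) (tchart p q x) (tchart p q y).
  apply: etrans (II_comp_at _ (cgram p) _ _ _ Bq sB sF) _.
  apply: etrans (congr1 _ (congr1 _ (II_transition x y qq pq))) _.
  by apply: etrans (congr1 _ (linear0 ('d F (chart p q)))) (addr0 _).
have EA : sff f q x y = 'd A (chart r s) (II (cgram q) (cgram r) (F \o B) (chart q q) x y).
  apply: etrans (sff_center q x y) _.
  apply: etrans (II_near _ _ x y nE dL) _.
  apply: etrans (II_comp_at _ (cgram r) _ _ _ FBq sFB sA) _.
  by apply: etrans (congr1 (+%R^~ _) (II_transition _ _ rq ss)) (add0r _).
apply: etrans (congr1 (tchart r s) (etrans EA (congr1 _ EFB))) _.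
exact: (diff_transK _ rq ss).
Qed.

Let sF p : smooth_at (lexpr f p (f p)) (chart p p).
Proof. by apply: smooth_lexpr => //; exact: cdom_center. Qed.

Let mF p : metric_at (cgram (f p)) (lexpr f p (f p) (chart p p)).
Proof.
have pp := cdom_center p; rewrite (lexpr_chart f (f p) pp).
exact/metric_at_gram/cdom_center.
Qed.

Lemma sff_linr p a x y y' : sff f p x (a *: y + y') = a *: sff f p x y + sff f p x y'.
Proof.
have mG := metric_at_gram (cdom_center p).
rewrite (sff_center p x (a *: y + y')) (sff_center p x y) (sff_center p x y').
exact: (II_linr a x y y' (@sF p) (metric_at_diff mG) (metric_at_diff (@mF p))).
Qed.

Lemma sffC p x y : sff f p x y = sff f p y x.
Proof.
rewrite (sff_center p x y) (sff_center p y x).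
exact: (IIC x y (@sF p) (metric_at_gram (cdom_center p)) (@mF p)).
Qed.

Lemma sff_linl p a x x' y : sff f p (a *: x + x') y = a *: sff f p x y + sff f p x' y.
Proof. by rewrite sffC sff_linr sffC (sffC p y x'). Qed.

Hypothesis isof : forall p x y, inner (f p) (tmap f p x) (tmap f p y) = inner p x y.

Lemma sff_normal p x y : normal_space f p (sff f p x y).
Proof.
move=> z; have pp := cdom_center p; have rr := cdom_center (f p).
have iso := isometric_near_lexpr sf isof pp rr.
have := II_normal x y z (@sF p) (metric_at_gram pp) (@mF p) iso.
rewrite (lexpr_chart f (f p) pp) => H.
rewrite innerC (inner_gram _ _ rr) (tchart_self _ (sff f p x y)) sff_center.
by rewrite (tchart_self _ (tmap f p z)).
Qed.

End SecondFundamentalForm.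

Lemma sff_comp m n k (M : riemannian R m) (N : riemannian R n) (L : riemannian R k)
    (g : N -> L) (f : M -> N) p x y : smooth_map g -> smooth_map f ->
  sff (g \o f) p x y =
  sff g (f p) (tmap f p x) (tmap f p y) + tmap g (f p) (sff f p x y).
Proof.
move=> sg sf; have pp := cdom_center p; have rr := cdom_center (f p).
have tt := cdom_center (g (f p)); have sgf := smooth_map_comp sg sf.
have nE := lexpr_comp_near g (g (f p)) sf pp rr.
have sF := smooth_lexpr sf pp rr; have sG := smooth_lexpr sg rr tt.
have dGF := smooth_at_diff (smooth_lexpr sgf pp tt).
apply: etrans (sff_center sgf p x y) _.
apply: etrans (II_near _ _ x y nE dGF) _.
apply: etrans (II_comp_at _ (cgram (f p)) _ _ _ (lexpr_chart f (f p) pp) sF sG) _.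
by rewrite (sff_center sf p x y) (sff_center sg).
Qed.

(** An involution has onto tangent maps, so the equidimensional case applies. *)
Lemma sff_isometry n (M : riemannian R n) (s : M -> M) p x y :
  involutive_isometry s -> sff s p x y = 0.
Proof.
move=> [ss inv iso]; have pp := cdom_center p; have rr := cdom_center (s p).
apply: etrans (sff_center ss p x y) _.
have mG := metric_at_gram pp; have mG' := metric_at_gram rr.
rewrite -(lexpr_chart s (s p) pp) in mG'.
apply: (II_equidim x y (smooth_lexpr ss pp rr) mG mG' (isometric_near_lexpr ss iso pp rr)).
move=> w; have ssE : s \o s = id by apply/funext.
exists (tmap s (s p) w).
have := tmap_comp (s p) w ss ss; rewrite ssE tmap_id inv => E.
by rewrite [RHS]E.
Qed.

End Connection.

Local Transparent chr.

(** * Smooth maps, fields along maps, and rules for covariant derivatives *)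

Section Along.
Context {R : realType}.

Section OneMap.
Context {n : nat} {N : smooth_manifold R n} {E : normedModType R}.
Implicit Types (u : E -> N) (V W : E -> 'rV[R]_n) (y z : E) (r s : N).

(* [u] is a smooth map near [y]; [W] is a smooth vector field along [u] near [y] *)
Definition smc u y := {for y, continuous u} /\ smooth_at (chart (u y) \o u) y.
Definition smf u W y := smooth_at (fun z => tchart (u y) (u z) (W z)) y.

Lemma near_along u y r : smc u y -> cdom r (u y) -> \forall z \near y, cdom r (u z).
Proof. by move=> [cu _] ry; exact: continuous_near cu (cdom_open r) ry. Qed.

Lemma smc_chart u y r : smc u y -> cdom r (u y) -> smooth_at (chart r \o u) y.
Proof.
move=> su ry; have [cu suy] := su; set p := u y in ry suy.
have pp : cdom p (u y) by exact: cdom_center.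
apply: (@smooth_at_ext _ _ _ (fun z => lexpr id p r (chart p (u z)))).
  apply: filterS (near_along su pp) => z pz.
  by rewrite lexpr_chart.
apply: (@smooth_at_comp _ _ _ _ _ (lexpr id p r) (chart p \o u) y suy).
exact: (smooth_lexpr (smooth_map_id N)).
Qed.

Lemma smf_change u W y r s : smc u y -> cdom r (u y) -> cdom s (u y) ->
  smooth_at (fun z => tchart r (u z) (W z)) y ->
  smooth_at (fun z => tchart s (u z) (W z)) y.
Proof.
move=> su ry sy sW.
apply: (@smooth_at_ext _ _ _
  (fun z => 'd (lexpr id r s) (chart r (u z)) (tchart r (u z) (W z)))).
  apply: filterS2 (near_along su ry) (near_along su sy) => z rz sz.
  by rewrite -tchart_trans.
apply: (@smooth_at_dapp _ _ _ _ _ (lexpr id r s) (chart r \o u) _ y _ _ sW).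
  exact: (smooth_lexpr (smooth_map_id N)).
exact: smc_chart.
Qed.

Lemma smf_chart u W y r : smc u y -> smf u W y -> cdom r (u y) ->
  smooth_at (fun z => tchart r (u z) (W z)) y.
Proof. by move=> su sW ry; apply: smf_change sW => //; exact: cdom_center. Qed.

Lemma chart_smf u W y r : smc u y -> cdom r (u y) ->
  smooth_at (fun z => tchart r (u z) (W z)) y -> smf u W y.
Proof. by move=> su ry sW; apply: smf_change sW => //; exact: cdom_center. Qed.

(** [smc] refers to the chart at [u y], which changes with y. Near y that one chart still applies:
    continuity at z is recovered through [chartI], smoothness through the transition to the chart at
    [u z]. *)
Lemma smc_near u y : smc u y -> \forall z \near y, smc u z.
Proof.
move=> su; have [cu suy] := su; set p := u y in suy.
have np := near_along su (cdom_center (u y)).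
apply: filterS2 (near_join np) (smooth_at_near suy) => z pz sz.
have pzz := nbhs_singleton pz.
have cz : {for z, continuous u}.
  have E1 : \forall w \near z, chartI p (chart p (u w)) = u w.
    by apply: filterS pz => w pw; rewrite chartK.
  change (u @ z --> u z); rewrite -(nbhs_singleton E1).
  apply: cvg_trans (near_eq_cvg E1) _.
  apply: (@continuous_comp _ _ _ (chart p \o u) (chartI p) z (smooth_at_cont sz)).
  by apply: chartI_continuous; exists (u z).
split => //; have zz := cdom_center (u z).
apply: (@smooth_at_ext _ _ _ (fun w => lexpr id p (u z) (chart p (u w)))).
  by apply: filterS pz => w pw; rewrite lexpr_chart.
apply: (@smooth_at_comp _ _ _ _ _ (lexpr id p (u z)) (chart p \o u) z sz).
exact: (smooth_lexpr (smooth_map_id N)).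
Qed.

Lemma smf_ext u V W y : (\forall z \near y, V z = W z) -> smf u V y -> smf u W y.
Proof.
move=> VW sV; apply: smooth_at_ext sV.
by apply: filterS VW => z ->.
Qed.

Lemma smfZ u (a : E -> R) W y : smooth_at a y -> smf u W y ->
  smf u (fun z => a z *: W z) y.
Proof.
move=> sa sW; apply: smooth_at_ext (smooth_at_mxZ sa sW).
by near=> z; rewrite tchartZ.
Unshelve. all: by end_near. Qed.

Lemma smf_sum u (I : Type) (l : seq I) (P : pred I) (W : I -> E -> 'rV[R]_n) y :
  (forall i, P i -> smf u (W i) y) ->
  smf u (fun z => \sum_(i <- l | P i) W i z) y.
Proof.
move=> sW.
have := @smooth_at_mx_sum _ _ _ _ _ l P (fun i z => tchart (u y) (u z) (W i z)) y sW.
apply: smooth_at_ext.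
by near=> z; rewrite tchart_sum.
Unshelve. all: by end_near. Qed.

Lemma smfB u V W y : smf u V y -> smf u W y -> smf u (fun z => V z - W z) y.
Proof.
move=> sV sW; apply: smooth_at_ext (smooth_at_mxB sV sW).
by near=> z; rewrite tchartB.
Unshelve. all: by end_near. Qed.

End OneMap.

Lemma smc_diff n (N : smooth_manifold R n) (E : normedModType R) (u : E -> N) y r v :
  smc u y -> cdom r (u y) ->
  tchart r (u y) ('D_v (chart (u y) \o u) y) = 'D_v (chart r \o u) y.
Proof.
move=> su ry; have [cu suy] := su; set p := u y in ry suy *.
have pp : cdom p p by exact: cdom_center.
have E1 : \forall z \near y, (lexpr id p r \o (chart p \o u)) z = (chart r \o u) z.
  apply: filterS (near_along su pp) => z pz.
  by rewrite /= (lexpr_chart id r pz).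
apply: etrans _ (near_eq_derive v E1).
apply/esym; apply: derive_comp; first exact: smooth_at_diff.
exact/smooth_at_diff/(smooth_lexpr (smooth_map_id N)).
Qed.

Lemma smooth_curveP n (N : smooth_manifold R n) (c : R -> N) :
  smooth_curve c <-> forall t, smc c t.
Proof.
split=> [[cc sc] t|sc].
  split; first exact: cc.
  apply: smooth_on_at (sc (c t)) _; last exact: cdom_center.
  by apply: open_comp => [? _|]; [exact: cc|exact: cdom_open].
have cc : continuous c by move=> t; have [] := sc t.
split=> // q; apply/smooth_onP.
  by apply: open_comp => [? _|]; [exact: cc|exact: cdom_open].
by move=> t qt; exact: smc_chart (sc t) qt.
Qed.

Lemma smooth_along_curveP n (N : smooth_manifold R n) (c : R -> N) V :
  (forall t, smc c t) -> smooth_along_curve c V <-> forall t, smf c V t.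
Proof.
move=> sc; have cc : continuous c by move=> t; have [] := sc t.
have oc q : open (c @^-1` cdom q).
  by apply: open_comp => [? _|]; [exact: cc|exact: cdom_open].
split=> [sV t|sV q].
  exact: smooth_on_at (oc _) (sV (c t)) (cdom_center (c t)).
apply/smooth_onP => // t qt; exact: smf_chart (sc t) (sV t) qt.
Qed.

Lemma smc_lexpr m n (M : smooth_manifold R m) (N : smooth_manifold R n)
    (f : M -> N) p q : smooth_map f -> cdom p q -> smc (f \o chartI p) (chart p q).
Proof.
move=> sf pq; have [cf _] := sf; split.
  apply: continuous_comp; last exact: cf.
  by apply: chartI_continuous; exists q.
rewrite /= chartK//; exact: smooth_lexpr sf pq (cdom_center _).
Qed.

Lemma smc_comp m n (M : smooth_manifold R m) (N : smooth_manifold R n)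
    (E : normedModType R) (f : M -> N) (u : E -> M) y :
  smooth_map f -> smc u y -> smc (f \o u) y.
Proof.
move=> sf su; have [cf _] := sf; have [cu suy] := su; split.
  by apply: continuous_comp; [exact: cu|exact: cf].
have pp := cdom_center (u y); have rr := cdom_center (f (u y)).
apply: (@smooth_at_ext _ _ _ (fun z => lexpr f (u y) (f (u y)) (chart (u y) (u z)))).
  by apply: filterS (near_along su pp) => z pz; rewrite lexpr_chart.
apply: (@smooth_at_comp _ _ _ _ _ (lexpr f (u y) (f (u y))) (chart (u y) \o u) y suy).
exact: smooth_lexpr.
Qed.

Lemma smooth_alongP m n (M : smooth_manifold R m) (N : smooth_manifold R n)
    (f : M -> N) (U : set M) W : smooth_map f -> open U ->
  smooth_along U f W <->
  forall q, U q -> smf (f \o chartI q) (W \o chartI q) (chart q q).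
Proof.
move=> sf oU; have [cf _] := sf.
have oI p r : open (chart p @` (U `&` cdom p `&` f @^-1` cdom r)).
  apply: open_chart_image; last by move=> ? [[]].
  apply: openI; first by apply: openI => //; exact: cdom_open.
  by apply: open_comp => [? _|]; [exact: cf|exact: cdom_open].
split=> [sW q Uq|sW p r].
  have qq := cdom_center q; rewrite /smf /= chartK//.
  apply: smooth_on_at (oI q (f q)) (sW q (f q)) _.
  by exists q => //; split; [split|exact: cdom_center].
apply/smooth_onP => // _ [q [[Uq pq] rq] <-].
have qq := cdom_center q; have qE : (f \o chartI q) (chart q q) = f q by rewrite /= chartK.
have rq' : cdom r ((f \o chartI q) (chart q q)) by rewrite qE.
have s1 := smf_chart (smc_lexpr sf qq) (sW q Uq) rq'.
have sT : smooth_at (lexpr (id : M -> M) p q) (chart p q).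
  exact: (smooth_lexpr (smooth_map_id M)).
have Tq : lexpr (id : M -> M) p q (chart p q) = chart q q by exact: lexpr_chart.
rewrite -Tq in s1.
apply: smooth_at_ext (smooth_at_comp sT s1).
apply: filterS (near_chartI pq (cdom_open q) qq) => x [px qx xE].
by rewrite /lexpr /= chartK.
Qed.

Lemma tchart_velocity n (N : smooth_manifold R n) (c : R -> N) t r :
  smc c t -> cdom r (c t) ->
  tchart r (c t) (velocity c t) = 'D_1 (chart r \o c) t.
Proof. exact: smc_diff. Qed.

Lemma smf_velocity n (N : smooth_manifold R n) (c : R -> N) t :
  smc c t -> smf c (velocity c) t.
Proof.
move=> sc; have cc := cdom_center (c t); have [_ sct] := sc.
apply: smooth_at_ext (smooth_at_derive (1 : R) sct).
apply: filterS2 (smc_near sc) (near_along sc cc) => s ss cs.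
by rewrite tchart_velocity.
Qed.

Section Push.
Context {m n : nat} {M : smooth_manifold R m} {N : smooth_manifold R n}.
Variable f : M -> N.
Hypothesis sf : smooth_map f.
Context {E : normedModType R}.
Variables (u : E -> M) (y : E).
Hypothesis su : smc u y.

Lemma near_along_comp r : cdom r (f (u y)) -> \forall z \near y, cdom r (f (u z)).
Proof. by move=> ry; exact: near_along (smc_comp sf su) ry. Qed.

Lemma smf_tmap W : smf u W y -> smf (f \o u) (fun z => tmap f (u z) (W z)) y.
Proof.
move=> sW; have pp := cdom_center (u y); have rr := cdom_center (f (u y)).
have [_ suy] := su.
apply: (@smooth_at_ext _ _ _ (fun z =>
  'd (lexpr f (u y) (f (u y))) (chart (u y) (u z)) (tchart (u y) (u z) (W z)))).
  apply: filterS2 (near_along su pp) (near_along_comp rr) => z pz rz.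
  by rewrite -tmap_chart.
apply: (@smooth_at_dapp _ _ _ _ _ (lexpr f (u y) (f (u y))) (chart (u y) \o u) _ y _ suy sW).
exact: smooth_lexpr.
Qed.

Lemma velocity_comp v : 'D_v (chart (f (u y)) \o (f \o u)) y =
  tmap f (u y) ('D_v (chart (u y) \o u) y).
Proof.
have pp := cdom_center (u y); have rr := cdom_center (f (u y)).
have [_ suy] := su.
have E1 : \forall z \near y, (lexpr f (u y) (f (u y)) \o (chart (u y) \o u)) z =
    (chart (f (u y)) \o (f \o u)) z.
  by apply: filterS (near_along su pp) => z pz; rewrite /= (lexpr_chart f _ pz).
apply: etrans (esym (near_eq_derive v E1)) _.
apply: derive_comp; first exact: smooth_at_diff.
exact/smooth_at_diff/smooth_lexpr.
Qed.

End Push.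

Section PushRiemannian.
Context {m n : nat} {M : riemannian R m} {N : riemannian R n}.
Variable f : M -> N.
Hypothesis sf : smooth_map f.
Context {E : normedModType R}.
Variables (u : E -> M) (y : E).
Hypothesis su : smc u y.

(** Gauss formula along an arbitrary map u: in charts, differentiating dF applied to W produces a
    Hessian term, which the Christoffel terms complete to [II]. *)
Lemma covd_tmap W v : smf u W y ->
  covd (f \o u) (fun z => tmap f (u z) (W z)) y v =
  tmap f (u y) (covd u W y v) + sff f (u y) ('D_v (chart (u y) \o u) y) (W y).
Proof.
move=> sW; have pp := cdom_center (u y); have rr := cdom_center (f (u y)).
have [_ suy] := su; set p := u y in pp rr suy *; set r := f p in rr *.
pose F := lexpr f p r.
have sF : smooth_at F (chart p p) by exact: smooth_lexpr.
have dF := smooth_at_diff sF.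
have E1 : \forall z \near y, 'd F (chart p (u z)) (tchart p (u z) (W z)) =
    tchart r ((f \o u) z) (tmap f (u z) (W z)).
  apply: filterS2 (near_along su pp) (near_along_comp sf su rr) => z pz rz.
  by rewrite -tmap_chart.
have [_ D1] := derive_dapp v (c := chart p \o u) sF (smooth_at_diff suy) (smooth_at_diff sW).
set X := 'D_v (chart p \o u) y in D1 *.
set Y := 'D_v (fun z => tchart p (u z) (W z)) y in D1.
have WE : tchart p (u y) (W y) = W y by exact: tchart_self.
rewrite WE in D1.
have E2 := covd_val (u := f \o u) (r := r) (erefl _) (etrans (esym (near_eq_derive v E1)) D1)
  (velocity_comp sf su v) (erefl (tmap f p (W y))).
have E3 := covd_val (u := u) (r := p) (erefl _) (erefl Y) (erefl X) (erefl (W y)).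
apply: etrans E2 _; rewrite [covd u W y v]E3 tmapD (sff_center sf) /II.
rewrite [lexpr f p (f p) (chart p p)](lexpr_chart f r pp).
rewrite -/r -/F -!(tmapE f p).
move: (hess _ _ _ _) (chr _ _ (tmap _ _ _) _) => a b.
rewrite -[_ X (W y)]/(chr (cgram p) (chart p p) X (W y)).
move: (tmap f p Y) (tmap f p (chr _ _ _ _)) => d e.
by apply/rowP => i; rewrite !mxE; ring.
Qed.

(** In fixed charts the second fundamental form is bilinear with smooth components [H i j]; both
    fields are expanded in coordinates. *)
Lemma smf_sff X Y : smf u X y -> smf u Y y ->
  smf (f \o u) (fun z => sff f (u z) (X z) (Y z)) y.
Proof.
move=> sX sY; have pp := cdom_center (u y); have rr := cdom_center (f (u y)).
have [_ suy] := su; set p := u y in pp rr suy *; set r := f p in rr *.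
pose F := lexpr f p r.
pose H i j z := II (cgram p) (cgram r) F z (delta_mx 0 i) (delta_mx 0 j).
pose a z := tchart p (u z) (X z); pose b z := tchart p (u z) (Y z).
apply: (@smooth_at_ext _ _ _ (fun z => \sum_i \sum_j
    (a z 0 i * b z 0 j) *: H i j (chart p (u z)))).
  apply: filterS2 (near_along su pp) (near_along_comp sf su rr) => z pz rz.
  have lr w s w1 w2 : II (cgram p) (cgram r) F (chart p (u z)) w (s *: w1 + w2) =
      s *: II (cgram p) (cgram r) F (chart p (u z)) w w1 +
      II (cgram p) (cgram r) F (chart p (u z)) w w2.
    apply: (II_linr _ _ _ _ (smooth_lexpr sf pz rz)).
      exact/metric_at_diff/metric_at_gram.
    by rewrite (lexpr_chart f r pz); exact/metric_at_diff/metric_at_gram.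
  have lC w1 w2 : II (cgram p) (cgram r) F (chart p (u z)) w1 w2 =
      II (cgram p) (cgram r) F (chart p (u z)) w2 w1.
    apply: (IIC _ _ (smooth_lexpr sf pz rz)).
      exact: metric_at_gram.
    by rewrite (lexpr_chart f r pz); exact: metric_at_gram.
  have l0 w : II (cgram p) (cgram r) F (chart p (u z)) w 0 = 0.
    have := lr w (-1) 0 0; rewrite scaler0 addr0 scaleN1r addNr; exact.
  have ls w w' : II (cgram p) (cgram r) F (chart p (u z)) w w' =
      \sum_j w' 0 j *: II (cgram p) (cgram r) F (chart p (u z)) w (delta_mx 0 j).
    rewrite [in LHS](row_sum_delta w').
    elim/big_rec2 : _ => [|j s1 s2 _ <-]; first exact: l0.
    exact: lr.
  rewrite [RHS](sff_chart sf _ _ pz rz) -/F -/(a z) -/(b z) lC ls.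
  apply: eq_bigr => i _; rewrite lC ls scaler_sumr.
  by apply: eq_bigr => j _; rewrite scalerA.
have sa := (smooth_at_mxP _ _).1 sX; have sb := (smooth_at_mxP _ _).1 sY.
apply: smooth_at_mx_sum => i _; apply: smooth_at_mx_sum => j _.
apply: smooth_at_mxZ; first by apply: smooth_atM; [exact: sa|exact: sb].
apply: (@smooth_at_comp _ _ _ _ _ (H i j) (chart p \o u) y suy).
have mF : metric_at (cgram r) (F (chart p p)).
  by rewrite [F _](lexpr_chart f r pp); exact: metric_at_gram.
exact: (smooth_at_II _ _ (smooth_lexpr sf pp rr) (metric_at_gram pp) mF).
Qed.

End PushRiemannian.

Section CovdRules.
Context {n : nat} {N : riemannian R n} {E : normedModType R}.
Variables (u : E -> N) (y v : E).
Implicit Types (V W : E -> 'rV[R]_n).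

Lemma covd_ext V W : (\forall z \near y, V z = W z) -> covd u V y v = covd u W y v.
Proof.
move=> VW; have E1 : \forall z \near y,
    tchart (u y) (u z) (V z) = tchart (u y) (u z) (W z) by apply: filterS VW => z ->.
exact: (covd_val (erefl _) (near_eq_derive v E1) (erefl _) (nbhs_singleton VW)).
Qed.

Let chrP : differentiable (cgram (u y)) (chart (u y) (u y)).
Proof. exact/metric_at_diff/metric_at_gram/cdom_center. Qed.

Lemma covdZD (a : E -> R) V W : smooth_at a y -> smf u V y -> smf u W y ->
  covd u (fun z => a z *: V z + W z) y v =
  'D_v a y *: V y + a y *: covd u V y v + covd u W y v.
Proof.
move=> sa sV sW.
pose Vc z := tchart (u y) (u z) (V z); pose Wc z := tchart (u y) (u z) (W z).
have dV : differentiable Vc y by exact: smooth_at_diff.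
have dW : differentiable Wc y by exact: smooth_at_diff.
have da := smooth_at_diff sa.
have E1 : \forall z \near y, a z *: Vc z + Wc z = tchart (u y) (u z) (a z *: V z + W z).
  by near=> z; rewrite tchart_lin.
have dE i : 'D_v (fun z => a z *: Vc z + Wc z) y 0 i =
   ('D_v a y *: V y + a y *: 'D_v Vc y + 'D_v Wc y) 0 i.
  have d1 : differentiable (fun z => a z *: Vc z + Wc z) y.
    apply: smooth_at_diff; apply: smooth_at_mxD => //; exact: smooth_at_mxZ.
  rewrite (derive_entry v 0 i d1).
  have -> : (fun z => (a z *: Vc z + Wc z) 0 i) =
      a * (fun z => Vc z 0 i) + (fun z => Wc z 0 i).
    by apply/funext => z; rewrite !mxE.
  have dVi := differentiable_entry 0 i dV; have dWi := differentiable_entry 0 i dW.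
  rewrite deriveD; [|exact: diff_derivable (differentiableM _ _)|exact: diff_derivable].
  rewrite deriveM; [|exact: diff_derivable|exact: diff_derivable].
  rewrite -(derive_entry v 0 i dV) -(derive_entry v 0 i dW) !mxE /Vc tchart_self.
  by rewrite [X in X + _]addrC; congr (_ + _ + _); exact: mulrC.
have HX : 'D_v (fun z => tchart (u y) (u z) (a z *: V z + W z)) y =
   'D_v a y *: V y + a y *: 'D_v Vc y + 'D_v Wc y.
  by apply: etrans (esym (near_eq_derive v E1)) _; apply/rowP => i; exact: dE.
have E2 := covd_val (r := u y) (erefl _) HX (erefl _) (erefl (a y *: V y + W y)).
have E3 := covd_val (r := u y) (erefl _) (erefl ('D_v Vc y)) (erefl _) (erefl (V y)).
have E4 := covd_val (r := u y) (erefl _) (erefl ('D_v Wc y)) (erefl _) (erefl (W y)).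
apply: etrans E2 _; rewrite [covd u V y v]E3 [covd u W y v]E4.
rewrite (chr_linr _ _ _ _ chrP).
move: ('D_v a y) ('D_v Vc y) ('D_v Wc y) (chr _ _ _ _) (chr _ _ _ _) => *.
by apply/rowP => i; rewrite !mxE; ring.
Unshelve. all: by end_near. Qed.

(** [chr_metric] splits the derivative of the Gram matrix along u into the two Christoffel terms
    that turn the derivatives of V and W into covariant ones. *)
Lemma derive_inner V W : smc u y -> smf u V y -> smf u W y ->
  smooth_at (fun z => inner (u z) (V z) (W z)) y /\
  'D_v (fun z => inner (u z) (V z) (W z)) y =
  inner (u y) (covd u V y v) (W y) + inner (u y) (V y) (covd u W y v).
Proof.
move=> su sV sW; have pp := cdom_center (u y); have [cu suy] := su.
set p := u y in pp suy *.
pose Vc z := tchart p (u z) (V z); pose Wc z := tchart p (u z) (W z).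
pose c := chart p \o u; pose G := cgram p.
have mG : metric_at G (c y) by exact: metric_at_gram.
have [sG nG _] := mG.
have E1 : \forall z \near y, bilin ((G \o c) z) (Vc z) (Wc z) = inner (u z) (V z) (W z).
  by apply: filterS (near_along su pp) => z pz; rewrite (inner_gram _ _ pz).
have sGc : smooth_at (G \o c) y by exact: (@smooth_at_comp _ _ _ _ _ G c y suy).
have sB : smooth_at (fun z => bilin ((G \o c) z) (Vc z) (Wc z)) y.
  exact: smooth_at_bilin.
split; first exact: smooth_at_ext E1 sB.
apply: etrans (esym (near_eq_derive v E1)) _.
have dV : differentiable Vc y by exact: smooth_at_diff.
have dW : differentiable Wc y by exact: smooth_at_diff.
have Vy : Vc y = V y by exact: tchart_self.
have Wy : Wc y = W y by exact: tchart_self.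
have [_] := derive_bilin v (smooth_at_diff sGc) dV dW.
rewrite Vy Wy => D1; apply: etrans D1 _.
have dG := derive_comp v (smooth_at_diff suy) (smooth_at_diff sG).
have DG : bilin ('D_v (G \o c) y) (V y) (W y) =
   bilin (G (c y)) (chr G (c y) ('D_v c y) (V y)) (W y) +
   bilin (G (c y)) (V y) (chr G (c y) ('D_v c y) (W y)).
  by apply: etrans (congr1 (fun X => bilin X _ _) dG) _; exact: chr_metric.
apply: etrans (congr1 (fun X => X + _ + _) DG) _.
have I1 a b : inner (u y) a b = bilin (G (c y)) a b.
  rewrite (inner_gram _ _ pp).
  by congr (bilin _ _ _); exact: tchart_self.
have E3 := covd_val (u := u) (r := p) (erefl _) (erefl ('D_v Vc y)) (erefl ('D_v c y)) (erefl (V y)).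
have E4 := covd_val (u := u) (r := p) (erefl _) (erefl ('D_v Wc y)) (erefl ('D_v c y)) (erefl (W y)).
apply/esym; rewrite !I1.
apply: etrans (congr2 (fun a b => bilin (G (c y)) a _ + bilin (G (c y)) _ b) E3 E4) _.
rewrite bilinDl bilinDr -[(G \o c) y]/(G (c y)).
move: (bilin _ _ _) (bilin _ _ _) (bilin _ _ _) (bilin _ _ _) => x1 x2 x3 x4.
ring.
Qed.

End CovdRules.
End Along.

Local Opaque chr hess.

(** * Parallel vector fields *)

Section Covd2.
Context {R : realType} {n : nat} {N : riemannian R n}.

Lemma covd_ext_map (E : normedModType R) (u u' : E -> N) (W W' : E -> 'rV[R]_n) y v :
  (\forall z \near y, u z = u' z /\ W z = W' z) -> covd u W y v = covd u' W' y v.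
Proof.
move=> H; have [uy Wy] := nbhs_singleton H.
have E1 : \forall z \near y,
    tchart (u' y) (u z) (W z) = tchart (u' y) (u' z) (W' z).
  by apply: filterS H => z [-> ->].
have E2 : \forall z \near y, (chart (u' y) \o u) z = (chart (u' y) \o u') z.
  by apply: filterS H => z [/= -> _].
exact: (covd_val uy (near_eq_derive v E1) (near_eq_derive v E2) Wy).
Qed.

Lemma covd_comp (E F : normedModType R) (k : E -> F) (U : F -> N)
    (W : F -> 'rV[R]_n) y v : differentiable k y -> smc U (k y) -> smf U W (k y) ->
  covd (U \o k) (W \o k) y v = covd U W (k y) ('D_v k y).
Proof.
move=> dk [_ sU] sW.
have D1 := derive_comp v dk (smooth_at_diff sW).
have D2 := derive_comp v dk (smooth_at_diff sU).
have dW := deriveE ('D_v k y) (smooth_at_diff sW).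
have dU := deriveE ('D_v k y) (smooth_at_diff sU).
exact: (covd_val (erefl _) (etrans D1 (esym dW)) (etrans D2 (esym dU)) (erefl _)).
Qed.

Section Rules.
Context {E : normedModType R}.
Variables (u : E -> N) (y v : E).
Implicit Types (V W : E -> 'rV[R]_n).

Lemma covd0 : covd u (fun=> 0) y v = 0.
Proof.
have s0 : smf u (fun=> 0) y.
  apply: smooth_at_ext (smooth_at_cst (0 : 'rV[R]_n) y).
  by near=> z; rewrite tchart0.
have E0 : covd u (fun=> 0) y v = covd u (fun z => cst (-1 : R) z *: 0 + 0) y v.
  by apply: covd_ext; near=> z; rewrite scaler0 addr0.
rewrite E0; apply: etrans (covdZD v (smooth_at_cst (-1 : R) y) s0 s0) _.
by rewrite derive_cst scale0r add0r scaleN1r addNr.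
Unshelve. all: by end_near. Qed.

Lemma smf0 : smf u (fun=> 0) y.
Proof.
apply: smooth_at_ext (smooth_at_cst (0 : 'rV[R]_n) y).
by near=> z; rewrite tchart0.
Unshelve. all: by end_near. Qed.

Lemma covdB V W : smf u V y -> smf u W y ->
  covd u (fun z => V z - W z) y v = covd u V y v - covd u W y v.
Proof.
move=> sV sW.
have -> : covd u (fun z => V z - W z) y v =
    covd u (fun z => cst (-1 : R) z *: W z + V z) y v.
  by apply: covd_ext; near=> z; rewrite scaleN1r addrC.
apply: etrans (covdZD v (smooth_at_cst (-1 : R) y) sW sV) _.
by rewrite derive_cst scale0r add0r scaleN1r addrC.
Unshelve. all: by end_near. Qed.

Lemma covd_sum (I : Type) (l : seq I) (a : I -> E -> R) (W : I -> E -> 'rV[R]_n) :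
  (forall i, smooth_at (a i) y) -> (forall i, smf u (W i) y) ->
  covd u (fun z => \sum_(i <- l) a i z *: W i z) y v =
  \sum_(i <- l) ('D_v (a i) y *: W i y + a i y *: covd u (W i) y v).
Proof.
move=> sa sW; elim: l => [|i l IH].
  rewrite big_nil -[RHS]covd0; apply: covd_ext.
  by near=> z; rewrite big_nil.
rewrite big_cons -IH.
have sl : smf u (fun z => \sum_(i <- l) a i z *: W i z) y.
  by apply: smf_sum => j _; exact: smfZ.
rewrite -(covdZD v (sa i) (sW i) sl).
by apply: covd_ext; near=> z; rewrite big_cons.
Unshelve. all: by end_near. Qed.

End Rules.
End Covd2.

Section ParallelFields.
Context {R : realType} {n : nat} {N : riemannian R n}.
Variable c : R -> N.
Hypothesis sc : forall t, smc c t.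

(** A condition at each single time, the form required of the predicate [sol] when local solutions
    are glued. *)
Definition parallel_at (V : R -> 'rV[R]_n) (t : R) :=
  smf c V t /\ covd_curve c V t = 0.

Lemma parallel_alongP V : parallel_along c V <-> forall t, parallel_at V t.
Proof.
split=> [[sV pV] t|pV].
  by split; [exact: (smooth_along_curveP _ sc).1|exact: pV].
by split; [apply/smooth_along_curveP => // t|move=> t]; have [] := pV t.
Qed.

(** By metric compatibility the difference of two parallel fields has constant length, and it
    vanishes at s. *)
Lemma parallel_unique (a b s : R) V W : (forall t, a < t < b -> parallel_at V t) ->
  (forall t, a < t < b -> parallel_at W t) -> a < s < b -> V s = W s ->
  forall t, a < t < b -> V t = W t.
Proof.
move=> pV pW sab VW t tab.
pose D u := V u - W u.
have df u : a < u < b -> is_derive u 1 (fun u => inner (c u) (D u) (D u)) 0.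
  move=> uab; have [sV V0] := pV u uab; have [sW W0] := pW u uab.
  have sD := smfB sV sW.
  have [sI DI] := derive_inner (1 : R) (sc u) sD sD.
  apply: DeriveDef; first exact/diff_derivable/smooth_at_diff.
  rewrite DI (covdB _ sV sW) -/(covd_curve c V u) V0 -/(covd_curve c W u) W0 subrr.
  by rewrite /inner bilin0l bilin0r addr0.
have := derive0_const_itv df sab tab.
rewrite {1 2}/D VW subrr /inner bilin0l => /esym D0.
by apply/eqP; rewrite -subr_eq0; apply/eqP; exact: (inner_eq0 D0).
Qed.

Lemma parallel_unique_all s V W : (forall t, parallel_at V t) ->
  (forall t, parallel_at W t) -> V s = W s -> forall t, V t = W t.
Proof.
move=> pV pW VW t; pose a := Num.min s t - 1; pose b := Num.max s t + 1.
have ab u : u = s \/ u = t -> a < u < b.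
  have h1 : Num.min s t <= s by rewrite ge_min lexx.
  have h2 : Num.min s t <= t by rewrite ge_min lexx orbT.
  have h3 : s <= Num.max s t by rewrite le_max lexx.
  have h4 : t <= Num.max s t by rewrite le_max lexx orbT.
  by clear VW; rewrite /a /b; case=> ->; lra.
have sab : a < s < b by apply: ab; left.
have tab : a < t < b by apply: ab; right.
exact: (parallel_unique (fun u _ => pV u) (fun u _ => pW u) sab VW tab).
Qed.

(** In the chart at [c t0] the equation reads w' = - Gamma(c', w), a linear system with matrix A.
    The bound e keeps the curve inside this chart and the time inside the range of the local
    solution. *)
Let parallel_local_existence (t0 : R) : exists2 e, 0 < e & forall s (x : 'rV[R]_n),
  t0 - e < s < t0 + e ->
  exists2 V, V s = x & forall t, t0 - e < t < t0 + e -> parallel_at V t.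
Proof.
pose r := c t0; pose G := cgram r; pose cr := chart r \o c.
pose A t : 'M[R]_n := \matrix_(i, j) (- chr G (cr t) ('D_1 cr t) (delta_mx 0 i) 0 j).
have rr : cdom r (c t0) := cdom_center r.
have scr : smooth_at cr t0 by have [] := sc t0.
have nr := near_along (sc t0) rr.
have sA t : cdom r (c t) -> smooth_at A t.
  move=> rt; have scrt : smooth_at cr t := smc_chart (sc t) rt.
  have [sG _ uG] : metric_at G (cr t) by exact: metric_at_gram.
  have schr i : smooth_at (fun t => chr G (cr t) ('D_1 cr t) (delta_mx 0 i)) t.
    apply: (smooth_at_chr sG uG scrt); first exact: smooth_at_derive.
    exact: smooth_at_cst.
  apply/smooth_at_mxP => i j.
  have := smooth_atN ((smooth_at_mxP _ _).1 (schr i) 0 j); apply: smooth_at_ext.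
  by near=> z; rewrite [RHS]mxE.
have AE t w : cdom r (c t) -> w *m A t = - chr G (cr t) ('D_1 cr t) w.
  move=> rt; have dG : differentiable G (cr t).
    by apply: metric_at_diff; exact: metric_at_gram.
  have lr a w1 w2 := chr_linr a ('D_1 cr t) w1 w2 dG.
  have l0 : chr G (cr t) ('D_1 cr t) 0 = 0.
    by have := lr (-1) 0 0; rewrite scaler0 addr0 scaleN1r addNr.
  have wE : chr G (cr t) ('D_1 cr t) w =
      \sum_i w 0 i *: chr G (cr t) ('D_1 cr t) (delta_mx 0 i).
    rewrite [in LHS](row_sum_delta w).
    elim/big_rec2 : _ => [|j s1 s2 _ <-]; first exact: l0.
    exact: lr.
  apply/rowP => j; rewrite mxE [RHS]mxE wE summxE -sumrN.
  by apply: eq_bigr => i _; rewrite !mxE mulrN.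
have [e1 e10 e1P] := lin_ode_local (sA t0 rr).
move/nbhs_ballP : nr => -[e2 /= e20 e2P].
pose e := Num.min e1 e2.
have e0 : 0 < e by rewrite lt_min e10 e20.
have ee1 : e <= e1 by rewrite ge_min lexx.
have ee2 : e <= e2 by rewrite ge_min lexx orbT.
exists e => // s x se.
have rs t : t0 - e < t < t0 + e -> cdom r (c t).
  move=> te; apply: e2P; rewrite -ball_normE/= ltr_distlC.
  by lra.
have [|w ws dw] := e1P s (tchart r (c s) x); first by lra.
have {}dw (t : R) : t0 - e < t < t0 + e -> is_derive t 1 w (w t *m A t).
  by move=> te; apply: dw; clear ws; lra.
exists (fun t => tchartI r (chart r (c t)) (w t)) => [|t te].
  by rewrite ws tchartK//; exact: rs.
have rt := rs t te; have sct := sc t.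
pose I : set R := [set u | t0 - e < u < t0 + e].
have oI : open I.
  have -> : I = [set` `]t0 - e, t0 + e[] by apply/seteqP; split => z; rewrite /I/= in_itv.
  exact: interval_open.
have sw : smooth_at w t.
  apply: (lin_ode_smooth oI _ dw te) => z ze; exact/sA/rs.
have E1 : \forall z \near t,
    w z = tchart r (c z) (tchartI r (chart r (c z)) (w z)).
  by apply: filterS (near_along sct rt) => z rz; rewrite tchartIK.
have sWr := smooth_at_ext E1 sw.
split; first exact: chart_smf sct rt sWr.
apply: (tchart_inj rt); rewrite tchart0.
have [cc _] := sct.
have scrt := smc_chart sct rt.
apply: etrans (covd_chart (1 : R) cc rt (smooth_at_diff scrt) (smooth_at_diff sWr)) _.
have [_ Dw] := dw t te.
have D1 := etrans (esym (near_eq_derive (1 : R) E1)) Dw.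
apply: etrans (congr2 (fun a b => a + chr G (cr t) ('D_1 cr t) b) D1 (esym (nbhs_singleton E1))) _.
by rewrite (AE _ _ rt) addNr.
Unshelve. all: by end_near. Qed.

Lemma parallel_exists s (x : 'rV[R]_n) :
  exists2 V, V s = x & forall t, parallel_at V t.
Proof.
apply: (solution_glue (sol := parallel_at)).
- move=> V W t VW [sV pV]; split; first exact: smf_ext VW sV.
  by rewrite -pV; apply: esym; exact: covd_ext.
- exact: parallel_local_existence.
- by move=> a b s' V W; exact: parallel_unique.
Qed.

End ParallelFields.

(** * Parallel immersions *)

Section Projections.
Context {R : realType} {m n : nat} {M : riemannian R m} {N : riemannian R n}.
Variable f : M -> N.
Implicit Types (p : M) (x y : 'rV[R]_m) (v w : 'rV[R]_n).

Lemma inner_tangent_part p w x :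
  inner p (tangent_part f p w) x = inner (f p) w (tmap f p x).
Proof.
rewrite /inner /bilin /tangent_part mulmxKV ?metric_unit// tmap_mxE.
by rewrite trmx_mul mulmxA.
Qed.

Lemma tangent_part_uniq p w x :
  (forall y, inner p x y = inner (f p) w (tmap f p y)) -> tangent_part f p w = x.
Proof.
move=> H; apply/eqP; rewrite -subr_eq0; apply/eqP.
apply: (bilin_nondeg (metric_unit p)) => y.
rewrite bilinBl -/(inner p _ y) inner_tangent_part -/(inner p x y) H.
exact: subrr.
Qed.

Lemma tangent_partD p v w :
  tangent_part f p (v + w) = tangent_part f p v + tangent_part f p w.
Proof. by rewrite /tangent_part !mulmxDl. Qed.

Lemma tangent_partZ p a w : tangent_part f p (a *: w) = a *: tangent_part f p w.
Proof. by rewrite /tangent_part -!scalemxAl. Qed.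

Lemma normal_partD p v w :
  normal_part f p (v + w) = normal_part f p v + normal_part f p w.
Proof. by rewrite /normal_part tangent_partD tmapD opprD addrACA. Qed.

Lemma normal_partZ p a w : normal_part f p (a *: w) = a *: normal_part f p w.
Proof. by rewrite /normal_part tangent_partZ tmapZ scalerBr. Qed.

Lemma normal_part0 p : normal_part f p 0 = 0.
Proof. by have := normal_partZ p 0 0; rewrite !scale0r. Qed.

Lemma normal_part_sum p (I : Type) (l : seq I) (F : I -> 'rV[R]_n) :
  normal_part f p (\sum_(i <- l) F i) = \sum_(i <- l) normal_part f p (F i).
Proof.
by apply: (big_morph _ (fun v w => normal_partD p v w)); exact: normal_part0.
Qed.

Lemma tangent_part_normal p w : normal_space f p w -> tangent_part f p w = 0.
Proof.
move=> nw; apply: tangent_part_uniq => y.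
by rewrite [RHS]innerC nw /inner bilin0l.
Qed.

Lemma normal_part_id p w : normal_space f p w -> normal_part f p w = w.
Proof. by move=> nw; rewrite /normal_part tangent_part_normal// tmap0 subr0. Qed.

Lemma normal_spaceZD p a v w : normal_space f p v -> normal_space f p w ->
  normal_space f p (a *: v + w).
Proof.
move=> nv nw x; rewrite /inner bilin_linr -/(inner _ _ v) -/(inner _ _ w).
by rewrite (nv x) (nw x) mulr0 addr0.
Qed.

Lemma normal_space0 p : normal_space f p 0.
Proof. by move=> x; rewrite /inner bilin0r. Qed.

Lemma normal_space_sum p (I : Type) (l : seq I) (a : I -> R) (F : I -> 'rV[R]_n) :
  (forall i, normal_space f p (F i)) ->
  normal_space f p (\sum_(i <- l) a i *: F i).
Proof.
move=> nF; elim/big_ind : _ => [|v w nv nw|i _].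
- exact: normal_space0.
- by have := normal_spaceZD 1 nv nw; rewrite scale1r.
- by have := normal_spaceZD (a i) (nF i) (normal_space0 p); rewrite addr0.
Qed.

Lemma decomp p w : w = tmap f p (tangent_part f p w) + normal_part f p w.
Proof. by rewrite /normal_part addrC subrK. Qed.

Lemma inner_normal_part p v w : normal_space f p v ->
  inner (f p) w v = inner (f p) (normal_part f p w) v.
Proof.
move=> nv; rewrite [in LHS](decomp p w) /inner bilinDl.
by rewrite -/(inner (f p) (tmap f p _) v) (nv _) add0r.
Qed.

Hypothesis isof : forall p x y, inner (f p) (tmap f p x) (tmap f p y) = inner p x y.

Lemma tangent_part_tmap p x : tangent_part f p (tmap f p x) = x.
Proof. by apply: tangent_part_uniq => y; rewrite isof. Qed.

Lemma tmap_inj p x y : tmap f p x = tmap f p y -> x = y.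
Proof. by move=> H; rewrite -(tangent_part_tmap p x) H tangent_part_tmap. Qed.

End Projections.

Section ParallelImmersion.
Context {R : realType} {m n : nat} {M : riemannian R m} {N : riemannian R n}.
Variable f : M -> N.
Hypothesis hf : isometric_immersion f.
Hypothesis hpar : parallel_immersion f.

Let sf : smooth_map f. Proof. by have [] := hf. Qed.
Let isof : forall p x y, inner (f p) (tmap f p x) (tmap f p y) = inner p x y.
Proof. by have [] := hf. Qed.

Lemma smf_const_field (p q : M) (y : 'rV[R]_m) : cdom p q ->
  smf (chartI q) (const_field p y \o chartI q) (chart q q).
Proof.
move=> pq; have qq := cdom_center q.
have su : smc (chartI q) (chart q q) := smc_lexpr (smooth_map_id M) qq.
have rq : cdom p (chartI q (chart q q)) by rewrite chartK.
apply: (chart_smf su rq); apply: smooth_at_ext (smooth_at_cst y (chart q q)).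
apply: filterS (near_along su rq) => z pz.
by rewrite /= /const_field tchartIK.
Qed.

Lemma smooth_const_field (p : M) (y : 'rV[R]_m) : smooth_field (cdom p) (const_field p y).
Proof.
apply/smooth_alongP; [exact: smooth_map_id|exact: cdom_open|].
by move=> q pq; exact: smf_const_field.
Qed.

Lemma nabla_perp_const (p : M) (x y z : 'rV[R]_m) :
  nabla_perp f (fun q => sff f q (const_field p y q) (const_field p z q)) p x =
  sff f p (nabla (const_field p y) p x) z + sff f p y (nabla (const_field p z) p x).
Proof.
have := hpar (cdom_open p) (smooth_const_field p x) (smooth_const_field p y)
  (smooth_const_field p z) (cdom_center p).
by rewrite !const_field_center.
Qed.

Lemma sff_sumr p x (I : Type) (l : seq I) (a : I -> R) (F : I -> 'rV[R]_m) :
  sff f p x (\sum_(i <- l) a i *: F i) = \sum_(i <- l) a i *: sff f p x (F i).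
Proof.
elim: l => [|i l IH]; last by rewrite !big_cons sff_linr// IH.
rewrite !big_nil; have := sff_linr sf p (-1) x 0 0.
by rewrite scaler0 addr0 scaleN1r addNr.
Qed.

Lemma sff_suml p x (I : Type) (l : seq I) (a : I -> R) (F : I -> 'rV[R]_m) :
  sff f p (\sum_(i <- l) a i *: F i) x = \sum_(i <- l) a i *: sff f p (F i) x.
Proof. by rewrite sffC// sff_sumr; apply: eq_bigr => i _; rewrite sffC. Qed.

Lemma sffDl p x x' y : sff f p (x + x') y = sff f p x y + sff f p x' y.
Proof. by have := sff_linl sf p 1 x x' y; rewrite !scale1r. Qed.

Lemma sffDr p x y y' : sff f p x (y + y') = sff f p x y + sff f p x y'.
Proof. by have := sff_linr sf p 1 x y y'; rewrite !scale1r. Qed.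

Lemma sff_sum2 p (a b : 'I_m -> R) (F G : 'I_m -> 'rV[R]_m) :
  sff f p (\sum_i a i *: F i) (\sum_j b j *: G j) =
  \sum_ij (a ij.1 * b ij.2) *: sff f p (F ij.1) (G ij.2).
Proof.
rewrite (sff_suml p _ _ a F).
transitivity (\sum_i \sum_j (a i * b j) *: sff f p (F i) (G j)).
  apply: eq_bigr => i _; rewrite (sff_sumr p _ _ b G) scaler_sumr.
  by apply: eq_bigr => j _; rewrite scalerA.
exact: (pair_bigA _ (fun i j => (a i * b j) *: sff f p (F i) (G j))).
Qed.

(** The algebra of the Leibniz rule: a' and b' stand for the derivatives of the coefficients a and
    b, and K for the covariant derivatives of the fields D. *)
Lemma sff_product_rule p (a a' b b' : 'I_m -> R) (D K : 'I_m -> 'rV[R]_m) :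
  \sum_ij ((a' ij.1 * b ij.2 + a ij.1 * b' ij.2) *: sff f p (D ij.1) (D ij.2) +
    (a ij.1 * b ij.2) *: (sff f p (K ij.1) (D ij.2) + sff f p (D ij.1) (K ij.2))) =
  sff f p (\sum_i (a' i *: D i + a i *: K i)) (\sum_j b j *: D j) +
  sff f p (\sum_i a i *: D i) (\sum_j (b' j *: D j + b j *: K j)).
Proof.
have E (u v : 'I_m -> R) : \sum_i (u i *: D i + v i *: K i) =
    \sum_i u i *: D i + \sum_i v i *: K i by exact: big_split.
rewrite (E a' a) (E b' b) sffDl sffDr.
rewrite (sff_sum2 p a' b D D) (sff_sum2 p a b K D) (sff_sum2 p a b' D D).
rewrite (sff_sum2 p a b D K) -!big_split/=; apply: eq_bigr => ij _.
move: (sff f p (D _) (D _)) (sff f p (K _) _) (sff f p _ (K _)) => *.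
by apply/rowP => k; rewrite !mxE; ring.
Qed.

Section Curve.
Variables (c : R -> M) (t : R).
Hypothesis sc : smc c t.

Let p := c t.
Let pp : cdom p p := cdom_center p.
Let cp := chart p \o c.
Let np := near_along sc pp.
Let scp : smooth_at cp t. Proof. by have [] := sc. Qed.

(** Near t the curve is [chartI p] after its coordinate curve, so the chain rule turns a covariant
    derivative along c into one on a chart domain of M in the direction of the velocity. *)
Let along_chart k (N' : riemannian R k) (U : 'rV[R]_m -> N') (W : 'rV[R]_m -> 'rV[R]_k)
    (u : R -> N') (V : R -> 'rV[R]_k) :
  smc U (chart p p) -> smf U W (chart p p) ->
  (forall s, cdom p (c s) -> U (cp s) = u s /\ W (cp s) = V s) ->
  covd u V t 1 = covd U W (chart p p) (velocity c t).
Proof.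
move=> sU sW UW; apply: etrans (covd_comp (1 : R) (smooth_at_diff scp) sU sW).
apply: covd_ext_map; apply: filterS np => s ps.
by have [<- <-] := UW s ps.
Qed.

Let covd_const_field y :
  covd c (fun s => const_field p y (c s)) t 1 = nabla (const_field p y) p (velocity c t).
Proof.
have s1 : smc (id \o chartI p) (chart p p) := smc_lexpr (smooth_map_id M) pp.
have s2 : smf (id \o chartI p) (const_field p y \o chartI p) (chart p p).
  exact: smf_const_field.
have s3 s : cdom p (c s) -> (id \o chartI p) (cp s) = c s /\
    (const_field p y \o chartI p) (cp s) = const_field p y (c s).
  by move=> ps; rewrite /cp /= chartK.
exact: (along_chart s1 s2 s3).
Qed.

Let smf_const_field_curve y : smf c (fun s => const_field p y (c s)) t.
Proof.
apply: (chart_smf sc pp); apply: smooth_at_ext (smooth_at_cst y t).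
by apply: filterS np => s ps; rewrite /= /const_field tchartIK.
Qed.

Let covd_sff_const y z :
  normal_part f p (covd (f \o c)
    (fun s => sff f (c s) (const_field p y (c s)) (const_field p z (c s))) t 1) =
  sff f p (nabla (const_field p y) p (velocity c t)) z +
  sff f p y (nabla (const_field p z) p (velocity c t)).
Proof.
apply: etrans _ (nabla_perp_const p (velocity c t) y z).
apply: (congr1 (normal_part f p)).
pose S q := sff f q (const_field p y q) (const_field p z q).
have s1 : smc (f \o chartI p) (chart p p) := smc_lexpr sf pp.
have sI : smc (chartI p) (chart p p) := smc_lexpr (smooth_map_id M) pp.
have s2 : smf (f \o chartI p) (S \o chartI p) (chart p p).
  exact: (smf_sff sf sI (smf_const_field y pp) (smf_const_field z pp)).
have s3 s : cdom p (c s) -> (f \o chartI p) (cp s) = f (c s) /\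
    (S \o chartI p) (cp s) = S (c s).
  by move=> ps; rewrite /cp /= chartK.
exact: (along_chart s1 s2 s3).
Qed.

(** Parallelism of f speaks of fields on open sets, whereas X and Y live on c only. Both are
    expanded in constant coordinate fields restricted to c, for which the hypothesis is available,
    and the Leibniz rule does the rest. *)
Lemma covd_perp_sff X Y : smf c X t -> smf c Y t ->
  covd_perp_curve f c (fun s => sff f (c s) (X s) (Y s)) t =
  sff f p (covd c X t 1) (Y t) + sff f p (X t) (covd c Y t 1).
Proof.
move=> sX sY.
pose D (i : 'I_m) (s : R) : 'rV[R]_m := const_field p (delta_mx 0 i) (c s).
pose a i s := tchart p (c s) (X s) 0 i; pose b i s := tchart p (c s) (Y s) 0 i.
have sa i : smooth_at (a i) t by exact: (smooth_at_mxP _ _).1 sX 0 i.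
have sb i : smooth_at (b i) t by exact: (smooth_at_mxP _ _).1 sY 0 i.
have sD i : smf c (D i) t by exact: smf_const_field_curve.
have expand Z s : cdom p (c s) ->
    Z = \sum_i tchart p (c s) Z 0 i *: D i s.
  move=> ps; rewrite -{1}(tchartK Z ps) {1}(row_sum_delta (tchart p (c s) Z)).
  elim/big_rec2 : _ => [|i x1 x2 _ <-].
    by apply: etrans _ (tchartK 0 ps); rewrite tchart0.
  by rewrite tchartI_lin.
have XE : \forall s \near t, X s = \sum_i a i s *: D i s.
  by apply: filterS np => s ps; exact: expand.
have YE : \forall s \near t, Y s = \sum_i b i s *: D i s.
  by apply: filterS np => s ps; exact: expand.
pose S ij s := sff f (c s) (D ij.1 s) (D ij.2 s).
have sS ij : smf (f \o c) (S ij) t by exact: smf_sff.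
have SE : \forall s \near t, sff f (c s) (X s) (Y s) =
    \sum_ij (a ij.1 s * b ij.2 s) *: S ij s.
  apply: filterS2 XE YE => s -> ->.
  exact: (sff_sum2 _ (fun i => a i s) (fun i => b i s) (fun i => D i s) (fun i => D i s)).
rewrite /covd_perp_curve /covd_curve (covd_ext _ (1 : R) SE).
rewrite (covd_sum (1 : R) (index_enum _) (a := fun ij s => a ij.1 s * b ij.2 s) _ sS); last first.
  by move=> ij; exact: smooth_atM.
rewrite normal_part_sum.
have DE i : D i t = delta_mx 0 i by exact: const_field_center.
have normS ij : normal_space f p (S ij t) by exact: sff_normal.
pose K i := covd c (D i) t 1.
have covS ij : normal_part f p (covd (f \o c) (S ij) t 1) =
    sff f p (K ij.1) (D ij.2 t) + sff f p (D ij.1 t) (K ij.2).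
  apply: etrans (covd_sff_const _ _) _.
  exact: (congr2 +%R
    (congr2 (sff f p) (esym (covd_const_field _)) (esym (DE _)))
    (congr2 (sff f p) (esym (DE _)) (esym (covd_const_field _)))).
have prodE i j : 'D_1 (fun s => a i s * b j s) t =
    'D_1 (a i) t * b j t + a i t * 'D_1 (b j) t.
  have da : derivable (a i) t 1 by apply: diff_derivable; exact: smooth_at_diff.
  have db : derivable (b j) t 1 by apply: diff_derivable; exact: smooth_at_diff.
  rewrite [LHS](deriveM da db) addrC; congr (_ + _); exact: mulrC.
have termE ij : normal_part f (c t) ('D_1 (fun s => a ij.1 s * b ij.2 s) t *: S ij t +
      a ij.1 t * b ij.2 t *: covd (f \o c) (S ij) t 1) =
    ('D_1 (a ij.1) t * b ij.2 t + a ij.1 t * 'D_1 (b ij.2) t) *: sff f p (D ij.1 t) (D ij.2 t) +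
    (a ij.1 t * b ij.2 t) *: (sff f p (K ij.1) (D ij.2 t) + sff f p (D ij.1 t) (K ij.2)).
  apply: etrans (normal_partD f p _ _) _; apply: congr2.
    apply: etrans (normal_partZ f p _ _) _.
    exact: (congr2 *:%R (prodE _ _) (normal_part_id (normS ij))).
  apply: etrans (normal_partZ f p _ _) _; exact: congr1 (covS ij).
apply: etrans (eq_bigr _ (fun ij _ => termE ij)) _.
apply: etrans (sff_product_rule p (fun i => a i t) (fun i => 'D_1 (a i) t)
  (fun i => b i t) (fun i => 'D_1 (b i) t) (fun i => D i t) K) _.
have covE (x : 'I_m -> R -> R) Z : (forall i, smooth_at (x i) t) ->
    (\forall s \near t, Z s = \sum_i x i s *: D i s) ->
    \sum_i ('D_1 (x i) t *: D i t + x i t *: K i) = covd c Z t 1.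
  move=> sx ZE; apply: esym; apply: etrans (covd_ext _ (1 : R) ZE) _.
  exact: (covd_sum (1 : R) (index_enum _) sx sD).
exact: (congr2 +%R
  (congr2 (sff f p) (covE a X sa XE) (esym (nbhs_singleton YE)))
  (congr2 (sff f p) (esym (nbhs_singleton XE)) (covE b Y sb YE))).
Qed.

(* Weingarten formula, obtained by differentiating <h(X,Y), Tf Z> = 0. *)
Lemma tangent_part_covd_sff X Y z : smf c X t -> smf c Y t ->
  inner p (tangent_part f p (covd_curve (f \o c) (fun s => sff f (c s) (X s) (Y s)) t)) z =
  - inner (f p) (sff f p (X t) (Y t)) (sff f p (velocity c t) z).
Proof.
move=> sX sY; pose Z s := const_field p z (c s).
have sZ : smf c Z t by exact: smf_const_field_curve.
have Zt : Z t = z by exact: const_field_center.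
have sTZ : smf (f \o c) (fun s => tmap f (c s) (Z s)) t by exact: smf_tmap.
have sS : smf (f \o c) (fun s => sff f (c s) (X s) (Y s)) t by exact: smf_sff.
have sfc : smc (f \o c) t by exact: smc_comp.
have [_ D1] := derive_inner (1 : R) sfc sS sTZ.
have E0 : \forall s \near t, 0 = inner ((f \o c) s) (sff f (c s) (X s) (Y s)) (tmap f (c s) (Z s)).
  by near=> s; rewrite innerC; apply/esym; exact: (sff_normal sf isof).
move: D1; rewrite -(near_eq_derive (1 : R) E0) derive_cst.
rewrite (covd_tmap sf sc (1 : R) sZ) -/(covd_curve (f \o c) _ t) /inner bilinDr.
rewrite -/(inner ((f \o c) t) _ (tmap f _ _)) -/(inner ((f \o c) t) _ (tmap f _ (covd _ _ _ _))).
rewrite [inner _ _ (tmap f _ (covd _ _ _ _))]innerC (sff_normal sf isof) add0r Zt.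
rewrite -/(velocity c t) -/p -[(f \o c) t]/(f p) -(inner_tangent_part f).
by move=> /eqP; rewrite eq_sym addr_eq0 => /eqP.
Unshelve. all: by end_near. Qed.

End Curve.
End ParallelImmersion.

Local Opaque covd sff tchart tmap.

(** * The osculating bundle *)

Section LocalCurves.
Context {R : realType} {m : nat} {M : smooth_manifold R m}.

Lemma smc_precomp (E F : normedModType R) (k : E -> F) (U : F -> M) y :
  smc U (k y) -> {for y, continuous k} ->
  smooth_at (chart (U (k y)) \o U \o k) y -> smc (U \o k) y.
Proof.
by move=> [cU _] ck sk; split => //; exact: (@continuous_comp _ _ _ k U y ck cU).
Qed.

(* [2t/(1+t^2)] maps the line onto [-1,1], with 0 and 1 fixed. *)
Lemma local_curves (q : M) : exists U, [/\ open U, U q &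
  forall y z, U y -> U z -> exists c : R -> M,
    [/\ forall t, smc c t, c 0 = y & c 1 = z]].
Proof.
pose phi (t : R) : R := (2 * t) * (1 + t * t)^-1.
have den t : 0 < 1 + t * t :> R by rewrite ltr_pwDl// -expr2 sqr_ge0.
have phi_le t : `|phi t| <= 1.
  rewrite /phi normrM normfV [X in _ / X]gtr0_norm// ler_pdivrMr// mul1r.
  rewrite normrM ger0_norm//.
  have : `|t| * `|t| = t * t by rewrite -normrM ger0_norm// -expr2 sqr_ge0.
  have := sqr_ge0 (`|t| - 1); rewrite expr2.
  have -> : (`|t| - 1) * (`|t| - 1) = `|t| * `|t| - 2 * `|t| + 1 by ring.
  by lra.
have sphi t : smooth_at phi t.
  apply: smooth_atM.
    by apply: smooth_atM; [exact: smooth_at_cst|exact: smooth_at_id].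
  apply: smooth_atV; last by rewrite gt_eqF.
  apply: smooth_atD; first exact: smooth_at_cst.
  by apply: smooth_atM; exact: smooth_at_id.
have qq := cdom_center q; pose x0 := chart q q.
have /nbhs_ballP[r /= r0 rP] := near_chartI qq (cdom_open q) qq.
(* Since phi may be negative, k leaves the segment; the estimate below bounds its distance to x0 by
   2 |x0 - y| + |x0 - z| in coordinates, whence r / 3. *)
pose B y := cdom q y /\ ball x0 (r / 3) (chart q y).
have : \forall y \near q, B y.
  apply: filterI; first exact: near_cdom.
  apply: (chart_continuous qq); apply: nbhsx_ballx.
  by rewrite divr_gt0.
rewrite /prop_near1 nbhsE => -[U [oU Uq] UB].
exists U; split => // y z /UB[qy by_] /UB[qz bz].
pose k t := chart q y + phi t *: (chart q z - chart q y).
have kB t : ball x0 r (k t).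
  move: by_ bz; rewrite -!ball_normE /ball_/= => by_ bz.
  have -> : x0 - k t = (x0 - chart q y) -
      phi t *: ((x0 - chart q y) - (x0 - chart q z)).
    by apply/rowP => i; rewrite !mxE; ring.
  apply: le_lt_trans (ler_normB _ _) _; rewrite normrZ.
  apply: (@le_lt_trans _ _ (`|x0 - chart q y| +
      1 * `|(x0 - chart q y) - (x0 - chart q z)|)).
    by rewrite lerD2l ler_wpM2r.
  rewrite mul1r; apply: le_lt_trans (lerD (lexx _) (ler_normB _ _)) _.
  by move: by_ bz; move: `|x0 - chart q y| `|x0 - chart q z| => a b; lra.
have sk t : smooth_at k t.
  apply: smooth_at_mxD; first exact: smooth_at_cst.
  by apply: smooth_at_mxZ => //; exact: smooth_at_cst.
exists (chartI q \o k); split.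
- move=> t; have [qk _ kE] := rP _ (kB t).
  have sI := smc_lexpr (smooth_map_id M) qk.
  rewrite kE in sI; have [_ sIk] := sI.
  apply: (smc_precomp (U := chartI q) sI (smooth_at_cont (sk t))).
  exact: (@smooth_at_comp _ _ _ _ _ (chart (chartI q (k t)) \o chartI q) k t (sk t) sIk).
- by rewrite /= /k /phi mulr0 mul0r scale0r addr0 chartK.
- have p1 : phi 1 = 1 by rewrite /phi !mulr1 divff// pnatr_eq0.
  by rewrite /= /k p1 scale1r addrC subrK chartK.
Qed.

(** Distant points need not be joined by one smooth curve: [local_curves] makes P locally constant,
    and connectedness of M finishes. *)
Lemma curve_const (P : M -> Prop) : connected [set: M] ->
  (forall c : R -> M, (forall t, smc c t) -> P (c 0) -> P (c 1)) ->
  forall x y, P x -> P y.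
Proof.
move=> cM HP x y; apply: (connected_const cM) => // q _.
have [U [oU Uq Uc]] := local_curves q.
exists U; split => // a b _ _ /Uc H /H[c [sc <- <-]]; exact: HP.
Qed.

End LocalCurves.

Section Glue.
Context {k k' : nat}.

Definition glue (T : Type) (g : 'I_k -> T) (g' : 'I_k' -> T) (i : 'I_(k + k')) : T :=
  match fintype.split i with inl j => g j | inr j => g' j end.

Lemma sum_glue (R : nzRingType) (V : lmodType R) (T : Type) (a : 'I_k -> R)
    (a' : 'I_k' -> R) (x : 'I_k -> T) (x' : 'I_k' -> T) (h : T -> V) :
  \sum_i glue a a' i *: h (glue x x' i) =
  \sum_i a i *: h (x i) + \sum_i a' i *: h (x' i).
Proof.
rewrite big_split_ord/=; congr (_ + _); apply: eq_bigr => i _.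
  by rewrite /glue (unsplitK (inl i)).
by rewrite /glue (unsplitK (inr i)).
Qed.

End Glue.

Section Generators.
Context {R : realType} {m n : nat} {M : riemannian R m} {N : riemannian R n}.
Variable f : M -> N.
Hypothesis hf : isometric_immersion f.
Hypothesis hpar : parallel_immersion f.

Let sf : smooth_map f. Proof. by have [] := hf. Qed.
Let isof : forall p x y, inner (f p) (tmap f p x) (tmap f p y) = inner p x y.
Proof. by have [] := hf. Qed.

(* The osculating space at [q] is spanned by the vectors Tf x and h(x, y). *)
Definition generator := ('rV[R]_m + 'rV[R]_m * 'rV[R]_m)%type.

Definition gen (q : M) (g : generator) : 'rV[R]_n :=
  match g with inl x => tmap f q x | inr (x, y) => sff f q x y end.

Definition push (T : 'rV[R]_m -> 'rV[R]_m) (g : generator) : generator :=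
  match g with inl x => inl (T x) | inr (x, y) => inr (T x, T y) end.

(** No independence is asked of the generators: one vector has many presentations, over different
    index types. *)
Definition gensum (A : finType) q (y : A -> R) (g : A -> generator) : 'rV[R]_n :=
  \sum_a y a *: gen q (g a).

Lemma first_normal_sff q x y : first_normal_space f q (sff f q x y).
Proof.
exists 1%N, (fun=> 1), (fun=> x), (fun=> y).
by rewrite big_ord1 scale1r.
Qed.

Lemma first_normal0 q : first_normal_space f q 0.
Proof.
by exists 0%N, (fun=> 1), (fun=> 0), (fun=> 0); rewrite big_ord0.
Qed.

Lemma first_normalZD q a v w : first_normal_space f q v ->
  first_normal_space f q w -> first_normal_space f q (a *: v + w).
Proof.
move=> [k [b [x [y ->]]]] [k' [b' [x' [y' ->]]]].
pose xy i := (x i, y i); pose xy' i := (x' i, y' i).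
exists (k + k')%N, (glue (fun i => a * b i) b'),
  (fun i => (glue xy xy' i).1), (fun i => (glue xy xy' i).2).
rewrite scaler_sumr; apply: etrans _ (esym (sum_glue _ _ _ _ (fun z => sff f q z.1 z.2))).
apply: (congr1 (+%R^~ _)); apply: eq_bigr => i _; exact: scalerA.
Qed.

Lemma osc_space_gen q g : osc_space f q (gen q g).
Proof.
case: g => [x|[x y]].
  by exists x, 0; split; [exact: first_normal0|rewrite addr0].
by exists 0, (sff f q x y); split; [exact: first_normal_sff|rewrite tmap0 add0r].
Qed.

Lemma osc_space0 q : osc_space f q 0.
Proof. by have := osc_space_gen q (inl 0); rewrite /gen tmap0. Qed.

Lemma osc_spaceZD q a v w : osc_space f q v -> osc_space f q w ->
  osc_space f q (a *: v + w).
Proof.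
move=> [x [xi [nxi ->]]] [x' [xi' [nxi' ->]]].
exists (a *: x + x'), (a *: xi + xi'); split; first exact: first_normalZD.
by rewrite tmap_lin scalerDr addrACA.
Qed.

Lemma osc_space_gensum (A : finType) q (y : A -> R) g : osc_space f q (gensum q y g).
Proof.
apply: big_ind => [|v w ov ow|a _]; first exact: osc_space0.
  by have := osc_spaceZD 1 ov ow; rewrite scale1r.
by have := osc_spaceZD (y a) (osc_space_gen q (g a)) (osc_space0 q); rewrite addr0.
Qed.

Lemma osc_gensum q v : osc_space f q v ->
  exists (A : finType) (y : A -> R) (g : A -> generator), v = gensum q y g.
Proof.
move=> [x [xi [[k [a [x1 [y1 ->]]]] ->]]].
exists (unit + 'I_k)%type, (fun i => match i with inl _ => 1 | inr j => a j end),
  (fun i => match i with inl _ => inl x | inr j => inr (x1 j, y1 j) end).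
rewrite /gensum big_sumType/=; congr (_ + _).
by rewrite (big_pred1 tt) ?scale1r// => -[].
Qed.

Lemma inner_gensum (A A' : finType) q (y : A -> R) g (y' : A' -> R) g' :
  inner (f q) (gensum q y g) (gensum q y' g') =
  \sum_a \sum_a' y a * y' a' * inner (f q) (gen q (g a)) (gen q (g' a')).
Proof.
rewrite /inner bilin_suml; apply: eq_bigr => a _.
rewrite bilin_sumr; apply: eq_bigr => a' _.
by rewrite bilinZl bilinZr mulrA.
Qed.

Definition sff4 q (x y z w : 'rV[R]_m) := inner (f q) (sff f q x y) (sff f q z w).

(** Each factor is normal, so only the normal part of the derivative of the other one enters; it
    vanishes because h and the four arguments are parallel. *)
Lemma sff4_parallel (c : R -> M) X Y Z W : (forall t, smc c t) ->
  (forall t, parallel_at c X t) -> (forall t, parallel_at c Y t) ->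
  (forall t, parallel_at c Z t) -> (forall t, parallel_at c W t) ->
  forall s t, sff4 (c s) (X s) (Y s) (Z s) (W s) = sff4 (c t) (X t) (Y t) (Z t) (W t).
Proof.
move=> sc pX pY pZ pW; apply: derive0_const => t.
have [sX X0] := pX t; have [sY Y0] := pY t; have [sZ Z0] := pZ t; have [sW W0] := pW t.
have sXY := smf_sff sf (sc t) sX sY; have sZW := smf_sff sf (sc t) sZ sW.
have [sI DI] := derive_inner (1 : R) (smc_comp sf (sc t)) sXY sZW.
have d0 F G : smf c F t -> smf c G t -> covd_curve c F t = 0 -> covd_curve c G t = 0 ->
    normal_part f (c t) (covd (f \o c) (fun s => sff f (c s) (F s) (G s)) t 1) = 0.
  move=> sF sG F0 G0; have H := covd_perp_sff hf hpar (sc t) sF sG.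
  rewrite [covd c F t 1]F0 [covd c G t 1]G0 in H.
  apply: etrans H _.
  have E1 : sff f (c t) 0 (G t) = 0.
    by have := sff_linl sf (c t) (-1) 0 0 (G t); rewrite scaler0 addr0 scaleN1r addNr.
  have E2 : sff f (c t) (F t) 0 = 0.
    by have := sff_linr sf (c t) (-1) (F t) 0 0; rewrite scaler0 addr0 scaleN1r addNr.
  by rewrite E1 E2 addr0.
apply: DeriveDef; first by apply: diff_derivable; exact: smooth_at_diff.
apply: etrans DI _.
have nXY : normal_space f (c t) (sff f (c t) (X t) (Y t)) by exact: sff_normal.
have nZW : normal_space f (c t) (sff f (c t) (Z t) (W t)) by exact: sff_normal.
apply: etrans (congr2 +%R (inner_normal_part _ nZW)
  (etrans (innerC _ _ _) (inner_normal_part _ nXY))) _.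
apply: etrans (congr2 (fun a b => inner (f (c t)) a _ + inner (f (c t)) b _)
  (d0 X Y sX sY X0 Y0) (d0 Z W sZ sW Z0 W0)) _.
exact: etrans (congr2 +%R (bilin0l _ _) (bilin0l _ _)) (addr0 0).
Qed.

Section Isometry.
Variable s : M -> M.
Hypothesis hs : involutive_isometry s.

Let ss : smooth_map s. Proof. by have [] := hs. Qed.
Let iso : forall p x y, inner (s p) (tmap s p x) (tmap s p y) = inner p x y.
Proof. by have [] := hs. Qed.

Lemma tmap_involutive q x : tmap s (s q) (tmap s q x) = x.
Proof.
have [_ inv _] := hs; have ssE : s \o s = id by apply/funext.
by have := tmap_comp q x ss ss; rewrite ssE tmap_id.
Qed.

Lemma parallel_at_push (c : R -> M) X t : smc c t -> parallel_at c X t ->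
  parallel_at (s \o c) (fun t => tmap s (c t) (X t)) t.
Proof.
move=> sc [sX X0]; split; first exact: smf_tmap.
apply: etrans (covd_tmap ss sc (1 : R) sX) _.
by rewrite [covd c X t 1]X0 tmap0 (sff_isometry _ _ _ hs) addr0.
Qed.

(** At p the four signs cancel in pairs. Along a curve the arguments are extended to parallel
    fields, whose images under Ts are parallel along the image curve, so both sides of the identity
    are constant. *)
Lemma sff4_invariant p : connected [set: M] -> s p = p ->
  (forall x, tmap s p x = - x) ->
  forall q x y z w, sff4 (s q) (tmap s q x) (tmap s q y) (tmap s q z) (tmap s q w) =
    sff4 q x y z w.
Proof.
move=> cM sp sp1 q.
pose P q := forall x y z w,
  sff4 (s q) (tmap s q x) (tmap s q y) (tmap s q z) (tmap s q w) = sff4 q x y z w.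
suff [HP Pp] : (forall c : R -> M, (forall t, smc c t) -> P (c 0) -> P (c 1)) /\ P p.
  exact: (curve_const cM HP q Pp).
split=> [c sc Pc0 x y z w|x y z w].
  have ex v := parallel_exists sc 1 v.
  have [X X1 pX] := ex x; have [Y Y1 pY] := ex y.
  have [Z Z1 pZ] := ex z; have [W W1 pW] := ex w.
  have ssc t : smc (s \o c) t by exact: smc_comp.
  have push t V : parallel_at c V t -> parallel_at (s \o c) (fun t => tmap s (c t) (V t)) t.
    exact: parallel_at_push.
  have E1 := sff4_parallel sc pX pY pZ pW 1 0.
  have E2 := sff4_parallel ssc (fun t => push t X (pX t)) (fun t => push t Y (pY t))
    (fun t => push t Z (pZ t)) (fun t => push t W (pW t)) 1 0.
  rewrite -X1 -Y1 -Z1 -W1; apply: etrans E2 _; rewrite E1; exact: Pc0.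
rewrite sp !sp1 /sff4.
have N2 v w' : sff f p (- v) (- w') = sff f p v w'.
  have e1 : sff f p (- v) (- w') = - sff f p v (- w').
    have := sff_linl sf p (-1) v 0 (- w').
    have -> : sff f p 0 (- w') = 0.
      by have := sff_linl sf p (-1) 0 0 (- w'); rewrite scaler0 addr0 scaleN1r addNr.
    by rewrite !addr0 !scaleN1r.
  have e2 : sff f p v (- w') = - sff f p v w'.
    have := sff_linr sf p (-1) v w' 0.
    have -> : sff f p v 0 = 0.
      by have := sff_linr sf p (-1) v 0 0; rewrite scaler0 addr0 scaleN1r addNr.
    by rewrite !addr0 !scaleN1r.
  by rewrite e1 e2 opprK.
by rewrite !N2.
Qed.

Hypothesis sff4_inv : forall q x y z w,
  sff4 (s q) (tmap s q x) (tmap s q y) (tmap s q z) (tmap s q w) = sff4 q x y z w.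

Lemma inner_gen_push q g g' :
  inner (f (s q)) (gen (s q) (push (tmap s q) g)) (gen (s q) (push (tmap s q) g')) =
  inner (f q) (gen q g) (gen q g').
Proof.
case: g => [x|[x y]]; case: g' => [x'|[x' y']] /=.
- by rewrite !isof iso.
- by rewrite !(sff_normal sf isof).
- by rewrite innerC (sff_normal sf isof) innerC (sff_normal sf isof).
- exact: sff4_inv.
Qed.

Lemma inner_gensum_push (A A' : finType) q (y : A -> R) g (y' : A' -> R) g' :
  inner (f (s q)) (gensum (s q) y (fun a => push (tmap s q) (g a)))
                  (gensum (s q) y' (fun a => push (tmap s q) (g' a))) =
  inner (f q) (gensum q y g) (gensum q y' g').
Proof.
rewrite !inner_gensum; apply: eq_bigr => a _; apply: eq_bigr => a' _.
by rewrite inner_gen_push.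
Qed.

(** Inner products of combinations survive [push], so the difference of the two images has the same
    length as the difference of two equal vectors. *)
Lemma gensum_push_uniq (A A' : finType) q (y : A -> R) g (y' : A' -> R) g' :
  gensum q y g = gensum q y' g' ->
  gensum (s q) y (fun a => push (tmap s q) (g a)) =
  gensum (s q) y' (fun a => push (tmap s q) (g' a)).
Proof.
move=> E; apply/eqP; rewrite -subr_eq0; apply/eqP; apply: (@inner_eq0 _ _ _ (f (s q))).
rewrite /inner bilinBl !bilinBr.
have := inner_gensum_push q y g y g; have := inner_gensum_push q y g y' g'.
have := inner_gensum_push q y' g' y g; have := inner_gensum_push q y' g' y' g'.
rewrite /inner => -> -> -> ->; rewrite E.
by rewrite !subrr.
Qed.

End Isometry.
End Generators.

(** * Parallel combinations of a spanning family, and parallel frames *)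

Section Coefficients.
Context {R : realType}.

Lemma coefficient_ode (I : finType) (C : R -> I -> I -> R) (t0 : R) (y0 : I -> R) :
  (forall a b t, smooth_at (fun t => C t a b) t) ->
  exists Y : I -> R -> R, [/\ forall a t, smooth_at (Y a) t, forall a, Y a t0 = y0 a &
    forall b t, 'D_1 (Y b) t = - \sum_a Y a t * C t a b].
Proof.
move=> sC; pose A t : 'M[R]_(#|I|) := \matrix_(i, j) - C t (enum_val i) (enum_val j).
have sA t : smooth_at A t.
  apply/smooth_at_mxP => i j.
  apply: smooth_at_ext (smooth_atN (sC (enum_val i) (enum_val j) t)).
  by near=> u; rewrite mxE.
have [w wt0 dw] := lin_ode_global t0 (\row_i y0 (enum_val i)) sA.
have sw t : smooth_at w t.
  exact: (lin_ode_smooth openT (fun t _ => sA t) (fun t _ => dw t) (Logic.I : setT t)).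
exists (fun a t => w t 0 (enum_rank a)); split.
- by move=> a t; exact: (smooth_at_mxP _ _).1 (sw t) 0 _.
- by move=> a; rewrite wt0 mxE enum_rankK.
- move=> b t; rewrite -(derive_entry (1 : R) 0 _ (smooth_at_diff (sw t))).
  have [_ ->] := dw t; rewrite mxE (reindex (@enum_rank I)) -?sumrN/=; last first.
    exact: onW_bij (enum_rank_bij I).
  by apply: eq_bigr => a _; rewrite mxE !enum_rankK mulrN.
Unshelve. all: by end_near. Qed.

(** With the minus sign in the coefficient equation the two double sums cancel after an exchange of
    summations. The argument is formal and so applies to families with linear relations. *)
Lemma combination_parallel n (N : riemannian R n) (c : R -> N) (I : finType)
    (F : I -> R -> 'rV[R]_n) (C : R -> I -> I -> R) (Y : I -> R -> R) t :
  (forall a, smf c (F a) t) -> (forall a, smooth_at (Y a) t) ->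
  (forall a, covd c (F a) t 1 = \sum_b C t a b *: F b t) ->
  (forall b, 'D_1 (Y b) t = - \sum_a Y a t * C t a b) ->
  parallel_at c (fun t => \sum_a Y a t *: F a t) t.
Proof.
move=> sF sY cF dY; split; first by apply: smf_sum => a _; exact: smfZ.
apply: etrans (covd_sum (1 : R) (index_enum I) sY sF) _.
apply: etrans (eq_bigr (fun a => - (\sum_b Y b t * C t b a) *: F a t +
    Y a t *: \sum_b C t a b *: F b t) _) _.
  move=> a _; exact: (congr2 (fun u v => u *: F a t + Y a t *: v) (dY a) (cF a)).
rewrite big_split/= -[RHS](subrr (\sum_a \sum_b (Y b t * C t b a) *: F a t)) addrC.
congr (_ + _).
  rewrite exchange_big/=; apply: eq_bigr => a _; rewrite scaler_sumr.
  by apply: eq_bigr => b _; rewrite scalerA.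
rewrite -sumrN; apply: eq_bigr => a _.
by rewrite scaleNr scaler_suml.
Qed.

End Coefficients.

Lemma bilin_mx_eq_delta (R : realType) n (G G' : 'M[R]_n) :
  (forall i j, bilin G (delta_mx 0 i) (delta_mx 0 j) =
               bilin G' (delta_mx 0 i) (delta_mx 0 j)) -> G = G'.
Proof. by move=> H; apply/matrixP => i j; rewrite -!bilin_delta; exact: H. Qed.

Section Frames.
Context {R : realType} {m : nat} {M : riemannian R m}.

Lemma inner_parallel (c : R -> M) X Y : (forall t, smc c t) ->
  (forall t, parallel_at c X t) -> (forall t, parallel_at c Y t) ->
  forall s t, inner (c s) (X s) (Y s) = inner (c t) (X t) (Y t).
Proof.
move=> sc pX pY; apply: derive0_const => t.
have [sX X0] := pX t; have [sY Y0] := pY t.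
have [sI DI] := derive_inner (1 : R) (sc t) sX sY.
apply: DeriveDef; first by apply: diff_derivable; exact: smooth_at_diff.
apply: etrans DI _; rewrite [covd c X t 1]X0 [covd c Y t 1]Y0.
exact: etrans (congr2 +%R (bilin0l _ _) (bilin0r _ _)) (addr0 0).
Qed.

(** [ginv] is the inverse Gram matrix, a single matrix for all times because inner products of
    parallel fields are constant; through it, coordinates are inner products with the frame. *)
Definition parallel_frame (c : R -> M) (E : 'I_m -> R -> 'rV[R]_m) (ginv : 'M[R]_m) :=
  (forall i t, parallel_at c (E i) t) /\
  (forall t w, w = \sum_l (\sum_k inner (c t) w (E k t) * ginv k l) *: E l t).

Lemma parallel_frame_exists (c : R -> M) (t0 : R) : (forall t, smc c t) ->
  exists E ginv, parallel_frame c E ginv /\ forall i, E i t0 = delta_mx 0 i.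
Proof.
move=> sc; have /choice[E EP] : forall i : 'I_m, exists V,
    V t0 = delta_mx 0 i /\ forall t, parallel_at c V t.
  by move=> i; have [V V0 pV] := parallel_exists sc t0 (delta_mx 0 i); exists V.
pose g := metric (c t0).
exists E, (invmx g); split; last by move=> i; have [] := EP i.
split=> [i|t w]; first by have [] := EP i.
pose Em : 'M[R]_m := \matrix_i E i t.
have GE : Em *m metric (c t) *m Em^T = g.
  apply: bilin_mx_eq_delta => i j.
  have [Ei pEi] := EP i; have [Ej pEj] := EP j.
  have := inner_parallel sc pEi pEj t t0; rewrite Ei Ej /inner => <-.
  have rE k : delta_mx 0 k *m Em = E k t by rewrite -rowE rowK.
  by rewrite /bilin -(rE i) -(rE j) trmx_mul !mulmxA.
have Eu : Em \in unitmx.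
  have : g \in unitmx by exact: metric_unit.
  by rewrite -GE !unitmx_mul => /andP[/andP[]].
(* Em G Em^T = g gives G Em^T = Em^-1 g, hence this identity; multiplying w by it is the expansion
   to be proved. *)
have GEi : metric (c t) *m Em^T *m invmx g *m Em = 1%:M.
  have -> : metric (c t) *m Em^T = invmx Em *m g.
    by rewrite -GE -!mulmxA mulKmx.
  by rewrite mulmxK ?metric_unit// mulVmx.
rewrite -[LHS]mulmx1 -GEi !mulmxA [LHS]mulmx_sum_row.
apply: eq_bigr => l _; rewrite rowK mxE; congr (_ *: _).
apply: eq_bigr => k _; congr (_ * _).
have rE : delta_mx 0 k *m Em = E k t by rewrite -rowE rowK.
by rewrite /inner /bilin -rE trmx_mul trmx_delta mulmxA -colE [RHS]mxE.
Qed.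

End Frames.

Section OsculatingParallel.
Context {R : realType} {m n : nat} {M : riemannian R m} {N : riemannian R n}.
Variable f : M -> N.
Hypothesis hf : isometric_immersion f.
Hypothesis hpar : parallel_immersion f.

Let sf : smooth_map f. Proof. by have [] := hf. Qed.
Let isof : forall p x y, inner (f p) (tmap f p x) (tmap f p y) = inner p x y.
Proof. by have [] := hf. Qed.

Definition fam_index := ('I_m + 'I_m * 'I_m)%type.

Definition fam (e : 'I_m -> 'rV[R]_m) (a : fam_index) : generator :=
  match a with inl i => inl (e i) | inr (i, j) => inr (e i, e j) end.

Section FrameCoefficients.
Variables (c : R -> M) (E : 'I_m -> R -> 'rV[R]_m) (ginv : 'M[R]_m).

Definition frame_velocity (t : R) (l : 'I_m) : R :=
  \sum_k inner (c t) (velocity c t) (E k t) * ginv k l.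

(* Connection coefficients of the spanning family [fam] of the osculating bundle
   along [c], by the formulas of Gauss and Weingarten. *)
Definition fam_coef (t : R) (a b : fam_index) : R :=
  match a, b with
  | inl i, inr (j, l) => frame_velocity t j * (l == i)%:R
  | inr (i, j), inl l => - \sum_k (\sum_q frame_velocity t q *
        sff4 f (c t) (E i t) (E j t) (E q t) (E k t)) * ginv k l
  | _, _ => 0
  end.

Hypothesis sc : forall t, smc c t.
Hypothesis EP : parallel_frame c E ginv.

Let pE i t : parallel_at c (E i) t. Proof. by have [] := EP. Qed.
Let sE i t : smf c (E i) t. Proof. by have [] := pE i t. Qed.

Lemma velocity_frame t : velocity c t = \sum_l frame_velocity t l *: E l t.
Proof. by have [_] := EP; exact. Qed.

Lemma smooth_frame_velocity l t : smooth_at (fun t => frame_velocity t l) t.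
Proof.
apply: smooth_at_sum => k _; apply: smooth_atM; last exact: smooth_at_cst.
by have [] := derive_inner (1 : R) (sc t) (smf_velocity (sc t)) (sE k t).
Qed.

Lemma smooth_fam_coef a b t : smooth_at (fun t => fam_coef t a b) t.
Proof.
case: a b => [i|[i j]] [l|[q l]] /=; try exact: (smooth_at_cst (0 : R)).
  apply: smooth_atM; last exact: smooth_at_cst.
  exact: smooth_frame_velocity.
apply: smooth_atN; apply: smooth_at_sum => k _; apply: smooth_atM; last exact: smooth_at_cst.
apply: smooth_at_sum => q _; apply: smooth_atM; first exact: smooth_frame_velocity.
have s1 := smf_sff sf (sc t) (sE i t) (sE j t).
have s2 := smf_sff sf (sc t) (sE q t) (sE k t).
by have [] := derive_inner (1 : R) (smc_comp sf (sc t)) s1 s2.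
Qed.

Let F a t := gen f (c t) (fam (fun i => E i t) a).

Lemma smf_fam a t : smf (f \o c) (F a) t.
Proof.
case: a => [i|[i j]]; first exact: smf_tmap.
exact: smf_sff.
Qed.

Lemma covd_fam a t : covd (f \o c) (F a) t 1 = \sum_b fam_coef t a b *: F b t.
Proof.
case: a => [i|[i j]]; rewrite big_sumType/=.
  rewrite [X in _ = X + _]big1 ?add0r; last by move=> l _; rewrite scale0r.
  apply: etrans (covd_tmap sf (sc t) (1 : R) (sE i t)) _.
  have [_ E0] := pE i t; rewrite [covd c (E i) t 1]E0 tmap0 add0r.
  have Ei : E i t = \sum_l (l == i)%:R *: E l t.
    rewrite (bigD1 i)//= eqxx scale1r big1 ?addr0// => l /negPf ->.
    by rewrite scale0r.
  rewrite [X in sff _ _ X _](velocity_frame t) {1}Ei.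
  apply: etrans (sff_sum2 hf _ _ _ _ _) _.
  by apply: eq_bigr => -[j l] _.
rewrite [X in _ = _ + X]big1 ?addr0; last by move=> [q l] _; rewrite scale0r.
set xi := F _; pose w := covd (f \o c) xi t 1.
(* h, E i and E j are parallel, so the derivative of h(E i, E j) is tangential; the Weingarten
   formula then gives its inner products with the frame. *)
have np : normal_part f (c t) w = 0.
  apply: etrans (covd_perp_sff hf hpar (sc t) (sE i t) (sE j t)) _.
  have [_ E0] := pE i t; have [_ E0'] := pE j t.
  rewrite [covd c (E i) t 1]E0 [covd c (E j) t 1]E0'.
  have E1 : sff f (c t) 0 (E j t) = 0.
    by have := sff_linl sf (c t) (-1) 0 0 (E j t); rewrite scaler0 addr0 scaleN1r addNr.
  have E2 : sff f (c t) (E i t) 0 = 0.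
    by have := sff_linr sf (c t) (-1) (E i t) 0 0; rewrite scaler0 addr0 scaleN1r addNr.
  by rewrite E1 E2 addr0.
have -> : covd (f \o c) xi t 1 = tmap f (c t) (tangent_part f (c t) w).
  by rewrite -/w {1}(decomp f (c t) w) np addr0.
have [_ Hexp] := EP; rewrite {1}(Hexp t (tangent_part f (c t) w)) tmap_sum.
apply: eq_bigr => l _; rewrite tmapZ; congr (_ *: _).
rewrite -sumrN; apply: eq_bigr => k _; rewrite -mulNr; congr (_ * _).
apply: etrans (tangent_part_covd_sff hf (sc t) (E k t) (sE i t) (sE j t)) _.
apply: congr1; rewrite (velocity_frame t) (sff_suml hf).
by rewrite /inner bilin_sumr; apply: eq_bigr => q _; rewrite bilinZr.
Qed.

End FrameCoefficients.

Lemma fam_span (e : 'I_m -> 'rV[R]_m) q v :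
  (forall x, exists a : 'I_m -> R, x = \sum_i a i *: e i) -> osc_space f q v ->
  exists y : fam_index -> R, v = gensum f q y (fam e).
Proof.
move=> He /(osc_gensum)[A [y [g ->]]].
have genE g' : exists z : fam_index -> R, gen f q g' = gensum f q z (fam e).
  case: g' => [x|[x x']].
    have [a ->] := He x.
    exists (fun b => match b with inl i => a i | inr _ => 0 end).
    rewrite /gensum big_sumType/= [X in _ = _ + X]big1 ?addr0; last first.
      by move=> ? _; rewrite scale0r.
    by rewrite tmap_sum; apply: eq_bigr => i _; rewrite tmapZ.
  have [a ->] := He x; have [a' ->] := He x'.
  exists (fun b => match b with inl i => 0 | inr ij => a ij.1 * a' ij.2 end).
  rewrite /gensum big_sumType/= [X in _ = X + _]big1 ?add0r; last first.
    by move=> ? _; rewrite scale0r.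
  apply: etrans (sff_sum2 hf _ _ _ _ _) _.
  by apply: eq_bigr => -[i j] _.
have /choice[z zE] := fun a => genE (g a).
exists (fun b => \sum_a y a * z a b).
rewrite [LHS](eq_bigr (fun a => \sum_b (y a * z a b) *: gen f q (fam e b))).
  rewrite exchange_big/=; apply: eq_bigr => b _; by rewrite scaler_suml.
move=> a _; rewrite (zE a) scaler_sumr.
by apply: eq_bigr => b _; rewrite scalerA.
Qed.

Section Transport.
Variable s : M -> M.
Hypothesis hs : involutive_isometry s.
Hypothesis sff4_inv : forall q x y z w,
  sff4 f (s q) (tmap s q x) (tmap s q y) (tmap s q z) (tmap s q w) = sff4 f q x y z w.

Let ss : smooth_map s. Proof. by have [] := hs. Qed.
Let iso : forall p x y, inner (s p) (tmap s p x) (tmap s p y) = inner p x y.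
Proof. by have [] := hs. Qed.

(** Ts preserves inner products, so the same [ginv] works; a vector at s (c t) is expanded after
    being carried back to c t by the involution. *)
Lemma parallel_frame_push c E ginv : (forall t, smc c t) -> parallel_frame c E ginv ->
  parallel_frame (s \o c) (fun i t => tmap s (c t) (E i t)) ginv.
Proof.
move=> sc [pE Hexp]; split=> [i t|t w].
  exact: (parallel_at_push hs (sc t) (pE i t)).
have wE : tmap s (c t) (tmap s (s (c t)) w) = w.
  have [_ inv _] := hs.
  by have := tmap_involutive hs (s (c t)) w; rewrite inv.
rewrite -{1}wE {1}(Hexp t (tmap s (s (c t)) w)) tmap_sum.
apply: eq_bigr => l _; rewrite tmapZ; congr (_ *: _).
by apply: eq_bigr => k _; rewrite -iso wE.
Qed.

Lemma fam_coef_push c E ginv t a b : smc c t ->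
  fam_coef (s \o c) (fun i t => tmap s (c t) (E i t)) ginv t a b =
  fam_coef c E ginv t a b.
Proof.
move=> sc; have vE l : frame_velocity (s \o c) (fun i t => tmap s (c t) (E i t)) ginv t l =
    frame_velocity c E ginv t l.
  apply: eq_bigr => k _; congr (_ * _).
  by rewrite [velocity (s \o c) t](velocity_comp ss sc (1 : R)) iso.
case: a => [i|[i j]]; case: b => [l|[q l]]; [by []| | |by []].
  exact: (congr1 ( *%R^~ _) (vE q)).
apply: (congr1 -%R); apply: eq_bigr => k _; apply: (congr1 ( *%R^~ _)).
apply: eq_bigr => q _; exact: (congr2 *%R (vE q) (sff4_inv _ _ _ _ _)).
Qed.

Lemma push_fam q e a : push (tmap s q) (fam e a) = fam (fun i => tmap s q (e i)) a.
Proof. by case: a => [i|[i j]]. Qed.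

(** The initial coefficients are any presentation of v by the frame; by [fam_coef_push] the
    resulting Y solves the system along s o c as well. *)
Lemma osc_parallel_transport c t0 v : (forall t, smc c t) -> osc_space f (c t0) v ->
  exists Y E, [/\ v = gensum f (c t0) (Y^~ t0) (fam (E^~ t0)),
    forall t, parallel_at (f \o c) (fun t => gensum f (c t) (Y^~ t) (fam (E^~ t))) t &
    forall t, parallel_at (f \o (s \o c)) (fun t => gensum f (s (c t)) (Y^~ t)
      (fun a => push (tmap s (c t)) (fam (E^~ t) a))) t].
Proof.
move=> sc ov; have [E [ginv [EP E0]]] := parallel_frame_exists t0 sc.
have [_ Hexp] := EP.
have [y yE] := fam_span (fun x => ex_intro _ _ (Hexp t0 x)) ov.
have [Y [sY Y0 dY]] := coefficient_ode t0 y (smooth_fam_coef sc EP).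
exists Y, E; split => [|t|t].
- by rewrite yE; apply: eq_bigr => a _; rewrite Y0.
- apply: (combination_parallel (C := fam_coef c E ginv) (F := fun a t => gen f (c t) (fam (E^~ t) a))).
  + by move=> a; exact: (smf_fam sc EP a t).
  + by move=> a; exact: (sY a t).
  + by move=> a; exact: (covd_fam sc EP a t).
  + by move=> b; exact: (dY b t).
- have EP' := parallel_frame_push sc EP.
  have sc' u : smc (s \o c) u by exact: smc_comp.
  pose E' i t := tmap s (c t) (E i t).
  have VE : (fun t => gensum f (s (c t)) (Y^~ t)
        (fun a => push (tmap s (c t)) (fam (E^~ t) a))) =
      (fun t => \sum_a Y a t *: gen f ((s \o c) t) (fam (E'^~ t) a)).
    by apply/funext => u; apply: eq_bigr => a _; rewrite push_fam.
  have dY' b : 'D_1 (Y b) t = - \sum_a Y a t * fam_coef (s \o c) E' ginv t a b.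
    apply: etrans (dY b t) _; apply: (congr1 -%R); apply: eq_bigr => a _.
    exact: (congr1 ( *%R _) (esym (fam_coef_push E ginv a b (sc t)))).
  rewrite VE; exact: (combination_parallel (fun a => smf_fam sc' EP' a t)
    (fun a => sY a t) (fun a => covd_fam sc' EP' a t) dY').
Qed.

End Transport.
End OsculatingParallel.

Lemma mxrank_le_ker (F : fieldType) k m n (A : 'M[F]_(k, m)) (B : 'M[F]_(k, n)) :
  (forall u : 'rV_k, u *m A = 0 -> u *m B = 0) -> (\rank B <= \rank A)%N.
Proof.
move=> H; have : (kermx A <= kermx B)%MS.
  apply/sub_kermxP/row_matrixP => i; rewrite row_mul row0; apply: H.
  by rewrite -row_mul mulmx_ker row0.
move=> /mxrankS; rewrite !mxrank_ker leq_sub2lE ?rank_leq_row//.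
Qed.

(** * Local frames of the osculating bundle, and the map extending Tf and h *)

Section SmoothSections.
Context {R : realType} {m n : nat} {M : riemannian R m} {N : riemannian R n}.
Variable f : M -> N.
Hypothesis hf : isometric_immersion f.
Hypothesis hpar : parallel_immersion f.

Let sf : smooth_map f. Proof. by have [] := hf. Qed.
Let isof : forall p x y, inner (f p) (tmap f p x) (tmap f p y) = inner p x y.
Proof. by have [] := hf. Qed.

Let k := #|{: fam_index (m := m)}|.

Definition fam_mx (q : M) (e : 'I_m -> 'rV[R]_m) : 'M[R]_(k, n) :=
  \matrix_a gen f q (fam e (enum_val a)).

Lemma gensum_fam_mx q e (y : fam_index -> R) :
  gensum f q y (fam e) = (\row_i y (enum_val i)) *m fam_mx q e.
Proof.
rewrite mulmx_sum_row /gensum (reindex (@enum_val _ {: fam_index})) /=; last first.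
  exact: onW_bij (enum_val_bij _).
by apply: eq_bigr => a _; rewrite mxE rowK.
Qed.

Lemma fam_mx_gensum q e (u : 'rV[R]_k) :
  u *m fam_mx q e = gensum f q (fun a => u 0 (enum_rank a)) (fam e).
Proof.
rewrite gensum_fam_mx; congr (_ *m _).
by apply/rowP => i; rewrite mxE enum_valK.
Qed.

Lemma inner_gen_parallel (c : R -> M) (E : 'I_m -> R -> 'rV[R]_m) a b s t :
  (forall t, smc c t) -> (forall i t, parallel_at c (E i) t) ->
  inner (f (c s)) (gen f (c s) (fam (E^~ s) a)) (gen f (c s) (fam (E^~ s) b)) =
  inner (f (c t)) (gen f (c t) (fam (E^~ t) a)) (gen f (c t) (fam (E^~ t) b)).
Proof.
move=> sc pE; case: a => [i|[i j]]; case: b => [i'|[i' j']].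
- by rewrite !isof; exact: inner_parallel.
- exact: etrans (sff_normal sf isof _ _ _ _) (esym (sff_normal sf isof _ _ _ _)).
- apply: etrans (innerC _ _ _) (etrans _ (innerC _ _ _)).
  exact: etrans (sff_normal sf isof _ _ _ _) (esym (sff_normal sf isof _ _ _ _)).
- exact: (sff4_parallel hf hpar sc).
Qed.

(** Let E be a parallel frame starting from the coordinate basis at c 0. The generators for e lie in
    the span of those for E at c 1, and a linear relation among the generators for E at c 0 persists
    at c 1, since their Gram matrix is constant and the combination keeps its length. *)
Lemma rank_fam_mx_le (c : R -> M) e : (forall t, smc c t) ->
  (\rank (fam_mx (c 1%R) e) <= \rank (fam_mx (c 0%R) (fun i => delta_mx 0%R i)))%N.
Proof.
move=> sc; have [E [ginv [[pE Hexp] E0]]] := parallel_frame_exists (0 : R) sc.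
have -> : (fun i => delta_mx 0 i) = E^~ (0 : R) by apply/funext => i; rewrite E0.
have s1 : (fam_mx (c 1) e <= fam_mx (c (1 : R)) (E^~ (1 : R)))%MS.
  apply/row_subP => i; rewrite rowK.
  have [y ->] := fam_span hf (fun x => ex_intro _ _ (Hexp (1 : R) x))
    (osc_space_gen f (c (1 : R)) (fam e (enum_val i))).
  by rewrite gensum_fam_mx submxMl.
apply: leq_trans (mxrankS s1) _; apply: mxrank_le_ker => u.
move=> u0; apply: etrans (fam_mx_gensum _ _ _) _.
have {u0} := etrans (esym (fam_mx_gensum _ _ _)) u0.
set y := fun a => _ => u0.
apply: (@inner_eq0 _ _ _ (f (c (1 : R)))).
apply: etrans (inner_gensum f (c (1 : R)) y _ y _) _.
apply: etrans (eq_bigr _ (fun a _ => eq_bigr _ (fun b _ =>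
  congr1 ( *%R _) (inner_gen_parallel a b (1 : R) (0 : R) sc pE)))) _.
apply: etrans (esym (inner_gensum f (c (0 : R)) y _ y _)) _.
by rewrite [gensum _ _ _ _]u0 /inner bilin0l.
Qed.

Lemma smf_gen_fam (E : normedModType R) (u : E -> M) (X : 'I_m -> E -> 'rV[R]_m) y a :
  smc u y -> (forall i, smf u (X i) y) ->
  smf (f \o u) (fun z => gen f (u z) (fam (X^~ z) a)) y.
Proof.
move=> su sX; case: a => [i|[i j]]; first exact: (smf_tmap sf su (sX i)).
exact: (smf_sff sf su (sX i) (sX j)).
Qed.

Lemma const_field_expand (p q : M) (w : 'rV[R]_m) : cdom p q ->
  w = \sum_i tchart p q w 0 i *: const_field p (delta_mx 0 i) q.
Proof.
move=> pq; rewrite -{1}(tchartK w pq) {1}(row_sum_delta (tchart p q w)).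
elim/big_rec2 : _ => [|i x1 x2 _ <-].
  by apply: etrans _ (tchartK 0 pq); rewrite tchart0.
by rewrite tchartI_lin.
Qed.

(* Near [q0] the osculating bundle has a smooth frame chosen among the vectors
   [gen]: its rank is constant because a parallel frame has constant Gram matrix. *)
Lemma osc_local_frame (q0 : M) : exists r (phi : 'I_r -> fam_index (m := m))
    (y : 'I_r -> 'rV[R]_m -> 'rV[R]_n -> R),
  [/\ \forall x \near chart q0 q0, forall v, osc_space f (chartI q0 x) v ->
        v = gensum f (chartI q0 x) (fun b => y b x v)
          (fun b => fam (fun i => const_field q0 (delta_mx 0 i) (chartI q0 x)) (phi b)) &
      forall W b, smf (f \o chartI q0) W (chart q0 q0) ->
        smooth_at (fun x => y b x (W x)) (chart q0 q0)].
Proof.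
pose x0 := chart q0 q0; pose u : 'rV[R]_m -> M := chartI q0.
have qq := cdom_center q0.
have su : smc u x0 := smc_lexpr (smooth_map_id M) qq.
have ux0 : u x0 = q0 by rewrite /u chartK.
pose D i x : 'rV[R]_m := const_field q0 (delta_mx 0 i) (u x).
have sD i : smf u (D i) x0 by exact: smf_const_field.
pose H x := fam_mx (u x) (D^~ x).
(* A maximal independent set of generators at x0; K x consists of the same rows at nearby points. *)
pose r := \rank (H x0); pose phi0 : 'I_r -> 'I_k := maxrankfun (H x0).
pose K x : 'M[R]_(r, n) := rowsub phi0 (H x).
pose Q x : 'M[R]_r := K x *m metric (f (u x)) *m (K x)^T.
have rowKx x b : row b (K x) = gen f (u x) (fam (D^~ x) (enum_val (phi0 b))).
  by rewrite row_rowsub rowK.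
have QE x a b : Q x a b = inner (f (u x)) (row a (K x)) (row b (K x)).
  by rewrite -[Q x a b]bilin_delta /Q /inner /bilin !rowE trmx_mul !mulmxA.
have sK b : smf (f \o u) (fun x => row b (K x)) x0.
  apply: smf_ext (smf_gen_fam (enum_val (phi0 b)) su sD).
  by near=> z; rewrite rowKx.
have sfu : smc (f \o u) x0 by exact: smc_comp.
have sQ : smooth_at Q x0.
  apply/smooth_at_mxP => a b.
  have [sI _] := derive_inner x0 sfu (sK a) (sK b).
  by apply: smooth_at_ext sI; near=> z; rewrite QE.
have unitQ x : row_free (K x) -> Q x \in unitmx.
  move=> fK; apply: posdef_unitmx => v v0.
  have -> : bilin (Q x) v v = inner (f (u x)) (v *m K x) (v *m K x).
    by rewrite /Q /inner /bilin trmx_mul !mulmxA.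
  apply: metric_posdef; apply: contra_neq v0 => vK0.
  by apply: (row_free_inj fK); rewrite vK0 mul0mx.
have freeK0 : row_free (K x0) by exact: maxrowsub_free.
have Q0 := unitQ _ freeK0.
have sQi := smooth_at_invmx sQ Q0.
(* If v = w K, then v G K^T = w Q, so w is recovered from the inner products of v with the rows of
   K; this depends smoothly on x and v. *)
pose yv x v : 'rV[R]_r := (v *m metric (f (u x)) *m (K x)^T) *m invmx (Q x).
exists r, (fun b => enum_val (phi0 b)), (fun b x v => yv x v 0 b); split.
  have [U [oU Uq0 UP]] := local_curves q0.
  have nU : \forall x \near x0, U (u x).
    by apply: continuous_near oU _; [have [] := su|rewrite ux0].
  have nq := near_along su (cdom_center (u x0)).
  have ndet : \forall x \near x0, \det (Q x) != 0.
    have d0 : \det (Q x0) != 0 by rewrite -unitfE -unitmxE.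
    have op0 : open [set y : R | y != 0] by exact: open_neq.
    exact: (continuous_near (smooth_at_cont (smooth_at_det sQ)) op0).
  apply: filterS3 nU nq ndet => x Ux qx dx v ov.
  have Qx : Q x \in unitmx by rewrite unitmxE unitfE.
  have freeK : row_free (K x).
    apply/row_freeP; exists (metric (f (u x)) *m (K x)^T *m invmx (Q x)).
    by rewrite !mulmxA mulmxV.
  (* The rows of K x are independent because det (Q x) is nonzero; they span all generators once the
     rank at x is known not to exceed r, for which a curve from q0 to u x is used. *)
  have rankH : (\rank (H x) <= r)%N.
    have [c [sc c0 c1]] := UP q0 (u x) Uq0 Ux.
    have := rank_fam_mx_le (D^~ x) sc; rewrite c0 c1 => /leq_trans; apply.
    rewrite /r /H ux0; suff -> : D^~ x0 = (fun i => delta_mx 0 i) by [].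
    by apply/funext => i; rewrite /D ux0 const_field_center.
  have HK : (H x <= K x)%MS.
    have KH : (K x <= H x)%MS by exact: rowsub_sub.
    rewrite -(geq_leqif (mxrank_leqif_sup KH)).
    by apply: leq_trans rankH _; rewrite (eqP freeK).
  rewrite ux0 in qx.
  have [z zE] := fam_span hf (fun w => ex_intro _ _ (const_field_expand w qx)) ov.
  have vH : (v <= H x)%MS by rewrite zE gensum_fam_mx submxMl.
  have [w wE] := submxP (submx_trans vH HK).
  have yE : yv x v = w.
    by rewrite /yv wE -!mulmxA [K x *m _]mulmxA [K x *m _ *m _]mulmxA mulmxV ?mulmx1.
  rewrite {1}wE mulmx_sum_row /gensum yE; apply: eq_bigr => b _.
  by rewrite rowKx.
move=> W b sW.
have sy : smooth_at (fun x => W x *m metric (f (u x)) *m (K x)^T) x0.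
  apply/smooth_at_mxP => i a.
  have [sI _] := derive_inner x0 sfu sW (sK a).
  apply: smooth_at_ext sI; near=> z.
  rewrite ord1 /inner /bilin [row a _]rowE trmx_mul trmx_delta mulmxA -colE.
  by rewrite [LHS]mxE.
exact: (smooth_at_mxP _ _).1 (smooth_at_mulmx sy sQi) 0 b.
Unshelve. all: by end_near. Qed.

Section Sigma.
Variable s : M -> M.
Hypothesis hs : involutive_isometry s.
Hypothesis sff4_inv : forall q x y z w,
  sff4 f (s q) (tmap s q x) (tmap s q y) (tmap s q z) (tmap s q w) = sff4 f q x y z w.

Let ss : smooth_map s. Proof. by have [] := hs. Qed.

(** Quantifying over all presentations of [ovec e] builds well-definedness into the property, so
    that later proofs may choose the presentation that suits them. *)
Definition extends_generators (S : osc_bundle f -> osc_bundle f) :=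
  forall e, obase (S e) = s (obase e) /\ forall (A : finType) (y : A -> R) g,
    ovec e = gensum f (obase e) y g ->
    ovec (S e) = gensum f (s (obase e)) y (fun a => push (tmap s (obase e)) (g a)).

Lemma osc_map_exists : exists S, extends_generators S.
Proof.
suff /choice[S SP] : forall e : osc_bundle f, exists e' : osc_bundle f,
    obase e' = s (obase e) /\ forall (A : finType) (y : A -> R) g,
    ovec e = gensum f (obase e) y g ->
    ovec e' = gensum f (s (obase e)) y (fun a => push (tmap s (obase e)) (g a)).
  by exists S.
move=> [q v ov] /=; have [A [y [g vE]]] := osc_gensum ov.
exists (OscVector (osc_space_gensum f (s q) y (fun a => push (tmap s q) (g a)))) => /=.
split => // A' y' g' vE'.
by apply: (gensum_push_uniq hf hs sff4_inv); rewrite -vE -vE'.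
Qed.

Lemma osc_bundle_eq (e e' : osc_bundle f) : obase e = obase e' -> ovec e = ovec e' -> e = e'.
Proof.
case: e e' => [q v ov] [q' v' ov'] /= E1 E2; subst q' v'.
by congr OscVector; exact: Prop_irrelevance.
Qed.

Variable S : osc_bundle f -> osc_bundle f.
Hypothesis SP : extends_generators S.

Lemma extends_generators_bundle_hom : bundle_hom_along s S.
Proof.
split=> [e|a [q1 v1 o1] [q2 v2 o2] [q3 v3 o3] /= E1 E2 vE|U sct oU [bU sU]].
- by have [] := SP e.
- subst q1 q2.
  have [_ S1] := SP (OscVector o1); have [_ S2] := SP (OscVector o2).
  have [_ S3] := SP (OscVector o3); rewrite /= in S1 S2 S3.
  have [A1 [y1 [g1 v1E]]] := osc_gensum o1; have [A2 [y2 [g2 v2E]]] := osc_gensum o2.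
  rewrite (S1 _ _ _ v1E) (S2 _ _ _ v2E).
  (* Linearity: the presentations of the two vectors are concatenated over the sum of their index
     types, the scalar a being absorbed in the first. *)
  pose y := fun b : A1 + A2 => match b with inl b => a * y1 b | inr b => y2 b end.
  pose g := fun b : A1 + A2 => match b with inl b => g1 b | inr b => g2 b end.
  have gsE q h1 h2 : gensum f q y (fun b => match b with inl b => h1 b | inr b => h2 b end) =
      a *: gensum f q y1 h1 + gensum f q y2 h2.
    rewrite /gensum big_sumType/=; apply: (congr1 (+%R^~ _)).
    by rewrite scaler_sumr; apply: eq_bigr => b _; rewrite scalerA.
  rewrite -gsE (S3 _ y g); last by rewrite vE v1E v2E -gsE.
  by apply: eq_bigr => -[].
- have sfs : smooth_map (f \o s) by exact: smooth_map_comp.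
  apply/smooth_alongP => // q0 Uq0.
  (* The section has smooth coefficients in the local frame, and its image is the combination of the
     pushed coordinate fields with the same coefficients. *)
  have [r [phi [y [Hy sy]]]] := osc_local_frame q0.
  pose u : 'rV[R]_m -> M := chartI q0; pose x0 := chart q0 q0.
  have qq := cdom_center q0.
  have su : smc u x0 := smc_lexpr (smooth_map_id M) qq.
  have ux0 : u x0 = q0 by rewrite /u chartK.
  pose W x := ovec (sct (u x)).
  have sW : smf (f \o u) W x0 by exact: ((smooth_alongP _ sf oU).1 sU q0 Uq0).
  pose TD i x : 'rV[R]_m := tmap s (u x) (const_field q0 (delta_mx 0 i) (u x)).
  have sTD i : smf (s \o u) (TD i) x0.
    exact: (smf_tmap ss su (smf_const_field (delta_mx 0 i) qq)).
  have ssu : smc (s \o u) x0 by exact: smc_comp.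
  have sG : smf (f \o (s \o u)) (fun x => \sum_b y b x (W x) *:
      gen f (s (u x)) (fam (TD^~ x) (phi b))) x0.
    apply: smf_sum => b _; apply: smfZ; first exact: sy.
    exact: (smf_gen_fam (phi b) ssu sTD).
  apply: smf_ext sG.
  have nU : \forall x \near x0, U (u x).
    by apply: continuous_near oU _; [have [] := su|rewrite ux0].
  apply: filterS2 Hy nU => x Hx Ux.
  have [_ Sx] := SP (sct (u x)); have ov := ovecP (sct (u x)).
  rewrite (bU _ Ux) in Sx ov.
  apply: esym; apply: etrans (Sx _ _ _ (Hx _ ov)) _.
  by apply: eq_bigr => b _; rewrite push_fam.
Qed.

Lemma extends_generators_isometric : fibrewise_isometric s S.
Proof.
move=> q [q1 v1 o1] [q2 v2 o2] /= E1 E2; subst q1 q2.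
have [_ S1] := SP (OscVector o1); have [_ S2] := SP (OscVector o2); rewrite /= in S1 S2.
have [A1 [y1 [g1 v1E]]] := osc_gensum o1; have [A2 [y2 [g2 v2E]]] := osc_gensum o2.
rewrite (S1 _ _ _ v1E) (S2 _ _ _ v2E) v1E v2E.
exact: inner_gensum_push.
Qed.

Lemma extends_generators_involutive : involutive S.
Proof.
move=> e; have [_ inv _] := hs; have [b1 S1] := SP e; have [b2 S2] := SP (S e).
have bE : obase (S (S e)) = obase e by rewrite b2 b1 inv.
apply: osc_bundle_eq => //.
have [A [y [g vE]]] := osc_gensum (ovecP e).
have := S2 _ _ _ _; rewrite b1 inv => /(_ _ _ _ (S1 _ _ _ vE)) ->.
rewrite vE; apply: eq_bigr => a _; congr (_ *: gen f _ _).
by case: (g a) => [x|[x z]] /=; rewrite !(tmap_involutive hs).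
Qed.

(** By uniqueness of parallel fields in N along f o c, a given parallel section is the combination
    built by [osc_parallel_transport]; S sends that combination to the pushed one, which is parallel
    too. *)
Lemma extends_generators_parallel : parallel_bundle_map s S.
Proof.
move=> c sct sc [bE pV]; have {}sc := (smooth_curveP c).1 sc.
split=> [t|]; first by have [-> _] := SP (sct t); rewrite bE.
have sfc t : smc (f \o c) t by exact: smc_comp.
have ssc t : smc (s \o c) t by exact: smc_comp.
have sfsc t : smc (f \o (s \o c)) t by exact: smc_comp.
have {}pV := (parallel_alongP sfc _).1 pV.
have ov := ovecP (sct 0); rewrite bE in ov.
have [Y [E [v0E pY pY']]] := osc_parallel_transport hf hpar hs sff4_inv sc ov.
have VE := parallel_unique_all sfc pV pY v0E.
apply/(parallel_alongP sfsc) => t.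
have SE u : gensum f (s (c u)) (Y^~ u)
    (fun a => push (tmap s (c u)) (fam (E^~ u) a)) = ovec (S (sct u)).
  have [_ Su] := SP (sct u); rewrite bE in Su.
  by apply: esym; apply: Su; exact: VE.
change (parallel_at (f \o (s \o c)) (fun u => ovec (S (sct u))) t).
rewrite -(funext SE); exact: pY'.
Qed.

End Sigma.
End SmoothSections.

(** * Bundle maps along an isometry *)

Section OscMaps.
Context {R : realType} {m n : nat} {M : riemannian R m} {N : riemannian R n}.
Variable f : M -> N.
Hypothesis hf : isometric_immersion f.
Hypothesis hpar : parallel_immersion f.
Variable s : M -> M.
Hypothesis hs : involutive_isometry s.
Hypothesis sff4_inv : forall q x y z w,
  sff4 f (s q) (tmap s q x) (tmap s q y) (tmap s q z) (tmap s q w) = sff4 f q x y z w.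

Let sf : smooth_map f. Proof. by have [] := hf. Qed.
Let ss : smooth_map s. Proof. by have [] := hs. Qed.

(** Every osculating vector at c 1 lies on a parallel section of the osculating bundle along c. Its
    images under S and S' are parallel in N and agree at time 0. *)
Lemma parallel_bundle_map_uniq (S S' : osc_bundle f -> osc_bundle f) (p : M) :
  connected [set: M] -> parallel_bundle_map s S -> parallel_bundle_map s S' ->
  (forall e, obase e = p -> S e = S' e) -> S = S'.
Proof.
move=> cM pS pS' Sp; apply/funext => e0.
suff H q : forall e, obase e = q -> S e = S' e by exact: (H (obase e0)).
pose P q := forall e : osc_bundle f, obase e = q -> S e = S' e.
apply: (@curve_const _ _ M P cM _ p q) => // c sc P0 e e1.
have ov := ovecP e; rewrite e1 in ov.
have [Y [E [v1E pY _]]] := osc_parallel_transport hf hpar hs sff4_inv sc ov.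
pose sct t := OscVector (osc_space_gensum f (c t) (Y^~ t) (fam (E^~ t))).
have sfc t : smc (f \o c) t by exact: smc_comp.
have ssc t : smc (s \o c) t by exact: smc_comp.
have sfsc t : smc (f \o (s \o c)) t by exact: smc_comp.
have scc : smooth_curve c by exact/smooth_curveP.
have psct : parallel_section c sct by split=> //; exact/(parallel_alongP sfc).
have [b1 /(parallel_alongP sfsc) p1] := pS _ _ scc psct.
have [b2 /(parallel_alongP sfsc) p2] := pS' _ _ scc psct.
have E0 : S (sct 0) = S' (sct 0) by exact: P0.
have VE := parallel_unique_all sfsc p1 p2 (congr1 (@ovec _ _ _ _ _ f) E0) 1.
have -> : e = sct 1 by apply: osc_bundle_eq.
apply: osc_bundle_eq; last exact: VE.
exact: etrans (b1 1) (esym (b2 1)).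
Qed.

Variable S : osc_bundle f -> osc_bundle f.
Hypothesis SP : extends_generators s S.

Lemma extends_generators_gen e g : ovec e = gen f (obase e) g ->
  ovec (S e) = gen f (s (obase e)) (push (tmap s (obase e)) g).
Proof.
have [_ Se] := SP e => eE.
have g1 q g' : gensum f q (fun=> 1) (fun _ : unit => g') = gen f q g' :> 'rV[R]_n.
  rewrite /gensum (big_pred1 tt) ?scale1r// => -[]//.
by rewrite (Se _ (fun=> 1) (fun _ : unit => g)) ?eE g1.
Qed.

Lemma extends_generators_normal e k (a : 'I_k -> R) x y :
  ovec e = \sum_i a i *: sff f (obase e) (x i) (y i) ->
  ovec (S e) = \sum_i a i *: sff f (s (obase e))
    (tmap s (obase e) (x i)) (tmap s (obase e) (y i)).
Proof.
have [_ Se] := SP e => eE.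
exact: (Se _ a (fun i => inr (x i, y i))).
Qed.

Lemma sff_opp q x y : sff f q (- x) (- y) = sff f q x y.
Proof.
have N1 z : - z = (-1) *: z :> 'rV[R]_m by rewrite scaleN1r.
have Zl a x' y' : sff f q (a *: x') y' = a *: sff f q x' y'.
  have := sff_linl sf q a x' 0 y'.
  have -> : sff f q 0 y' = 0.
    have := sff_linl sf q (-1) 0 0 y'; rewrite scaler0 addr0 scaleN1r addNr; exact.
  by rewrite !addr0.
have Zr a x' y' : sff f q x' (a *: y') = a *: sff f q x' y'.
  by rewrite [LHS](sffC sf) Zl [sff f q y' x'](sffC sf).
by rewrite (N1 x) (N1 y) Zl Zr scalerA mulrNN mulr1 scale1r.
Qed.

Lemma extends_generators_reflection p : s p = p -> (forall x, tmap s p x = - x) ->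
  reflection_at S p.
Proof.
move=> sp sp1 e x xi be [k [a [x1 [y1 xiE]]]] vE; have [bS Se] := SP e.
rewrite be in bS Se; rewrite sp in bS Se; split => //.
(* The tangential vector is one generator and the summands of xi are the others; [push] at p changes
   the sign of every argument, which h does not see. *)
pose y (i : unit + 'I_k) : R := match i with inl _ => 1 | inr j => a j end.
pose g (i : unit + 'I_k) : generator := match i with inl _ => inl x | inr j => inr (x1 j, y1 j) end.
have gE q (h : unit -> generator) h' : gensum f q y (fun i : unit + 'I_k =>
    match i with inl i => h i | inr j => h' j end) =
    gen f q (h tt) + \sum_i a i *: gen f q (h' i).
  rewrite /gensum big_sumType/=; apply: (congr1 (+%R^~ _)).
  by rewrite (big_pred1 tt) ?scale1r// => -[].
have eE : ovec e = gensum f p y g.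
  by rewrite vE xiE; apply: esym; exact: (gE p (fun=> inl x) (fun j => inr (x1 j, y1 j))).
apply: etrans (Se _ _ _ eE) _.
have -> : (fun i => push (tmap s p) (g i)) = (fun i => match i with
    inl i => inl (- x) | inr j => inr (- x1 j, - y1 j) end).
  by apply/funext => -[i|j] /=; rewrite !sp1.
apply: etrans (gE p (fun=> inl (- x)) (fun j => inr (- x1 j, - y1 j))) _.
apply: congr2; first by rewrite /gen -scaleN1r tmapZ scaleN1r.
by rewrite xiE; apply: eq_bigr => i _ /=; rewrite sff_opp.
Qed.

End OscMaps.

Local Transparent covd.

(** * Geodesics *)

Lemma deriveN_dir (R : realType) (V W : normedModType R) (F : V -> W) x v :
  differentiable F x -> 'D_(- v) F x = - 'D_v F x.
Proof. by move=> dF; rewrite !deriveE// linearN. Qed.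

Section Geodesics.
Context {R : realType} {n : nat} {N : riemannian R n}.
Implicit Types c : R -> N.

Lemma covdN_dir c V t : smc c t -> smf c V t -> covd c V t (-1) = - covd c V t 1.
Proof.
move=> [cc sc] sV.
have dG : differentiable (cgram (c t)) (chart (c t) (c t)).
  by apply: metric_at_diff; exact: metric_at_gram (cdom_center _).
have chrN u v : chr (cgram (c t)) (chart (c t) (c t)) (- u) v =
    - chr (cgram (c t)) (chart (c t) (c t)) u v.
  have := chr_linl (-1) u 0 v dG; have := chr_linl (-1) 0 0 v dG.
  move: (chr (cgram (c t)) (chart (c t) (c t))) => C.
  by rewrite scaler0 !addr0 !scaleN1r addNr => -> ->; exact: addr0.
apply: etrans (covd_val (erefl _) (deriveN_dir _ (smooth_at_diff sV))
  (deriveN_dir _ (smooth_at_diff sc)) (erefl _)) _.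
apply: etrans (congr1 (+%R _) (chrN _ _)) _.
exact: etrans (esym (opprD _ _)) (congr1 -%R (esym (covd_val (erefl _) (erefl _) (erefl _) (erefl _)))).
Qed.

Lemma smooth_at_opp (t : R) : smooth_at (fun t : R => - t) t.
Proof. exact: smooth_atN (smooth_at_id t). Qed.

Lemma derive_opp (t : R) : 'D_1 (fun t : R => - t) t = -1.
Proof. by have [_ ->] := is_deriveN (is_derive_id t (1 : R)). Qed.

Lemma smc_reverse c t : smc c (- t) -> smc (fun t => c (- t)) t.
Proof.
move=> sc; have [cc sct] := sc.
apply: (smc_precomp (k := fun t => - t) sc); first exact: opp_continuous.
exact: (smooth_at_comp1 (smooth_at_opp t) sct).
Qed.

Lemma parallel_at_reverse c V t : smc c (- t) -> parallel_at c V (- t) ->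
  parallel_at (fun t => c (- t)) (fun t => V (- t)) t.
Proof.
move=> sc [sV V0]; split.
  exact: (smooth_at_comp1 (smooth_at_opp t) sV).
have dN := smooth_at_diff (smooth_at_opp t).
apply: etrans (covd_comp (1 : R) dN sc sV) _.
rewrite derive_opp; apply: etrans (covdN_dir sc sV) _.
by rewrite [covd c V (- t) 1]V0 oppr0.
Qed.

Lemma velocity_reverse c t : smc c (- t) ->
  velocity (fun t => c (- t)) t = - velocity c (- t).
Proof.
move=> [_ sc]; have dN := smooth_at_diff (smooth_at_opp t).
apply: etrans (derive_comp (1 : R) dN (smooth_at_diff sc)) _.
rewrite derive_opp linearN; apply: congr1; apply: esym.
by apply: deriveE; exact: smooth_at_diff.
Qed.

Lemma parallel_atN c V t : smc c t -> parallel_at c V t ->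
  parallel_at c (fun t => - V t) t.
Proof.
move=> sc [sV V0]; have E : \forall z \near t, (-1 : R) *: V z = - V z.
  by near=> z; rewrite scaleN1r.
have E' : \forall z \near t, - V z = cst (-1 : R) z *: V z + 0.
  by near=> z; rewrite scaleN1r addr0.
split; first by apply: smf_ext E (smfZ (smooth_at_cst (-1 : R) t) sV).
apply: etrans (covd_ext _ (1 : R) E') _.
apply: etrans (covdZD (1 : R) (smooth_at_cst (-1 : R) t) sV (smf0 c t)) _.
by rewrite derive_cst [covd c V t 1]V0 covd0 scale0r scaler0 !addr0.
Unshelve. all: by end_near. Qed.

(** Position and velocity in the chart r as one point of phase space, which makes the geodesic
    equation first order and autonomous. *)
Definition geodesic_state c r (t : R) : 'rV[R]_(n + n) :=
  row_mx (chart r (c t)) ('D_1 (chart r \o c) t).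

(** The geodesic spray in the coordinates of the chart r. *)
Definition geodesic_field (r : N) (w : 'rV[R]_(n + n)) : 'rV[R]_(n + n) :=
  row_mx (rsubmx w) (- chr (cgram r) (lsubmx w) (rsubmx w) (rsubmx w)).

Lemma smooth_geodesic_field r q w : cdom r q -> lsubmx w = chart r q ->
  smooth_at (geodesic_field r) w.
Proof.
move=> rq wq; have [sG _ uG] : metric_at (cgram r) (lsubmx w).
  by rewrite wq; exact: metric_at_gram.
have sco i j : smooth_at (fun w : 'rV[R]_(n + n) => w i j) w.
  exact: (smooth_at_mxP _ _).1 (smooth_at_id w) i j.
have sl : smooth_at (fun w : 'rV[R]_(n + n) => lsubmx w) w.
  apply/smooth_at_mxP => i j; apply: smooth_at_ext (sco i (lshift n j)).
  by near=> z; rewrite [RHS]mxE.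
have sr : smooth_at (fun w : 'rV[R]_(n + n) => rsubmx w) w.
  apply/smooth_at_mxP => i j; apply: smooth_at_ext (sco i (rshift n j)).
  by near=> z; rewrite [RHS]mxE.
have sc := smooth_at_chr sG uG sl sr sr.
apply/smooth_at_mxP => i j; rewrite /geodesic_field.
case: (split_ordP j) => k ->.
  apply: smooth_at_ext ((smooth_at_mxP _ _).1 sr i k).
  by near=> z; rewrite row_mxEl.
apply: smooth_at_ext (smooth_atN ((smooth_at_mxP _ _).1 sc i k)).
by near=> z; rewrite row_mxEr [RHS]mxE.
Unshelve. all: by end_near. Qed.

Lemma geodesic_ode c r t : smc c t -> parallel_at c (velocity c) t -> cdom r (c t) ->
  is_derive t (1 : R) (geodesic_state c r) (geodesic_field r (geodesic_state c r t)).
Proof.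
move=> sc [sv v0] rt; have scr := smc_chart sc rt; have [cc _] := sc.
have svr := smf_chart sc sv rt.
have sD := smooth_at_derive (1 : R) scr.
have nE : \forall z \near t, tchart r (c z) (velocity c z) = 'D_1 (chart r \o c) z.
  by apply: filterS2 (smc_near sc) (near_along sc rt) => z sz rz; exact: tchart_velocity.
have dv : 'D_1 ('D_1 (chart r \o c)) t =
    - chr (cgram r) (chart r (c t)) ('D_1 (chart r \o c) t) ('D_1 (chart r \o c) t).
  have := covd_chart (1 : R) cc rt (smooth_at_diff scr) (smooth_at_diff svr).
  rewrite [covd c _ t 1]v0 tchart0 (near_eq_derive (1 : R) nE) (nbhs_singleton nE).
  by move=> /esym/eqP; rewrite addr_eq0 => /eqP.
have d1 : is_derive t (1 : R) (chart r \o c) ('D_1 (chart r \o c) t).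
  by apply: DeriveDef => //; apply: diff_derivable; exact: smooth_at_diff.
have d2 : is_derive t (1 : R) ('D_1 (chart r \o c)) ('D_1 ('D_1 (chart r \o c)) t).
  by apply: DeriveDef => //; apply: diff_derivable; exact: smooth_at_diff.
apply: is_derive_mx => i j; rewrite /geodesic_field/geodesic_state row_mxKl row_mxKr.
case: (split_ordP j) => k ->.
  rewrite row_mxEl; have := is_derive_entry i k d1.
  by congr is_derive; apply/funext => z; rewrite row_mxEl.
rewrite row_mxEr -dv; have := is_derive_entry i k d2.
by congr is_derive; apply/funext => z; rewrite row_mxEr.
Qed.

(** Agreement of positions and velocities is an open condition by uniqueness for the spray.
    Disagreement is open as well, so connectedness of the line gives agreement everywhere. *)
Lemma geodesic_unique c c' : (forall t, smc c t) -> (forall t, smc c' t) ->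
  (forall t, parallel_at c (velocity c) t) -> (forall t, parallel_at c' (velocity c') t) ->
  c 0 = c' 0 -> velocity c 0 = velocity c' 0 -> c = c'.
Proof.
move=> sc sc' gc gc' c0 v0; apply/funext => t.
pose P (t : R) := c t = c' t /\ velocity c t = velocity c' t.
suff : P t by case.
have cR : connected [set: R].
  by have -> : [set: R] = [set` `]-oo, +oo[%O] ; [apply/seteqP; split|exact/connected_intervalP/interval_is_interval].
apply: (@connected_const _ setT P cR _ 0 t) => // u _.
have [[cu vu]|nPu] := pselect (P u).
  have rr := cdom_center (c u); pose r := c u.
  have rc' : cdom r (c' u) by rewrite -cu.
  have n1 : \forall z \near u, is_derive z (1 : R) (geodesic_state c r)
      (geodesic_field r (geodesic_state c r z)).
    by apply: filterS (near_along (sc u) rr) => z; exact: geodesic_ode.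
  have n2 : \forall z \near u, is_derive z (1 : R) (geodesic_state c' r)
      (geodesic_field r (geodesic_state c' r z)).
    by apply: filterS (near_along (sc' u) rc') => z; exact: geodesic_ode.
  have E0 : geodesic_state c r u = geodesic_state c' r u.
    rewrite /geodesic_state; apply: congr2; first by rewrite cu.
    exact: etrans (esym (tchart_velocity (sc u) rr))
      (etrans (congr2 (tchart r) cu vu) (tchart_velocity (sc' u) rc')).
  have sF : smooth_at (geodesic_field r) (geodesic_state c r u).
    by apply: (smooth_geodesic_field rr); rewrite row_mxKl.
  have nE := ode_unique_local sF E0 n1 n2.
  have : \forall z \near u, P z.
    apply: filterS3 nE (near_along (sc u) rr) (near_along (sc' u) rc') => z.
    move=> /eq_row_mx[e1 e2] rz rz'.
    have cz : c z = c' z by rewrite -(chartK rz) e1 chartK.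
    have w1 := tchart_velocity (sc z) rz; have w2 := tchart_velocity (sc' z) rz'.
    have w3 := congr1 (fun q => tchart r q (velocity c' z)) cz.
    have vz := etrans w1 (etrans e2 (etrans (esym w2) (esym w3))).
    exact: conj cz (tchart_inj rz vz).
  rewrite /prop_near1 nbhsE => -[U [oU Uu] UP]; exists U; split; [exact: oU|exact: Uu|] => y z _ _ _ Uz _; exact: UP.
(* Distinct positions are separated by disjoint open sets; for equal positions some coordinate of
   the difference of velocities, taken in a common chart, is nonzero at u and hence nearby. *)
suff : \forall z \near u, ~ P z.
  rewrite /prop_near1 nbhsE => -[U [oU Uu] UP]; exists U; split; [exact: oU|exact: Uu|] => y z _ _ Uy _ Py.
  by case: (UP y Uy Py).
have [cu|cu] := pselect (c u = c' u); last first.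
  have := @hausdorffM _ _ N; rewrite open_hausdorff => /(_ (c u) (c' u)).
  case; first exact/eqP.
  move=> [A B] /= [/set_mem Au /set_mem Bu] [oA oB AB].
  have nA := continuous_near (sc u).1 oA Au; have nB := continuous_near (sc' u).1 oB Bu.
  apply: filterS2 nA nB => z Az Bz [cz _].
  have : (A `&` B) (c z) by split=> //; rewrite cz.
  by rewrite (eqP AB).
have rr := cdom_center (c u); pose r := c u.
have rc' : cdom r (c' u) by rewrite -cu.
pose D z := 'D_1 (chart r \o c) z - 'D_1 (chart r \o c') z.
have Du : D u != 0.
  rewrite subr_eq0; apply/eqP => DE; apply: nPu.
  have w1 := tchart_velocity (sc u) rr; have w2 := tchart_velocity (sc' u) rc'.
  have w3 := congr1 (fun q => tchart r q (velocity c' u)) cu.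
  have vu := etrans w1 (etrans DE (etrans (esym w2) (esym w3))).
  exact: conj cu (tchart_inj rr vu).
have /rV0Pn[j Dj] := Du.
have sD : smooth_at D u.
  apply: smooth_at_mxB; first exact: smooth_at_derive (smc_chart (sc u) rr).
  exact: smooth_at_derive (smc_chart (sc' u) rc').
have cD := smooth_at_cont ((smooth_at_mxP _ _).1 sD 0 j).
have op0 : open [set y : R | y != 0] by exact: open_neq.
apply: filterS3 (continuous_near cD op0 Dj) (near_along (sc u) rr)
  (near_along (sc' u) rc') => z Dz rz rz' [cz vz].
move/eqP: Dz; apply; suff -> : D z = 0 by exact: mxE.
apply/eqP; rewrite subr_eq0; apply/eqP.
exact: etrans (esym (tchart_velocity (sc z) rz))
  (etrans (congr2 (tchart r) cz vz) (tchart_velocity (sc' z) rz')).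
Qed.

End Geodesics.

Local Opaque covd.

(** * Parallel displacement along geodesics through the centre of a symmetry *)

Section Reflection.
Context {R : realType} {m n : nat} {M : riemannian R m} {N : riemannian R n}.
Variables (s : M -> M) (p : M) (c : R -> M).
Hypothesis hs : involutive_isometry s.
Hypothesis sp : s p = p.
Hypothesis sp1 : forall x, tmap s p x = - x.
Hypothesis gc : geodesic_line c.
Hypothesis c0 : c 0 = p.

Let ss : smooth_map s. Proof. by have [] := hs. Qed.
Let sc t : smc c t. Proof. by have [/smooth_curveP] := gc. Qed.
Let pc t : parallel_at c (velocity c) t.
Proof. by split; [exact: smf_velocity|have [_] := gc; exact]. Qed.
Let rc t := s (c (- t)).
Let src t : smc rc t.
Proof. exact: smc_comp ss (smc_reverse (sc (- t))). Qed.
(** With this sign the velocity of c goes to the velocity of [rc], and the value at time 0 is V 0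
    again, as Ts is -id at p. *)
Let push_reverse V : (forall t, parallel_at c V t) ->
  forall t, parallel_at rc (fun t => - tmap s (c (- t)) (V (- t))) t.
Proof.
move=> pV t; apply: (parallel_atN (src t)).
exact: (parallel_at_push hs (smc_reverse (sc (- t)))
  (parallel_at_reverse (sc (- t)) (pV (- t)))).
Qed.

Let velocity_rc t : velocity rc t = - tmap s (c (- t)) (velocity c (- t)).
Proof.
apply: etrans (velocity_comp ss (smc_reverse (sc (- t))) (1 : R)) _.
apply: etrans (congr1 (tmap s (c (- t))) (velocity_reverse (sc (- t)))) _.
exact: tmapN.
Qed.

Lemma geodesic_reflection : (fun t => s (c (- t))) = c.
Proof.
have rc0 : rc 0 = c 0 by rewrite /rc oppr0 c0.
apply: (geodesic_unique src sc _ pc rc0).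
  by rewrite (funext velocity_rc); exact: push_reverse.
by rewrite velocity_rc oppr0 c0 sp1 opprK.
Qed.

(** Since [rc] is c, the reflected field is parallel along c itself; it agrees with V at time 0. *)
Lemma parallel_reflection V : (forall t, parallel_at c V t) ->
  forall t, V t = - tmap s (c (- t)) (V (- t)).
Proof.
move=> pV; have := push_reverse pV; rewrite /rc geodesic_reflection => pW.
apply: (parallel_unique_all sc pV pW (s := 0)).
by rewrite oppr0 c0 sp1 opprK.
Qed.

Lemma parallel_displacement_reflection x y :
  parallel_displacement c (-1) 1 x y <-> y = - tmap s (c (-1)) x.
Proof.
split=> [[V [/(parallel_alongP sc) pV <- <-]]|->]; first exact: parallel_reflection.
have [V V1 pV] := parallel_exists sc (-1) x.
exists V; split; [exact/(parallel_alongP sc)|exact: V1|].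
by rewrite (parallel_reflection pV 1) V1.
Qed.

Variable f : M -> N.
Hypothesis hf : isometric_immersion f.
Hypothesis hpar : parallel_immersion f.
Let sf : smooth_map f. Proof. by have [] := hf. Qed.
Let isof : forall p x y, inner (f p) (tmap f p x) (tmap f p y) = inner p x y.
Proof. by have [] := hf. Qed.

(** Only the normal part of the derivative of the difference pairs with the difference, so its
    length is constant although the fields need not be parallel in N. *)
Lemma normal_parallel_unique (xi eta : R -> 'rV[R]_n) t0 :
  (forall t, normal_space f (c t) (xi t)) -> (forall t, normal_space f (c t) (eta t)) ->
  (forall t, smf (f \o c) xi t) -> (forall t, smf (f \o c) eta t) ->
  (forall t, covd_perp_curve f c xi t = 0) -> (forall t, covd_perp_curve f c eta t = 0) ->
  xi t0 = eta t0 -> forall t, xi t = eta t.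
Proof.
move=> nxi neta sxi seta pxi peta E0 t.
pose D u := xi u - eta u.
have nD u : normal_space f (c u) (D u).
  by have := normal_spaceZD (-1) (neta u) (nxi u); rewrite scaleN1r addrC.
have sD u : smf (f \o c) D u := smfB (sxi u) (seta u).
have cD u : normal_part f (c u) (covd (f \o c) D u 1) = 0.
  apply: etrans (congr1 (normal_part f (c u)) (covdB (1 : R) (sxi u) (seta u))) _.
  rewrite -scaleN1r; apply: etrans (normal_partD f (c u) _ _) _.
  apply: etrans (congr1 (+%R _) (normal_partZ f (c u) _ _)) _.
  apply: etrans (congr2 (fun a b => a + (-1) *: b) (pxi u) (peta u)) _.
  by rewrite scaler0 addr0.
have sfc u : smc (f \o c) u by exact: smc_comp.
have inD u : inner (f (c u)) (covd (f \o c) D u 1) (D u) = 0.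
  apply: etrans (inner_normal_part _ (nD u)) _.
  by rewrite cD /inner bilin0l.
have /derive0_const H : forall u, is_derive u (1 : R)
    (fun u => inner (f (c u)) (D u) (D u)) 0.
  move=> u; have [sI DI] := derive_inner (1 : R) (sfc u) (sD u) (sD u).
  apply: DeriveDef; first exact/diff_derivable/smooth_at_diff.
  apply: etrans DI _.
  exact: etrans (congr2 +%R (inD u) (etrans (innerC _ _ _) (inD u))) (addr0 0).
have := H t t0; rewrite {3 4}/D E0 subrr /inner bilin0l => D0.
by apply/eqP; rewrite -subr_eq0; apply/eqP; exact: (inner_eq0 D0).
Qed.

(** With x i and y i extended to parallel fields along c, the corresponding combination of second
    fundamental forms is parallel in the normal bundle. At time 1 [parallel_reflection] puts a sign
    on both arguments of h, and the signs cancel. *)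
Lemma normal_displacement_reflection k (a : 'I_k -> R) (x y : 'I_k -> 'rV[R]_m) w :
  normal_displacement f c (-1) 1 (\sum_i a i *: sff f (c (-1)) (x i) (y i)) w <->
  w = \sum_i a i *: sff f (c 1) (tmap s (c (-1)) (x i)) (tmap s (c (-1)) (y i)).
Proof.
have /choice[X XP] : forall i, exists V, V (-1) = x i /\ forall t, parallel_at c V t.
  by move=> i; have [V V1 pV] := parallel_exists sc (-1) (x i); exists V.
have /choice[Y YP] : forall i, exists V, V (-1) = y i /\ forall t, parallel_at c V t.
  by move=> i; have [V V1 pV] := parallel_exists sc (-1) (y i); exists V.
pose S i t := sff f (c t) (X i t) (Y i t).
pose eta t : 'rV[R]_n := \sum_i a i *: S i t.
have sS i t : smf (f \o c) (S i) t.
  have [_ /(_ t)[sX _]] := XP i; have [_ /(_ t)[sY _]] := YP i.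
  exact: (smf_sff sf (sc t) sX sY).
have nS i t : normal_space f (c t) (S i t) by exact: sff_normal.
have cS i t : normal_part f (c t) (covd (f \o c) (S i) t 1) = 0.
  have [_ /(_ t)[sX X0]] := XP i; have [_ /(_ t)[sY Y0]] := YP i.
  apply: etrans (covd_perp_sff hf hpar (sc t) sX sY) _.
  rewrite [covd c (X i) t 1]X0 [covd c (Y i) t 1]Y0.
  have z u : sff f (c t) 0 u = 0.
    have := sff_linl sf (c t) (-1) 0 0 u.
    by rewrite scaler0 addr0 scaleN1r addNr.
  by rewrite z [sff _ _ _ 0](sffC sf) z addr0.
have neta t : normal_space f (c t) (eta t) by exact: normal_space_sum.
have sa i t : smooth_at (fun _ : R => a i) t by exact: (smooth_at_cst (a i)).
have seta t : smf (f \o c) eta t.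
  by apply: smf_sum => i _; exact: (smfZ (sa i t) (sS i t)).
have ceta t : covd_perp_curve f c eta t = 0.
  apply: etrans (congr1 (normal_part f (c t)) (covd_sum (1 : R) (index_enum _)
    (a := fun i _ => a i) (fun i => sa i t) (fun i => sS i t))) _.
  rewrite normal_part_sum big1// => i _.
  rewrite derive_cst scale0r add0r; apply: etrans (normal_partZ f (c t) _ _) _.
  by rewrite cS scaler0.
have eta1 : eta (-1) = \sum_i a i *: sff f (c (-1)) (x i) (y i).
  by apply: eq_bigr => i _; rewrite /S; have [-> _] := XP i; have [-> _] := YP i.
have eta2 : eta 1 = \sum_i a i *: sff f (c 1) (tmap s (c (-1)) (x i)) (tmap s (c (-1)) (y i)).
  apply: eq_bigr => i _; rewrite /S; have [X1 pX] := XP i; have [Y1 pY] := YP i.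
  rewrite (parallel_reflection pX 1) (parallel_reflection pY 1) X1 Y1.
  by rewrite (sff_opp hf).
have sfc u : smc (f \o c) u by exact: smc_comp.
split=> [[xi [nxi /(smooth_along_curveP _ sfc) sxi cxi xi1 <-]]|->].
  rewrite -eta2; apply: (normal_parallel_unique nxi neta sxi seta cxi ceta (t0 := -1)).
  exact (etrans xi1 (esym eta1)).
exists eta; split; [exact: neta|exact/(smooth_along_curveP _ sfc)|exact: ceta| |].
  exact: eta1.
exact: eta2.
Qed.

End Reflection.

(** * Isometries of the ambient space that extend a symmetry *)

Section Extrinsic.
Context {R : realType} {m n : nat} {M : riemannian R m} {N : riemannian R n}.
Variables (f : M -> N) (s : M -> M) (g : N -> N).
Hypothesis sf : smooth_map f.
Hypothesis hs : involutive_isometry s.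
Hypothesis hg : involutive_isometry g.
Hypothesis gf : forall q, g (f q) = f (s q).

Let ss : smooth_map s. Proof. by have [] := hs. Qed.
Let sg : smooth_map g. Proof. by have [] := hg. Qed.
Let gfE : g \o f = f \o s. Proof. exact/funext. Qed.

Lemma tmap_intertwine q x : tmap g (f q) (tmap f q x) = tmap f (s q) (tmap s q x).
Proof.
apply: etrans (esym (tmap_comp q x sg sf)) _; rewrite gfE.
exact: tmap_comp.
Qed.

(** The composition formula for g o f = f o s, in which the terms with [sff g] and [sff s] vanish
    because both maps are isometries. *)
Lemma tmap_sff_intertwine q x y :
  tmap g (f q) (sff f q x y) = sff f (s q) (tmap s q x) (tmap s q y).
Proof.
have := sff_comp q x y sg sf; rewrite gfE.
move=> E; have := etrans (esym (sff_comp q x y sf ss)) E.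
rewrite (sff_isometry _ _ _ hs) (sff_isometry _ _ _ hg) tmap0 addr0 add0r.
exact: esym.
Qed.

Lemma tmap_gensum_intertwine (A : finType) q (y : A -> R) h :
  tmap g (f q) (gensum f q y h) = gensum f (s q) y (fun a => push (tmap s q) (h a)).
Proof.
rewrite /gensum tmap_sum; apply: eq_bigr => a _; rewrite tmapZ; congr (_ *: _).
case: (h a) => [x|[x z]]; first exact: tmap_intertwine.
exact: tmap_sff_intertwine.
Qed.

End Extrinsic.

Theorem theorem9 (R : realType) (m n : nat)
    (M : riemannian R m) (N : riemannian R n)
    (sN : N -> N -> N) (sM : M -> M -> M) (f : M -> N)
    (hN : symmetric_space sN)
    (hM : symmetric_space sM)
    (hM1 : simply_connected R M)
    (hf : isometric_immersion f)
    (hpar : parallel_immersion f) :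
  forall p : M,
  let abc (S : osc_bundle f -> osc_bundle f) :=
    [/\ bundle_hom_along (sM p) S /\ fibrewise_isometric (sM p) S,
        bijective S /\ parallel_bundle_map (sM p) S &
        reflection_at S p] in
  exists Sigma : osc_bundle f -> osc_bundle f,
    [/\ involutive Sigma,
        abc Sigma &
        forall S, abc S -> S = Sigma] /\
    [/\ (* (d) *)
        forall (q : M) (x y : 'rV[R]_m) (e : osc_bundle f), obase e = q ->
          (ovec e = tmap f q x ->
             obase (Sigma e) = sM p q /\
             ovec (Sigma e) = tmap f (sM p q) (tmap (sM p) q x)) /\
          (ovec e = sff f q x y ->
             obase (Sigma e) = sM p q /\
             ovec (Sigma e)
             = sff f (sM p q) (tmap (sM p) q x) (tmap (sM p) q y)),
        (* (e) *)
        forall gamma : R -> M, geodesic_line gamma -> gamma 0 = p ->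
          [/\ sM p (gamma (-1)) = gamma 1,
              forall (e : osc_bundle f) (x y : 'rV[R]_m),
                obase e = gamma (-1) -> ovec e = tmap f (gamma (-1)) x ->
                (parallel_displacement gamma (-1) 1 x y <->
                 obase (Sigma e) = gamma 1 /\
                 ovec (Sigma e) = - tmap f (gamma 1) y) &
              forall (e : osc_bundle f) (w : 'rV[R]_n),
                obase e = gamma (-1) ->
                first_normal_space f (gamma (-1)) (ovec e) ->
                (normal_displacement f gamma (-1) 1 (ovec e) w <->
                 obase (Sigma e) = gamma 1 /\ ovec (Sigma e) = w)] &
        (* (f) *)
        forall sperp : M -> N -> N, symmetric_submanifold f sM sperp ->
          (forall q v, osc_space f q v ->
             osc_space f (sM p q) (tmap (sperp p) (f q) v)) /\
          (forall e : osc_bundle f,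
             obase (Sigma e) = sM p (obase e) /\
             ovec (Sigma e) = tmap (sperp p) (f (obase e)) (ovec e))].
Proof.
move=> p abc; have [cM symM] := hM; have [hs sp sp1] := symM p.
have [sf isof] := hf; have [_ inv _] := hs.
have inv4 := sff4_invariant hf hpar hs cM sp sp1.
have [Sigma SP] := osc_map_exists hf hs inv4.
have par := extends_generators_parallel hf hpar hs inv4 SP.
have SS := extends_generators_involutive hs SP.
have bS e : obase (Sigma e) = sM p (obase e) by have [] := SP e.
exists Sigma; split; split.
- exact: SS.
- split; [split| |].
  + exact (extends_generators_bundle_hom hf hpar hs SP).
  + exact (extends_generators_isometric hf hs inv4 SP).
  + by split; [exists Sigma|exact par].
  + exact (extends_generators_reflection hf SP sp sp1).
(* Condition (c) fixes a map on the whole fibre over p, where every vector is tangential plus first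
   normal; parallelism propagates the equality to all fibres. *)
- move=> S [_ [_ parS] reflS].
  apply: (parallel_bundle_map_uniq hf hpar hs inv4 cM parS par (p := p)) => e be.
  have reflSigma := extends_generators_reflection hf SP sp sp1.
  have [x [xi [nxi vE]]] := ovecP e; rewrite be in nxi vE.
  have [b1 v1] := reflS e x xi be nxi vE; have [b2 v2] := reflSigma e x xi be nxi vE.
  by apply: osc_bundle_eq; [rewrite b1 b2|rewrite v1 v2].
- move=> q x y e be; rewrite bS be; split=> vE.
    have H := extends_generators_gen SP (e := e) (g := inl x); rewrite be in H.
    exact (conj (erefl _) (H vE)).
  have H := extends_generators_gen SP (e := e) (g := inr (x, y)); rewrite be in H.
  exact (conj (erefl _) (H vE)).
- move=> gamma gg g0.
  have refl1 : sM p (gamma (-1)) = gamma 1.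
    exact (congr1 (fun c => c (1 : R)) (geodesic_reflection hs sp sp1 gg g0)).
  split; [exact refl1|move=> e x y be vE|move=> e w be [k [a [x [y vE]]]]].
    have vS : ovec (Sigma e) = tmap f (gamma 1) (tmap (sM p) (gamma (-1)) x).
      have H := extends_generators_gen SP (e := e) (g := inl x); rewrite be refl1 in H.
      exact (H vE).
    rewrite bS be refl1 vS.
    split=> [/(parallel_displacement_reflection hs sp sp1 gg g0) ->|[_]].
      by rewrite tmapN opprK.
    (* Equality of the images in N descends to M because Tf is isometric, hence injective. *)
    rewrite -tmapN => /(tmap_inj isof) yE.
    by apply/(parallel_displacement_reflection hs sp sp1 gg g0); rewrite yE opprK.
  have vS : ovec (Sigma e) = \sum_i a i *: sff f (gamma 1)
      (tmap (sM p) (gamma (-1)) (x i)) (tmap (sM p) (gamma (-1)) (y i)).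
    have H := extends_generators_normal SP (e := e) (a := a) (x := x) (y := y).
    by rewrite be refl1 in H; exact (H vE).
  rewrite bS be refl1 vE vS.
  have H := normal_displacement_reflection hs sp sp1 gg g0 hf hpar a x y w.
  split=> [/H wE|[_ wE]]; first exact (conj (erefl _) (esym wE)).
  exact (H.2 (esym wE)).
(* The tangent map of the extrinsic symmetry acts on any presentation of an osculating vector by the
   rule that characterizes [Sigma]. *)
- move=> sperp [_ _ _ /(_ p)[hg _ gf _ _]].
  split=> [q v /osc_gensum[A [y [g ->]]]|e].
    rewrite (tmap_gensum_intertwine sf hs hg gf); exact: osc_space_gensum.
  split; first exact: bS.
  have [A [y [g vE]]] := osc_gensum (ovecP e).
  have [_ SE] := SP e; rewrite (SE _ _ _ vE) vE.
  by rewrite (tmap_gensum_intertwine sf hs hg gf).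
Qed.
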